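(* For $k\ge1$ and $h\in(0,1]$ let $$u_{k,\pm}(t,x,y)=\frac1h\int_{\mathbb{R}}e^{\pm it\sqrt{\lambda_k(\eta/h)}}\,e^{iy\eta/h}\,\psi(\eta)\,e_k(x,\eta/h)\,d\eta,\qquad u_{k,0}(x,y)=u_{k,\pm}(0,x,y).$$ Strichartz estimates hold for any data of the form $u_{k,0}$, $k\geq 1$, uniformly in $k$: there exists a universal constant $C$ such that, for all $(q,r)$ satisfying $q\ge4$ and $\frac1q=\frac12\big(\frac12-\frac1r\big)$, and with $\beta=2\big(\frac12-\frac1r\big)-\frac1q$, $$\|u_{k,\pm}\|_{L^q_t(L^r(\Omega_2))}\le C\,h^{-\beta}\,\|u_{k,0}\|_{L^2(\Omega_2)}.$$
   Context: $\Omega_2=\{(x,y)\in\mathbb{R}^2:x>0\}$ with measure $dx\,dy$. $\psi\in C_0^\infty([\frac12,\frac32])$. Let $Ai$ be the Airy function and $\{-\omega_k\}_{k\ge1}$ its zeros in decreasing order. Set $\lambda_k(\theta)=|\theta|^2+\omega_k|\theta|^{4/3}$ and $$e_k(x,\theta)=\frac{\sqrt{2\pi}\,|\theta|^{1/3}}{\sqrt{L'(\omega_k)}}\,Ai\big(|\theta|^{2/3}x-\omega_k\big),\qquad L'(\omega_k)=2\pi\int_0^\infty Ai^2(x-\omega_k)\,dx,$$ so that $e_k(\cdot,\theta)$ are the $L^2(\mathbb{R}_+)$-normalized Dirichlet eigenfunctions of $-\partial_x^2+(1+x)\theta^2$ with eigenvalues $\lambda_k(\theta)$. The functions $u_{k,\pm}$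 solve the half-wave equations for $\Delta_F=\partial_x^2+(1+x)\partial_y^2$ with Dirichlet condition (gallery modes). As throughout the paper, estimates are local in time: $L^q_t$ is over a fixed bounded time interval ($|t|\lesssim1$). $L^r$ with $r=\infty$ is allowed ($q=4$). *)

(* Defs.v *)
From mathcomp Require Import all_boot all_order all_algebra.
From mathcomp Require Import all_classical all_reals all_analysis.
From mathcomp Require Import complex.

Set Implicit Arguments.
Unset Strict Implicit.
Unset Printing Implicit Defensive.

Import Order.TTheory GRing.Theory Num.Theory.
Import numFieldNormedType.Exports.

Local Open Scope classical_set_scope.
Local Open Scope complex_scope.
Local Open Scope ring_scope.

Section GalleryModes.
Context {R : realType}.

(* The integral is only conditionally convergent, hence the limit of integrals
   over bounded intervals rather than a Lebesgue integral over [0, +oo[. *)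
Definition Ai (x : R) : R :=
  pi^-1 * lim ((\int[lebesgue_measure]_(s in `[0, A]) cos (s ^+ 3 / 3 + s * x))
                 @[A --> +oo]).

(* Only the values [omega k] with [1 <= k] are meaningful. *)
Definition airy_zeros (omega : nat -> R) : Prop :=
  (forall k, (1 <= k)%N -> omega k < omega k.+1) /\
  [set - omega k | k in [set k | (1 <= k)%N]] = [set z | Ai z = 0].

Definition Lprime (w : R) : R :=
  2 * pi * \int[lebesgue_measure]_(x in `[0, +oo[) (Ai (x - w) ^+ 2).

(* Eigenvalues and L2-normalized Dirichlet eigenfunctions of
   - d^2/dx^2 + (1 + x) theta^2 on the half-line. *)
Definition gallery_eigval (omega : nat -> R) (k : nat) (theta : R) : R :=
  `|theta| ^+ 2 + omega k * `|theta| `^ (4 / 3).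

Definition gallery_eigfun (omega : nat -> R) (k : nat) (x theta : R) : R :=
  Num.sqrt (2 * pi) * `|theta| `^ (1 / 3) / Num.sqrt (Lprime (omega k))
  * Ai (`|theta| `^ (2 / 3) * x - omega k).

Definition expi (a : R) : R[i] := cos a +i* sin a.

Definition cintegral (f : R -> R[i]) : R[i] :=
  (\int[lebesgue_measure]_s complex.Re (f s))
  +i* (\int[lebesgue_measure]_s complex.Im (f s)).

(* [s = false] is the sign +, [s = true] is the sign -. *)
Definition gallery_mode (psi : R -> R[i]) (omega : nat -> R) (k : nat) (h : R)
    (s : bool) (t x y : R) : R[i] :=
  (h^-1)%:C * cintegral (fun eta =>
    expi ((-1) ^+ s * t * Num.sqrt (gallery_eigval omega k (eta / h)))
    * expi (y * eta / h) * psi eta * (gallery_eigfun omega k x (eta / h))%:C).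

Definition smooth (f : R -> R) : Prop :=
  forall (n : nat) (x : R), derivable (derive1n n f) x 1.

Definition smooth_supported (a b : R) (psi : R -> R[i]) : Prop :=
  [/\ smooth (fun x => complex.Re (psi x)), smooth (fun x => complex.Im (psi x))
    & forall x, x \notin `[a, b] -> psi x = 0].

Definition Omega2 : set (R * R) := [set z | 0 < z.1].

Definition Lr_Omega2 (r : \bar R) (v : R -> R -> R[i]) : \bar R :=
  'N[(lebesgue_measure \x lebesgue_measure)%E]_r
    [(fun z : R * R => (Normc.normc (v z.1 z.2))%:E) \_ Omega2].

Definition Lq_Lr (T : R) (q r : \bar R) (v : R -> R -> R -> R[i]) : \bar R :=
  'N[lebesgue_measure]_q [(fun t : R => Lr_Omega2 r (v t)) \_ `[- T, T]].

(* For a Lebesgue exponent [p >= 1], with the convention 1/oo = 0. *)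
Definition recip (p : \bar R) : R := fine (p^-1)%E.

End GalleryModes.

(* Main.v *)
(* Put kap = h^(1/3) and w = omega k. The rescaled mode is an oscillatory
   integral over eta in [1/2, 3/2], divided by kap^4 |Ai'(-w)|. Plancherel in y
   and the normalization of e_k give |u(t)|_2^2 = (2 pi / h) int |psi|^2 for all
   t, so that only a dispersive bound remains. The energy z Ai^2 - Ai'^2 is
   monotone, which controls Ai on [-w, 0] uniformly in w: the integrals of the
   absolute values are O(w^(-1/4)), the amplitudes have total variation
   O(w^(5/4)), and Ai'(-w)^2 >= c w^(1/2). Hence |u| <= C kap^-4 w^(-1/2) always,
   and, when w kap^2 <= 1, van der Corput's lemma, with a phase whose second
   derivative is at least |t| w / (36 kap) in absolute value, gives
   |u| <= C kap^-4 (w kap / |t|)^(1/2). Combining the two, |u(t)|_oo^4 <= b(t)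
   with the integral of b over [-T, T] at most C h^-5, uniformly in k. This is
   the endpoint (q, r) = (4, oo); interpolating |u(t)|_r between |u(t)|_2 and
   |u(t)|_oo gives the other exponents. *)

Require Import Defs.
From mathcomp Require Import all_boot all_order all_algebra.
From mathcomp Require Import all_classical all_reals all_analysis.
From mathcomp Require Import measurable_realfun ess_sup_inf complex ring lra.

Set Implicit Arguments.
Unset Strict Implicit.
Unset Printing Implicit Defensive.

Import Order.TTheory GRing.Theory Num.Theory.
Import numFieldNormedType.Exports.

Local Open Scope classical_set_scope.
Local Open Scope ring_scope.

(** The exponents balance as follows. By conservation |u|_2^4 is of order h^-2, while the time
    integral of |u|_oo^4 is allowed to be of order h^-5; the quotient h^-3 is h^(-4 beta) with beta
    = 3/4, and beta = 3/q for general q. The obstacle is uniformity in k. The Airy factor itself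
    oscillates, the more so the larger w is. It is not split into two travelling waves but left
    whole in the amplitude, at the price of a variation w^(5/4) against an L1 norm w^(-1/4). This
    loss is harmless: with a = kap^-16 w^-2 the two bounds on |u|^4 are, up to constants, a and a
    (kap w^2)^2 / t^2. Their minimum integrates over all times to a multiple of a kap w^2 = kap^-15
    = h^-5, and w has cancelled. No asymptotic expansion of Ai enters. The estimates on it use only
    the Airy equation, a crude decay at +oo and the existence of a largest zero, and are therefore
    stated for an abstract solution [y]. *)

Local Notation leb := lebesgue_measure.

(** * Calculus on intervals and van der Corput's lemma *)

Section Calculus.
Context {R : realType}.
Implicit Types (f g : R -> R) (a b x l m : R).

Lemma is_derive_lambda_cst c x : is_derive x 1 (fun _ : R => c) (0 : R).
Proof. exact: is_derive_cst. Qed.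

Lemma is_derive_lambda_id x : is_derive x 1 (fun y : R => y) (1 : R).
Proof. exact: is_derive_id. Qed.

Lemma is_derive_lambdaD f g x l m : is_derive x 1 f l -> is_derive x 1 g m ->
  is_derive x 1 (fun y => f y + g y) (l + m).
Proof. exact: is_deriveD. Qed.

Lemma is_derive_lambdaN f x l : is_derive x 1 f l ->
  is_derive x 1 (fun y => - f y) (- l).
Proof. exact: is_deriveN. Qed.

Lemma is_derive_lambdaM f g x l m : is_derive x 1 f l -> is_derive x 1 g m ->
  is_derive x 1 (fun y => f y * g y) (f x * m + g x * l).
Proof. exact: is_deriveM. Qed.

Lemma is_derive_lambdaX n f x l : is_derive x 1 f l ->
  is_derive x 1 (fun y => f y ^+ n) (n%:R * f x ^+ n.-1 * l).
Proof.
move=> df; have -> : (fun y => f y ^+ n) = f ^+ n.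
  by apply/funext => y; rewrite exprfctE.
exact: is_deriveX.
Qed.

Lemma is_derive_lambdaV f x l : f x != 0 -> is_derive x 1 f l ->
  is_derive x 1 (fun y => (f y)^-1) (- (f x) ^- 2 * l).
Proof. exact: is_deriveV. Qed.

Lemma is_derive_lambda_comp f g x l m : is_derive (g x) 1 f l ->
  is_derive x 1 g m -> is_derive x 1 (fun y => f (g y)) (l * m).
Proof. exact: is_derive1_comp. Qed.

End Calculus.

Ltac derive_step :=
  match goal with
  | |- is_derive _ _ (fun _ => ?c) _ => eapply (is_derive_lambda_cst c)
  | |- is_derive _ _ (fun y => y) _ => eapply is_derive_lambda_id
  | |- is_derive _ _ (fun y => @?f y + @?g y) _ =>
      eapply (@is_derive_lambdaD _ f g)
  | |- is_derive _ _ (fun y => - @?f y) _ => eapply (@is_derive_lambdaN _ f)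
  | |- is_derive _ _ (fun y => @?f y * @?g y) _ =>
      eapply (@is_derive_lambdaM _ f g)
  | |- is_derive _ _ (fun y => (@?f y) ^+ ?n) _ =>
      eapply (@is_derive_lambdaX _ n f)
  | |- is_derive _ _ (fun y => (@?f y)^-1) _ => eapply (@is_derive_lambdaV _ f)
  | |- is_derive _ _ (fun y => cos (@?g y)) _ =>
      eapply (@is_derive_lambda_comp _ cos g); [eapply is_derive_cos|]
  | |- is_derive _ _ (fun y => sin (@?g y)) _ =>
      eapply (@is_derive_lambda_comp _ sin g); [eapply is_derive_sin|]
  | |- is_derive _ _ (fun y => atan (@?g y)) _ =>
      eapply (@is_derive_lambda_comp _ atan g); [eapply is_derive1_atan|]
  end.

Ltac feed H :=
  match type of H with
  | ?P -> _ => let h := fresh in assert (h : P); [|specialize (H h); clear h]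
  end.
Ltac feed3 H := feed H; [|feed H; [|feed H]].

Lemma is_derive_lambda_linear {R : realType} (c x : R) :
  is_derive x 1 (fun y => c * y) c.
Proof.
by eapply is_derive_eq; [eapply (@is_derive_lambdaM _ (fun=> c) (fun y => y));
  [exact: is_derive_lambda_cst|exact: is_derive_lambda_id]|rewrite /=; ring].
Qed.

(** * Comparison of functions through their derivatives *)

Section Comparison.
Context {R : realType}.
Implicit Types (f g : R -> R) (a b x l m : R).

Lemma is_derive1_continuous f x l : is_derive x 1 f l -> {for x, continuous f}.
Proof.
by move=> [df _]; apply/differentiable_continuous/derivable1_diffP.
Qed.

(** By the mean value theorem [g + f] and [g - f] are both nondecreasing. This stands in for the
    integral of |f'| throughout: a total variation is always carried by a primitive [g] of a
    majorant of |f'|. *)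
Lemma derive_comparison f g (f' g' : R -> R) a b : a <= b ->
  (forall x, a <= x <= b -> is_derive x 1 f (f' x)) ->
  (forall x, a <= x <= b -> is_derive x 1 g (g' x)) ->
  (forall x, a <= x <= b -> `|f' x| <= g' x) ->
  `|f b - f a| <= g b - g a.
Proof.
move=> ab df dg fg.
have key (h h' : R -> R) : (forall x, a <= x <= b -> is_derive x 1 h (h' x)) ->
    (forall x, a <= x <= b -> 0 <= h' x) -> h a <= h b.
  move=> dh h0.
  have [||c] := @MVT_segment _ h h' a b ab.
  - by move=> x; rewrite in_itv/= => /andP[? ?]; apply: dh; rewrite !ltW.
  - apply: continuous_in_subspaceT => x; rewrite inE/= in_itv/= => /dh.
    exact: is_derive1_continuous.
  - rewrite in_itv/= => /h0 c0 e.
    by rewrite -subr_ge0 e mulr_ge0// subr_ge0.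
have h1 : g a + f a <= g b + f b.
  apply: (key (fun x => g x + f x) (fun x => g' x + f' x)) => x ax.
    by apply: is_derive_lambdaD; [exact: dg|exact: df].
  by have := fg _ ax; rewrite ler_norml => /andP[]; lra.
have h2 : g a - f a <= g b - f b.
  apply: (key (fun x => g x - f x) (fun x => g' x - f' x)) => x ax.
    by apply: is_derive_lambdaD; [exact: dg|exact/is_derive_lambdaN/df].
  by have := fg _ ax; rewrite ler_norml => /andP[]; lra.
by rewrite ler_norml; apply/andP; split; lra.
Qed.

Lemma derive_ge0_le f (f' : R -> R) a b : a <= b ->
  (forall x, a <= x <= b -> is_derive x 1 f (f' x)) ->
  (forall x, a <= x <= b -> 0 <= f' x) -> f a <= f b.
Proof.
move=> ab df f0.
have := @derive_comparison (fun=> 0) f (fun=> 0) f' a b ab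
  (fun x _ => is_derive_lambda_cst _ _) df.
by rewrite subrr normr0 subr_ge0; apply => x /f0.
Qed.

Lemma continuous_integrable_itv f a b : (forall x, a <= x <= b -> {for x, continuous f}) ->
  lebesgue_measure.-integrable `[a, b] (EFin \o f).
Proof.
move=> cf; apply: continuous_compact_integrable; first exact: segment_compact.
apply: continuous_in_subspaceT => x; rewrite inE/= in_itv/= => ?; exact: cf.
Qed.

(** The integral from a base point m is a primitive only to the right of m. Subtracting its value at
    0 makes the choices of m agree, so these local primitives glue to one on the whole line. *)
Lemma continuous_primitive f : continuous f ->
  exists F : R -> R, forall x, is_derive x 1 F (f x).
Proof.
move=> cf; have intf a b := @continuous_integrable_itv f a b (fun x _ => cf x).
pose G m x := \int[lebesgue_measure]_(t in `[m, x]) f t.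
have dG m x : m < x -> is_derive x 1 (G m) (f x).
  move=> mx.
  have [||d e] := @continuous_FTC1 _ f (BLeft m) x (x + 1) _ (intf _ _) _ (cf x).
  - by rewrite ltrDl.
  - by rewrite /= lte_fin.
  exact: DeriveDef d (etrans (esym (derive1E _ _)) e).
have GB m n x : m <= n -> n < x -> G m x - G n x = G m n.
  move=> mn nx; rewrite /G.
  rewrite -[X in _ - X](@Rintegral_itv_obnd_cbnd _ n (BRight x) f).
    rewrite -(@Rintegral_itvB _ f (BLeft m) (BRight x) n (intf _ _)) ?bnd_simp//.
      by lra.
    exact: ltW.
  by apply: integrableS (intf n x) => //; apply: subset_itv; rewrite bnd_simp.
pose F x := if 0 < x then G 0 x else G (x - 1) x - G (x - 1) 0.
have FE m x : m < 0 -> m < x -> F x = G m x - G m 0.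
  move=> m0 mx; rewrite /F; case: ltP => x0.
    by rewrite -(GB m 0 x) ?ltW//; lra.
  have G0 k : k < 0 -> k < x -> G k x - G k 0 = - \int[lebesgue_measure]_(t in `]x, 0]) f t.
    move=> k0 kx; rewrite /G.
    have := @Rintegral_itvB _ f (BLeft k) (BRight 0) x (intf _ _).
    rewrite !bnd_simp => <-; rewrite ?opprB ?(ltW kx)//.
  by rewrite !G0//; lra.
exists F => x.
(* [m] is negative and at distance at least 1 below [x], so [FE] applies on a neighbourhood of
   [x]. *)
pose m := Num.min x 0 - 1.
have m0 : m < 0 by rewrite /m; case: (leP x 0); lra.
have mx : m < x by rewrite /m; case: (leP x 0); lra.
apply: (@near_eq_is_derive _ _ _ (fun y => G m y - G m 0)).
- near=> y; rewrite (FE m)//; near: y.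
  by exists (x - m) => /=; [lra|move=> y /=; rewrite ltr_norml => /andP[]; lra].
- rewrite -[f x]addr0; apply: is_derive_lambdaD; first exact: dG.
Unshelve. all: by end_near. Qed.

Lemma FTC_itv F f a b : a <= b ->
  (forall x, a <= x <= b -> is_derive x 1 F (f x)) ->
  (forall x, a <= x <= b -> {for x, continuous f}) ->
  \int[lebesgue_measure]_(t in `[a, b]) f t = F b - F a.
Proof.
rewrite le_eqVlt => /predU1P[<- _ _|ab dF cf].
  by rewrite set_itv1 Rintegral_set1 subrr.
rewrite /Rintegral (@continuous_FTC2 _ f F a b ab)//.
- apply: continuous_in_subspaceT => x; rewrite inE/= in_itv/= => ?; exact: cf.
- have cF x : a <= x <= b -> {for x, continuous F}.
    by move=> /dF; exact: is_derive1_continuous.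
  split.
  + by move=> x; rewrite in_itv/= => /andP[? ?]; have [] := dF x _; rewrite ?ltW.
  + by apply: cvg_at_right_filter; apply: cF; rewrite lexx ltW.
  + by apply: cvg_at_left_filter; apply: cF; rewrite lexx ltW.
- move=> x; rewrite in_itv/= => /andP[? ?]; rewrite derive1E.
  by have [] := dF x _; rewrite ?ltW.
Qed.

(** Clamping the argument to [a, b] turns [f] into a function continuous on the whole line. *)
Lemma continuous_primitive_itv f a b : a <= b ->
  (forall x, a <= x <= b -> {for x, continuous f}) ->
  exists F : R -> R, forall x, a <= x <= b -> is_derive x 1 F (f x).
Proof.
move=> ab cf; pose g x := f (Num.max a (Num.min x b)).
have cg : continuous g.
  move=> x; rewrite /g; apply: (@continuous_comp _ _ _ (fun x => Num.max a (Num.min x b)) f).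
    apply: continuous_max; first exact: cvg_cst.
    by apply: continuous_min; [exact: cvg_id|exact: cvg_cst].
  by apply: cf; rewrite le_max lexx/= ge_max ab/= ge_min lexx orbT.
have [F dF] := continuous_primitive cg.
exists F => x /andP[ax xb]; have := dF x; rewrite /g.
by rewrite (min_idPl xb) (max_idPr ax).
Qed.

(** Integration by parts in inequality form: [h] is the boundary term and [k] a primitive of a
    majorant of the remaining integrand. *)
Lemma Rintegral_comparison f (h h' k k' : R -> R) a b : a <= b ->
  (forall x, a <= x <= b -> {for x, continuous f}) ->
  (forall x, a <= x <= b -> is_derive x 1 h (h' x)) ->
  (forall x, a <= x <= b -> is_derive x 1 k (k' x)) ->
  (forall x, a <= x <= b -> `|f x - h' x| <= k' x) ->
  `|\int[lebesgue_measure]_(t in `[a, b]) f t - (h b - h a)| <= k b - k a.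
Proof.
move=> ab cf dh dk le.
have [F dF] := continuous_primitive_itv ab cf.
rewrite (FTC_itv ab dF cf).
have -> : F b - F a - (h b - h a) = (F b - h b) - (F a - h a) by ring.
apply: (@derive_comparison (fun x => F x - h x) k (fun x => f x - h' x) k') => //.
move=> x ax; apply: is_derive_lambdaD; first exact: dF.
exact/is_derive_lambdaN/dh.
Qed.

Lemma Rintegral_itv_le_primitive f (k k' : R -> R) a b : a <= b ->
  (forall x, a <= x <= b -> {for x, continuous f}) ->
  (forall x, a <= x <= b -> is_derive x 1 k (k' x)) ->
  (forall x, a <= x <= b -> `|f x| <= k' x) ->
  `|\int[lebesgue_measure]_(t in `[a, b]) f t| <= k b - k a.
Proof.
move=> ab cf dk le.
have := @Rintegral_comparison f (fun=> 0) (fun=> 0) k k' a b ab cf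
  (fun x _ => is_derive_lambda_cst _ _) dk.
by rewrite subrr subr0; apply => x /le; rewrite subr0.
Qed.

(* Integrating by parts against v / (v^2 + l), which behaves like 1 / v away
   from the stationary point and is bounded by 1 / sqrt l near it, treats both
   regions at once. *)
Lemma van_der_Corput_primitive (P P' P'' F : R -> R) l a b : a <= b -> 0 < l ->
  (forall x, a <= x <= b -> is_derive x 1 P (P' x)) ->
  (forall x, a <= x <= b -> is_derive x 1 P' (P'' x)) ->
  (forall x, a <= x <= b -> l <= P'' x) ->
  (forall x, a <= x <= b -> is_derive x 1 F (cos (P x))) ->
  `|F b - F a| <= (2 * pi + 1) / Num.sqrt l.
Proof.
move=> ab l0 dP dP' lP dF.
set r := Num.sqrt l.
have r0 : 0 < r by rewrite sqrtr_gt0.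
have rl : l = r ^+ 2 by rewrite sqr_sqrtr ?ltW.
have v0 (v : R) : 0 < v ^+ 2 + l by rewrite ltr_wpDl// sqr_ge0.
pose p v := v / (v ^+ 2 + l).
have dp (v : R) : is_derive v (1 : R) p ((l - v ^+ 2) / (v ^+ 2 + l) ^+ 2).
  rewrite /p; eapply is_derive_eq; first by repeat derive_step; rewrite gt_eqF.
  by have := v0 v => ? /=; field; rewrite gt_eqF.
have p1 (v : R) : `|p v| <= 2^-1 / r.
  rewrite normrM normfV (gtr0_norm (v0 v)) ler_pdivrMr// mulrAC ler_pdivlMr// rl.
  have := sqr_ge0 (`|v| - r); rewrite -(real_normK (num_real v)); nra.
pose h x := sin (P x) * p (P' x).
have h1 x : `|h x| <= 2^-1 / r.
  rewrite normrM -[leRHS]mul1r ler_pM// ler_norml.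
  by rewrite sin_geN1 sin_le1.
have hb : `|h b - h a| <= 1 / r.
  rewrite (le_trans (ler_normB _ _))// (_ : 1 / r = 2^-1 / r + 2^-1 / r) ?lerD//.
  by field; rewrite gt_eqF.
(* [k] is twice a primitive of P'' / (P'^2 + l). The arctangent oscillates by less than pi however
   large [P'] becomes, hence [2 * pi]; the boundary term [h] contributes the remaining 1. *)
pose k x := 2 * (atan (P' x / r) / r).
have kb : k b - k a <= 2 * pi / r.
  rewrite /k -mulrBr -mulrBl -mulrA ler_pM2l// ler_pM2r ?invr_gt0//.
  have := atan_ltpi2 (P' b / r); have := atan_gtNpi2 (P' a / r).
  have := pi_gt0 R; lra.
have main : `|(F b - h b) - (F a - h a)| <= k b - k a.
  apply: (@derive_comparison (fun x => F x - h x) k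
     (fun x => cos (P x) * (l / (P' x ^+ 2 + l))
               - sin (P x) * ((l - P' x ^+ 2) / (P' x ^+ 2 + l) ^+ 2 * P'' x))
     (fun x => 2 * (P'' x / (P' x ^+ 2 + l)))) => //.
  - move=> x ax; eapply is_derive_eq.
      rewrite /h; repeat derive_step; [exact: dF|exact: dP|].
      by apply: (is_derive_lambda_comp (dp _)); exact: dP'.
    rewrite /p; have := v0 (P' x) => ?; field; by rewrite gt_eqF.
  - move=> x ax; eapply is_derive_eq; first by rewrite /k; repeat derive_step; exact: dP'.
    have := v0 (P' x); rewrite rl => ?; field.
    rewrite (gt_eqF r0)/= !gt_eqF//.
  - move=> x ax; have lx := lP _ ax.
    have q0 := v0 (P' x); set q := P' x ^+ 2 + l in q0 *.
    have q1 : `|(l - P' x ^+ 2) / q ^+ 2| <= q^-1.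
      rewrite normrM normfV (ger0_norm (sqr_ge0 q))// ler_pdivrMr ?exprn_gt0//.
      rewrite expr2 mulKf ?gt_eqF// /q ler_norml; have := sqr_ge0 (P' x); lra.
    rewrite (le_trans (ler_normB _ _))// mulr_natl mulr2n lerD//.
      rewrite normrM -[leRHS]mul1r ler_pM//.
        by rewrite ler_norml cos_geN1 cos_le1.
      by rewrite ger0_norm ?ler_pM2r ?invr_gt0 ?lx// divr_ge0// ltW.
    rewrite normrM -[leRHS]mul1r ler_pM//.
      by rewrite ler_norml sin_geN1 sin_le1.
    rewrite normrM mulrC ler_pM// ger0_norm// (le_trans _ lx)//; exact: ltW.
have -> : F b - F a = ((F b - h b) - (F a - h a)) + (h b - h a) by ring.
rewrite (le_trans (ler_normD _ _))// mulrDl.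
by apply: lerD => //; exact: le_trans kb.
Qed.

End Comparison.

(** * Limits at infinity that are uniform in a parameter *)

Section LimitsOfFunctions.
Context {R : realType}.
Implicit Types (f g : R -> R) (x l K : R).

Lemma is_derive_eps f x l :
  (forall e, 0 < e -> exists2 d, 0 < d & forall y, `|y - x| < d ->
     `|f y - f x - (y - x) * l| <= e * `|y - x|) ->
  is_derive x 1 f l.
Proof.
move=> fl; apply/is_derive1_caratheodory.
exists (fun z => if z == x then l else (f z - f x) / (z - x)); split.
- move=> z; case: eqVneq => [->|zx]; first by rewrite !subrr mulr0.
  by rewrite divfK// subr_eq0.
- apply/cvgrPdist_le => e e0; have [d d0 dP] := fl _ e0.
  exists d => //= z; rewrite /= distrC => zd; rewrite eqxx.
  case: eqVneq => [_|zx]; first by rewrite subrr normr0 ltW.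
  have zx0 : 0 < `|z - x| by rewrite normr_gt0 subr_eq0.
  have -> : l - (f z - f x) / (z - x) = - ((f z - f x - (z - x) * l) / (z - x)).
    by field; rewrite subr_eq0.
  by rewrite normrN normrM normfV ler_pdivrMr// dP.
- by rewrite eqxx.
Qed.

Lemma is_derive_quadratic f x l K :
  (forall y, `|f y - f x - (y - x) * l| <= K * (y - x) ^+ 2) ->
  is_derive x 1 f l.
Proof.
move=> fK; apply: is_derive_eps => e e0.
have K1 : 0 < `|K| + 1 by rewrite ltr_wpDl.
exists (e / (`|K| + 1)) => [|y yx]; first by rewrite divr_gt0.
rewrite (le_trans (fK y))// -real_normK ?num_real// expr2 mulrA ler_wpM2r//.
rewrite ltr_pdivlMr// in yx; rewrite (le_trans _ (ltW yx))// mulrC ler_wpM2l//.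
by rewrite (le_trans (ler_norm _))// lerDl.
Qed.

(** The rate [K / A] survives the passage to the limit; it is the uniformity that later allows the
    limit to be differentiated in a parameter. *)
Lemma Cauchy_pinfty f K a : 0 < a -> 0 <= K ->
  (forall A B, a <= A -> A <= B -> `|f B - f A| <= K / A) ->
  exists2 l, f A @[A --> +oo] --> l &
    forall A, a <= A -> `|l - f A| <= K / A.
Proof.
move=> a0 K0 fK.
have cf : cvg (f A @[A --> +oo]).
  apply: cauchy_cvg; apply: cauchy_exP => e e0.
  pose A := Num.max a ((K + 1) / e).
  have A0 : 0 < A by rewrite lt_max a0.
  exists (f A); exists A; split; first exact: num_real.
  move=> B /ltW AB; rewrite /ball/= distrC; apply: le_lt_trans (fK _ _ _ AB) _.
    by rewrite le_max lexx.
  rewrite ltr_pdivrMr// mulrC -ltr_pdivrMr// lt_max.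
  by apply/orP; right; rewrite ltr_pM2r ?invr_gt0// ltrDl.
have [l fl] := (cvg_ex _).1 cf.
exists l => // A aA.
have : (fun B => `|f B - f A|) B @[B --> +oo] --> `|l - f A|.
  by apply: cvg_norm; apply: cvgB => //; exact: cvg_cst.
move=> /cvgr_to_le; apply.
by exists A; split; [exact: num_real|move=> B /ltW; exact: fK].
Qed.

Lemma pinfty_le_cst f l K a : f A @[A --> +oo] --> l ->
  (forall A, a <= A -> f A <= K) -> l <= K.
Proof.
move=> fl fK; apply: (cvgr_to_le fl).
by exists a; split; [exact: num_real|move=> B /ltW; exact: fK].
Qed.

Lemma ler_pdiv_swap (a b c : R) : 0 < b -> 0 < c -> a / c <= b -> a / b <= c.
Proof. by move=> b0 c0; rewrite !ler_pdivrMr// mulrC. Qed.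

(** Between [x] and [y] the comparison lemma applies to f_A(z) - z g(x), whose derivative g_A(z) -
    g(x) is at most e/2 + K/A. Passing from f_A to [f] costs 2K/A, and A may be chosen after [y]. *)
Lemma is_derive_uniform_limit (f_ g_ : R -> R -> R) f g x K a : 0 < a -> 0 <= K ->
  {for x, continuous g} ->
  (forall A y, a <= A -> `|y - x| <= 1 -> is_derive y 1 (f_ A) (g_ A y)) ->
  (forall A y, a <= A -> `|y - x| <= 1 -> `|f y - f_ A y| <= K / A) ->
  (forall A y, a <= A -> `|y - x| <= 1 -> `|g y - g_ A y| <= K / A) ->
  is_derive x 1 f (g x).
Proof.
move=> a0 K0 cg df fK gK; apply: is_derive_eps => e e0.
have e2 : 0 < e / 2 by lra.
have [d d0 dP] : exists2 d, 0 < d & forall y, `|y - x| < d -> `|g y - g x| <= e / 2.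
  move/cvgrPdist_le : cg => /(_ _ e2)[d /= d0 dP]; exists d => // y yd.
  by rewrite distrC; apply: dP; rewrite /= distrC.
exists (Num.min d 1) => [|y]; first by rewrite lt_min d0 ltr01.
rewrite lt_min => /andP[yd y1].
have main A : a <= A ->
    `|f_ A y - f_ A x - (y - x) * g x| <= (e / 2 + K / A) * `|y - x|.
  move=> aA.
  have gA z : `|z - x| <= `|y - x| -> `|g_ A z - g x| <= e / 2 + K / A.
    move=> zy; have -> : g_ A z - g x = (g z - g x) - (g z - g_ A z) by ring.
    rewrite (le_trans (ler_normB _ _))// lerD//.
      by apply: dP; exact: le_lt_trans yd.
    by apply: gK => //; rewrite (le_trans zy)// ltW.
  have dh (z : R) : `|z - x| <= `|y - x| ->
      is_derive z (1:R) (fun z => f_ A z - z * g x) (g_ A z - g x).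
    move=> zy; eapply is_derive_eq.
      repeat derive_step; apply: df => //; exact/(le_trans zy)/ltW.
    by rewrite /=; ring.
  have dk (z : R) : is_derive z (1:R) (fun z => (e / 2 + K / A) * z) (e / 2 + K / A).
    by eapply is_derive_eq; [repeat derive_step|rewrite /=; ring].
  have [xy|/ltW yx] := leP x y.
    have := @derive_comparison _ (fun z => f_ A z - z * g x)
      (fun z => (e / 2 + K / A) * z) (fun z => g_ A z - g x)
      (fun=> e / 2 + K / A) x y xy.
    have zz z : x <= z <= y -> `|z - x| <= `|y - x|.
      by move=> /andP[xz zy]; rewrite !ger0_norm ?subr_ge0// lerB.
    move=> /(_ (fun z zxy => dh z (zz z zxy)) (fun z _ => dk z)
               (fun z zxy => gA z (zz z zxy))).
    rewrite -mulrBr (ger0_norm (_ : 0 <= y - x)) ?subr_ge0//.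
    by congr (`| _ | <= _); ring.
  have := @derive_comparison _ (fun z => f_ A z - z * g x)
    (fun z => (e / 2 + K / A) * z) (fun z => g_ A z - g x)
    (fun=> e / 2 + K / A) y x yx.
  have zz z : y <= z <= x -> `|z - x| <= `|y - x|.
    by move=> /andP[xz zy]; rewrite !ler0_norm ?subr_le0// lerN2 lerB.
  move=> /(_ (fun z zxy => dh z (zz z zxy)) (fun z _ => dk z)
             (fun z zxy => gA z (zz z zxy))).
  rewrite -mulrBr (ler0_norm (_ : y - x <= 0)) ?subr_le0// opprB.
  by rewrite -normrN; congr (`| _ | <= _); ring.
have [->|yx] := eqVneq y x; first by rewrite !subrr mul0r subrr normr0 mulr0.
have yx0 : 0 < `|y - x| by rewrite normr_gt0 subr_eq0.
pose s := e * `|y - x|.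
(* The first term makes the error on the derivative at most e/4, so that the increment costs 3/4 of
   [s]; the second makes each of the two errors on the values at most [s / 8]. The total is [s]. *)
pose r := K / (e / 4) + K / (s / 8).
have s0 : 0 < s by rewrite mulr_gt0.
have r1 : 0 <= K / (e / 4) by apply: divr_ge0 => //; lra.
have r2 : 0 <= K / (s / 8) by apply: divr_ge0 => //; lra.
pose A := a + r.
have aA : a <= A by rewrite lerDl addr_ge0.
have A0 : 0 < A by exact: lt_le_trans aA.
have KA1 : K / A <= e / 4.
  by apply: ler_pdiv_swap => //; [lra|rewrite /A addrCA lerDl addr_ge0// ltW].
have KA2 : K / A <= s / 8.
  apply: ler_pdiv_swap => //; first lra.
  by rewrite /A /r addrA lerDr addr_ge0// ltW.
have f1 := fK _ y aA (ltW y1).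
have f2 : `|f x - f_ A x| <= K / A by apply: fK => //; rewrite subrr normr0.
have -> : f y - f x - (y - x) * g x = (f y - f_ A y) - (f x - f_ A x)
   + (f_ A y - f_ A x - (y - x) * g x) by ring.
rewrite (le_trans (ler_normD _ _))//.
have := ler_normB (f y - f_ A y) (f x - f_ A x).
have := main _ aA.
have : (e / 2 + K / A) * `|y - x| <= (e / 2 + e / 4) * `|y - x|.
  by rewrite ler_wpM2r// lerD2l.
rewrite -/s; have : (e / 2 + e / 4) * `|y - x| = 3 / 4 * s by rewrite /s; field.
lra.
Qed.

Lemma continuous_uniform_limit (f_ : R -> R -> R) f x K a : 0 < a -> 0 <= K ->
  (forall A, a <= A -> {for x, continuous (f_ A)}) ->
  (forall A y, a <= A -> `|y - x| <= 1 -> `|f y - f_ A y| <= K / A) ->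
  {for x, continuous f}.
Proof.
move=> a0 K0 cf fK; apply/cvgrPdist_le => e e0.
have r0 : 0 <= K / (e / 4) by apply: divr_ge0 => //; lra.
pose A := a + K / (e / 4).
have aA : a <= A by rewrite lerDl.
have A0 : 0 < A by exact: lt_le_trans aA.
have KA : K / A <= e / 4.
  by apply: ler_pdiv_swap => //; [lra|rewrite /A lerDr ltW].
have e4 : 0 < e / 4 by lra.
have /cvgrPdist_le/(_ _ e4)[d /= d0 dP] := cf _ aA.
exists (Num.min d 1) => /=; first by rewrite lt_min d0 ltr01.
move=> y /=; rewrite lt_min => /andP[yd y1].
have f1 : `|f y - f_ A y| <= K / A by apply: fK => //; rewrite distrC ltW.
have f2 : `|f x - f_ A x| <= K / A by apply: fK => //; rewrite subrr normr0.
have f3 := dP _ yd.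
have -> : f x - f y = (f x - f_ A x) - (f y - f_ A y) + (f_ A x - f_ A y) by ring.
rewrite (le_trans (ler_normD _ _))//.
have := ler_normB (f x - f_ A x) (f y - f_ A y); lra.
Qed.

End LimitsOfFunctions.

(** * Taylor bounds for sine and cosine *)

Section SineCosine.
Context {R : realType}.
Implicit Types (a d s x A B : R).

Lemma sin_cos_taylor_ge0 d : 0 <= d ->
  [/\ `|sin d| <= d, `|cos d - 1| <= d, `|cos d - 1| <= d ^+ 2 / 2
    & `|sin d - d| <= d ^+ 2 / 2].
Proof.
move=> d0.
have c1 : forall x : R, is_derive x (1:R) (fun x : R => cos x - 1) (- sin x).
  by move=> x; eapply is_derive_eq; [repeat derive_step|rewrite /=; ring].
have i1 : forall x : R, is_derive x (1:R) (fun x : R => x) (1 : R).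
  by move=> x; exact: is_derive_lambda_id.
have q1 : forall x : R, is_derive x (1:R) (fun x : R => x ^+ 2 / 2) x.
  by move=> x; eapply is_derive_eq; [repeat derive_step|rewrite /=; field].
have s1 (e : R) : 0 <= e -> `|sin e| <= e.
  move=> e0.
  have := @derive_comparison _ sin (fun x => x) cos (fun=> 1) 0 e e0
    (fun x _ => is_derive_sin x) (fun x _ => i1 x).
  rewrite sin0 !subr0; apply => x _.
  by rewrite ler_norml cos_geN1 cos_le1.
have c2 (e : R) : 0 <= e -> `|cos e - 1| <= e.
  move=> e0.
  have := @derive_comparison _ _ (fun x => x) _ (fun=> 1) 0 e e0
    (fun x _ => c1 x) (fun x _ => i1 x).
  rewrite cos0 !subrr !subr0; apply => x _.
  by rewrite normrN ler_norml sin_geN1 sin_le1.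
have c3 : `|cos d - 1| <= d ^+ 2 / 2.
  have := @derive_comparison _ _ _ _ (fun x => x) 0 d d0
    (fun x _ => c1 x) (fun x _ => q1 x).
  rewrite cos0 !subrr !subr0 expr0n/= mul0r subr0; apply => x /andP[x0 _].
  by rewrite normrN s1.
have s2 : `|sin d - d| <= d ^+ 2 / 2.
  have sd : forall x : R, is_derive x (1:R) (fun x : R => sin x - x) (cos x - 1).
    by move=> x; eapply is_derive_eq; [repeat derive_step|rewrite /=; ring].
  have := @derive_comparison _ _ _ _ (fun x => x) 0 d d0
    (fun x _ => sd x) (fun x _ => q1 x).
  rewrite sin0 !subr0 expr0n/= mul0r subr0; apply => x /andP[x0 _].
  exact: c2.
by split => //; [exact: s1|exact: c2].
Qed.

Lemma sin_cos_taylor d :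
  `|cos d - 1| <= d ^+ 2 / 2 /\ `|sin d - d| <= d ^+ 2 / 2.
Proof.
have [d0|/ltW d0] := leP 0 d; first by have [] := sin_cos_taylor_ge0 d0.
have [|_ _] := @sin_cos_taylor_ge0 (- d); first by rewrite oppr_ge0.
rewrite cosN sinN sqrrN => ? ?; split => //.
by rewrite -normrN opprD.
Qed.

(** The remainder is quadratic uniformly in [a]. An oscillatory integral over a bounded interval can
    then be differentiated in its parameter through [is_derive_quadratic], without a limit theorem
    for integrals. *)
Lemma cos_taylor a d : `|cos (a + d) - cos a + d * sin a| <= d ^+ 2.
Proof.
have [c s] := sin_cos_taylor d.
have -> : cos (a + d) - cos a + d * sin a
    = cos a * (cos d - 1) - sin a * (sin d - d) by rewrite cosD; ring.
rewrite (le_trans (ler_normB _ _))// !normrM.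
have ca : `|cos a| <= 1 by rewrite ler_norml cos_geN1 cos_le1.
have sa : `|sin a| <= 1 by rewrite ler_norml sin_geN1 sin_le1.
have := ler_pM (normr_ge0 _) (normr_ge0 _) ca c.
have := ler_pM (normr_ge0 _) (normr_ge0 _) sa s.
lra.
Qed.

Lemma sin_taylor a d : `|sin (a + d) - sin a - d * cos a| <= d ^+ 2.
Proof.
have [c s] := sin_cos_taylor d.
have -> : sin (a + d) - sin a - d * cos a
    = sin a * (cos d - 1) + cos a * (sin d - d) by rewrite sinD; ring.
rewrite (le_trans (ler_normD _ _))// !normrM.
have ca : `|cos a| <= 1 by rewrite ler_norml cos_geN1 cos_le1.
have sa : `|sin a| <= 1 by rewrite ler_norml sin_geN1 sin_le1.
have := ler_pM (normr_ge0 _) (normr_ge0 _) sa c.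
have := ler_pM (normr_ge0 _) (normr_ge0 _) ca s.
lra.
Qed.

End SineCosine.

(** * The Airy equation *)

Section AiryFunction.
Context {R : realType}.
Implicit Types (s x y z A B : R).

Let phase x s := s ^+ 3 / 3 + s * x.

Let is_derive_phase x s : is_derive s 1 (phase x) (s ^+ 2 + x).
Proof.
by rewrite /phase; eapply is_derive_eq; [repeat derive_step|rewrite /=; field].
Qed.

Let phase_continuous x : continuous (phase x).
Proof. by move=> s; exact: is_derive1_continuous (is_derive_phase x s). Qed.

Let cos_phase_continuous x : continuous (fun s => cos (phase x s)).
Proof.
by move=> s; apply: continuous_comp; [exact: phase_continuous|exact: continuous_cos].
Qed.

Let sin_phase_continuous x : continuous (fun s => s * sin (phase x s)).
Proof.
move=> s; apply: cvgM; first exact: cvg_id.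
by apply: continuous_comp; [exact: phase_continuous|exact: continuous_sin].
Qed.

(** [C x A] and [S x A] are the integrals over [0, A] of cos(phase) and of s sin(phase); as A tends
    to +oo they converge to pi Ai(x) and - pi Ai'(x). *)
Let oscillatory_primitives : exists C S : R -> R -> R,
  [/\ forall x, C x 0 = 0, forall x, S x 0 = 0,
      forall x s, is_derive s 1 (C x) (cos (phase x s))
    & forall x s, is_derive s 1 (S x) (s * sin (phase x s))].
Proof.
have ex (g : R -> R -> R) : (forall x, continuous (g x)) ->
    exists G : R -> R -> R, (forall x, G x 0 = 0) /\
      forall x s, is_derive s 1 (G x) (g x s).
  move=> cg.
  have /choice[G GP] : forall x, exists G : R -> R,
      G 0 = 0 /\ forall s, is_derive s 1 G (g x s).
    move=> x; have [G dG] := continuous_primitive (cg x).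
    exists (fun s => G s - G 0); split; first by rewrite subrr.
    move=> s; eapply is_derive_eq; first by repeat derive_step; exact: dG.
    by rewrite /=; ring.
  by exists G; split => x; have [] := GP x.
have [C [C0 dC]] := ex _ cos_phase_continuous.
have [S [S0 dS]] := ex _ sin_phase_continuous.
by exists C, S.
Qed.

Section Primitives.
Variables C S : R -> R -> R.
Hypothesis C0 : forall x, C x 0 = 0.
Hypothesis S0 : forall x, S x 0 = 0.
Hypothesis dC : forall x s, is_derive s 1 (C x) (cos (phase x s)).
Hypothesis dS : forall x s, is_derive s 1 (S x) (s * sin (phase x s)).

(** Integration by parts against sin(phase) / phase'. The remainder is dominated by the derivative
    of - 1 / (s^2 + x), and its contribution at B cancels the boundary term at B. *)
Let cos_tail x A B : 0 <= A -> A <= B -> 0 < A ^+ 2 + x ->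
  `|C x B - C x A| <= 2 / (A ^+ 2 + x).
Proof.
move=> A0 AB A2.
have sx s : A <= s -> A ^+ 2 + x <= s ^+ 2 + x.
  by move=> As; rewrite lerD2r lerXn2r// nnegrE// (le_trans A0).
have sx0 s : A <= s -> 0 < s ^+ 2 + x by move=> /sx; exact: lt_le_trans.
have h s : A <= s -> `|sin (phase x s) / (s ^+ 2 + x)| <= (s ^+ 2 + x)^-1.
  move=> As; have q0 : 0 <= (s ^+ 2 + x)^-1 by rewrite invr_ge0 ltW// sx0.
  rewrite normrM (ger0_norm q0) -[leRHS]mul1r ler_wpM2r//.
  by rewrite ler_norml sin_geN1 sin_le1.
pose proof (@derive_comparison _ (fun s => C x s - sin (phase x s) / (s ^+ 2 + x))
  (fun s => - (s ^+ 2 + x)^-1)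
  (fun s => sin (phase x s) * (s *+ 2 / (s ^+ 2 + x) ^+ 2))
  (fun s => s *+ 2 / (s ^+ 2 + x) ^+ 2) A B AB) as k; feed3 k.
- move=> s /andP[As _]; eapply is_derive_eq.
    repeat derive_step; [exact: dC|exact: is_derive_phase|by rewrite gt_eqF ?sx0].
  by have := sx0 _ As => ? /=; field; rewrite gt_eqF.
- move=> s /andP[As _]; eapply is_derive_eq.
    by repeat derive_step; rewrite gt_eqF ?sx0.
  by have := sx0 _ As => ? /=; field; rewrite gt_eqF.
- move=> s /andP[As _]; rewrite normrM -[leRHS]mul1r.
  rewrite (ger0_norm (_ : 0 <= s *+ 2 / _)); last first.
    by rewrite divr_ge0// ?sqr_ge0// mulrn_wge0// (le_trans A0).
  rewrite ler_wpM2r//; last by rewrite ler_norml sin_geN1 sin_le1.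
  by rewrite divr_ge0// ?sqr_ge0// mulrn_wge0// (le_trans A0).
move: k (h _ AB) (h _ (lexx A)) => /=.
set a := sin (phase x B) / _; set b := sin (phase x A) / _ => k ha hb.
have -> : C x B - C x A = (C x B - a - (C x A - b)) + (a - b) by ring.
rewrite (le_trans (ler_normD _ _))//.
have := ler_normB a b; lra.
Qed.

(** The same integration by parts, with the growing factor s; the condition on A gives s^2 + x >=
    s^2 / 2. The boundary terms cost at most 4/A and the remainder 6/A. *)
Let sin_tail x A B : 0 < A -> A <= B -> 2 * `|x| <= A ^+ 2 ->
  `|S x B - S x A| <= 10 / A.
Proof.
move=> A0 AB xA.
have sx s : A <= s -> 2 * `|x| <= s ^+ 2.
  move=> As; rewrite (le_trans xA)// lerXn2r// nnegrE ?ltW//.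
  exact: lt_le_trans As.
have s0 s : A <= s -> 0 < s by exact: lt_le_trans.
have sx0 s : A <= s -> s ^+ 2 / 2 <= s ^+ 2 + x.
  move=> /sx; have := ler_norm (- x); rewrite normrN; lra.
have sxgt0 s : A <= s -> 0 < s ^+ 2 + x.
  move=> As; apply: lt_le_trans (sx0 _ As).
  by rewrite divr_gt0// exprn_gt0// s0.
have h s : A <= s -> `|s * cos (phase x s) / (s ^+ 2 + x)| <= 2 / s.
  move=> As; rewrite normrM normfV (gtr0_norm (sxgt0 _ As)) ler_pdivrMr ?sxgt0//.
  rewrite normrM (gtr0_norm (s0 _ As)).
  have c1 : `|cos (phase x s)| <= 1 by rewrite ler_norml cos_geN1 cos_le1.
  rewrite (@le_trans _ _ s)//; first by rewrite ler_piMr// ltW// s0.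
  rewrite mulrAC ler_pdivlMr ?s0//; have := sx0 _ As; rewrite expr2; lra.
pose proof (@derive_comparison _ (fun s => S x s + s * cos (phase x s) / (s ^+ 2 + x))
  (fun s => - 6 * s^-1)
  (fun s => cos (phase x s) * ((x - s ^+ 2) / (s ^+ 2 + x) ^+ 2))
  (fun s => 6 / s ^+ 2) A B AB) as k; feed3 k.
- move=> s /andP[As _]; eapply is_derive_eq.
    repeat derive_step; [exact: dS|exact: is_derive_phase|by rewrite gt_eqF ?sxgt0].
  by have := sxgt0 _ As => ? /=; field; rewrite gt_eqF.
- move=> s /andP[As _]; eapply is_derive_eq.
    by repeat derive_step; rewrite gt_eqF ?s0.
  by have := s0 _ As => ? /=; field; rewrite gt_eqF.
- move=> s /andP[As _]; rewrite normrM -[leRHS]mul1r ler_pM//.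
    by rewrite ler_norml cos_geN1 cos_le1.
  have q0 := sxgt0 _ As; have q1 := sx0 _ As.
  rewrite normrM normfV (ger0_norm (sqr_ge0 _)) ler_pdivrMr ?exprn_gt0//.
  rewrite mulrAC ler_pdivlMr ?exprn_gt0 ?s0//.
  have n1 : `|x - s ^+ 2| <= 3 / 2 * s ^+ 2.
    rewrite (le_trans (ler_normB _ _))// (ger0_norm (sqr_ge0 _)).
    have := sx _ As; lra.
  have : `|x - s ^+ 2| * s ^+ 2 <= 3 / 2 * s ^+ 2 * s ^+ 2.
    by rewrite ler_wpM2r// sqr_ge0.
  move/le_trans; apply.
  have : (s ^+ 2 / 2) ^+ 2 <= (s ^+ 2 + x) ^+ 2.
    by rewrite lerXn2r// nnegrE; [rewrite divr_ge0// sqr_ge0|exact: ltW].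
  rewrite !expr2; lra.
move: k (h _ AB) (h _ (lexx A)) => /=.
set a := B * cos _ / _; set b := A * cos _ / _ => k ha hb.
have -> : S x B - S x A = (S x B + a - (S x A + b)) - (a - b) by ring.
rewrite (le_trans (ler_normB _ _))//.
have BA : 2 / B <= 2 / A by rewrite ler_pM2l// lef_pV2// posrE// (lt_le_trans A0).
have B0 : 0 < B^-1 by rewrite invr_gt0 (lt_le_trans A0).
have := ler_normB a b; lra.
Qed.

Let tail_threshold x A : 1 + 2 * `|x| <= A -> 2 * `|x| <= A ^+ 2 /\ 1 <= A.
Proof.
move=> h; have := normr_ge0 x => x0; split; last lra.
by rewrite expr2 (@le_trans _ _ (A * 1))//; [lra|rewrite ler_pM2l; lra].
Qed.

Let cos_limit x : exists2 l, C x A @[A --> +oo] --> l &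
  forall A, 1 + 2 * `|x| <= A -> `|l - C x A| <= 10 / A.
Proof.
apply: Cauchy_pinfty => //.
move=> A B xA AB; have [xA2 A1] := tail_threshold xA.
have A0 : 0 < A by lra.
have h : A ^+ 2 / 2 <= A ^+ 2 + x.
  have := ler_norm (- x); rewrite normrN; lra.
have h0 : 0 < A ^+ 2 + x.
  by apply: lt_le_trans h; rewrite divr_gt0// exprn_gt0.
rewrite (le_trans (cos_tail _ AB _))//; first exact: ltW.
rewrite ler_pdivrMr// mulrAC ler_pdivlMr//.
have : A * 1 <= A * A by rewrite ler_pM2l.
move: h; rewrite expr2; lra.
Qed.

Let sin_limit x : exists2 l, S x A @[A --> +oo] --> l &
  forall A, 1 + 2 * `|x| <= A -> `|l - S x A| <= 10 / A.
Proof.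
apply: Cauchy_pinfty => //.
move=> A B xA AB; have [xA2 A1] := tail_threshold xA.
by apply: sin_tail => //; lra.
Qed.

Let is_derive_cos_parameter A x : 0 <= A -> is_derive x 1 (C ^~ A) (- S x A).
Proof.
move=> A0; apply: (@is_derive_quadratic _ _ _ _ (A ^+ 3)) => y.
pose proof (@derive_comparison _ (fun s => C y s - C x s + (y - x) * S x s)
  (fun s => s ^+ 3 * (y - x) ^+ 2)
  (fun s => cos (phase y s) - cos (phase x s) + (y - x) * (s * sin (phase x s)))
  (fun s => 3 * s ^+ 2 * (y - x) ^+ 2) 0 A A0) as k; feed3 k.
- move=> s _; eapply is_derive_eq.
    by repeat derive_step; [exact: dC|exact: dC|exact: dS].
  by rewrite /=; ring.
- by move=> s _; eapply is_derive_eq; [repeat derive_step|rewrite /=; ring].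
- move=> s _; have -> : phase y s = phase x s + s * (y - x) by rewrite /phase; ring.
  have -> : (y - x) * (s * sin (phase x s)) = s * (y - x) * sin (phase x s) by ring.
  rewrite (le_trans (cos_taylor _ _))// exprMn ler_wpM2r ?sqr_ge0//.
  by rewrite ler_peMl ?sqr_ge0// ler1n.
move: k; rewrite !C0 !S0 expr0n/= !(subrr, mulr0, mul0r, subr0, addr0).
by rewrite mulrN opprK.
Qed.

(** The derivative is the integral of s^2 cos(phase). Writing s^2 = (s^2 + x) - x, the first part
    integrates exactly to sin(phase) and the second gives the right-hand side of the Airy
    equation. *)
Let is_derive_sin_parameter A x : 0 <= A ->
  is_derive x 1 (S ^~ A) (sin (phase x A) - x * C x A).
Proof.
move=> A0; apply: (@is_derive_quadratic _ _ _ _ (A ^+ 4)) => y.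
pose proof (@derive_comparison _
  (fun s => S y s - S x s - (y - x) * (sin (phase x s) - x * C x s))
  (fun s => s ^+ 4 * (y - x) ^+ 2)
  (fun s => s * (sin (phase y s) - sin (phase x s) - s * (y - x) * cos (phase x s)))
  (fun s => 4 * s ^+ 3 * (y - x) ^+ 2) 0 A A0) as k; feed3 k.
- move=> s _; eapply is_derive_eq.
    by repeat derive_step; [exact: dS|exact: dS|exact: is_derive_phase|exact: dC].
  by rewrite /=; ring.
- by move=> s _; eapply is_derive_eq; [repeat derive_step|rewrite /=; ring].
- move=> s /andP[s0 _].
  have -> : phase y s = phase x s + s * (y - x) by rewrite /phase; ring.
  rewrite normrM (ger0_norm s0).
  have := sin_taylor (phase x s) (s * (y - x)); move/(ler_wpM2l s0)/le_trans; apply.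
  have -> : s * (s * (y - x)) ^+ 2 = s ^+ 3 * (y - x) ^+ 2 by ring.
  by rewrite ler_wpM2r ?sqr_ge0// ler_peMl ?exprn_ge0// ler1n.
have p0 z : phase z 0 = 0 by rewrite /phase expr0n/= !mul0r addr0.
by move: k; rewrite !C0 !S0 !p0 expr0n/= sin0 !(subrr, mulr0, mul0r, subr0, addr0).
Qed.

Lemma airy_equation_primitives : exists ai di : R -> R,
  [/\ forall x, C x A @[A --> +oo] --> ai x,
      forall x, is_derive x 1 ai (di x),
      forall x, is_derive x 1 di (x * ai x)
    & forall x, 0 < x -> `|ai x| <= 2 / x].
Proof.
have /choice[ai aiP] : forall x, exists l, C x A @[A --> +oo] --> l /\
    forall A, 1 + 2 * `|x| <= A -> `|l - C x A| <= 10 / A.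
  by move=> x; have [l ? ?] := cos_limit x; exists l.
have /choice[si siP] : forall x, exists l,
    forall A, 1 + 2 * `|x| <= A -> `|l - S x A| <= 10 / A.
  by move=> x; have [l ? ?] := sin_limit x; exists l.
(* The threshold of [x] enlarged by 2 serves every [y] at distance at most 1 from [x]. *)
have thr x y A : 3 + 2 * `|x| <= A -> `|y - x| <= 1 -> 1 + 2 * `|y| <= A.
  move=> xA yx; have : `|y| <= `|y - x| + `|x|.
    by rewrite -[X in `|X| <= _](subrK x) ler_normD.
  lra.
have thr0 x : 0 < 3 + 2 * `|x| by rewrite ltr_pwDl// mulr_ge0.
have ca x : {for x, continuous ai}.
  apply: (@continuous_uniform_limit _ (fun A => C ^~ A) _ _ 10 (3 + 2 * `|x|)) => //.
    move=> A xA; apply: is_derive1_continuous (is_derive_cos_parameter _ _).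
    by rewrite (le_trans _ xA)// ltW.
  by move=> A y xA yx; apply: (aiP y).2; exact: thr xA yx.
have cs x : {for x, continuous si}.
  apply: (@continuous_uniform_limit _ (fun A => S ^~ A) _ _ 10 (3 + 2 * `|x|)) => //.
    move=> A xA; apply: is_derive1_continuous (is_derive_sin_parameter _ _).
    by rewrite (le_trans _ xA)// ltW.
  by move=> A y xA yx; apply: siP; exact: thr xA yx.
exists ai, (fun x => - si x); split.
- by move=> x; exact: (aiP x).1.
- move=> x.
  apply: (@is_derive_uniform_limit _ (fun A => C ^~ A) (fun A y => - S y A)
    ai (fun y => - si y) x 10 (3 + 2 * `|x|)) => //.
  + by apply: cvgN; exact: cs.
  + move=> A y xA yx; apply: is_derive_cos_parameter.
    by rewrite (le_trans _ xA)// ltW.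
  + by move=> A y xA yx; apply: (aiP y).2; exact: thr xA yx.
  + move=> A y xA yx; rewrite -opprD normrN; apply: siP; exact: thr xA yx.
- move=> x.
  (* The derivative of [- S y A] contains - sin(phase y A), which has no limit as A grows.
     Subtracting cos(phase y A) / A, which tends to 0, removes it: the corrected approximant has
     derivative exactly [y * C y A]. *)
  apply: (@is_derive_uniform_limit _
    (fun A y => - S y A - cos (phase y A) / A) (fun A y => y * C y A)
    (fun y => - si y) (fun y => y * ai y) x (11 + 10 * (1 + `|x|)) (3 + 2 * `|x|)) => //.

  + by apply: cvgM; [exact: cvg_id|exact: ca].
  + move=> A y xA yx; have A0 : 0 < A by exact: lt_le_trans xA.
    eapply is_derive_eq.
      repeat derive_step; first exact: is_derive_sin_parameter (ltW _).
      by rewrite /phase; repeat derive_step.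
    by rewrite /=; field; rewrite gt_eqF.
  + move=> A y xA yx; have A0 : 0 < A by exact: lt_le_trans xA.
    have -> : - si y - (- S y A - cos (phase y A) / A)
      = cos (phase y A) / A - (si y - S y A) by ring.
    rewrite (le_trans (ler_normB _ _))//.
    rewrite (@le_trans _ _ (1 / A + 10 / A))//.
      rewrite lerD//; last by apply: siP; exact: thr xA yx.
      rewrite normrM (gtr0_norm (_ : 0 < A^-1)) ?invr_gt0// ler_pM2r ?invr_gt0//.
      by rewrite ler_norml cos_geN1 cos_le1.
    rewrite -mulrDl ler_pM2r ?invr_gt0//; have := normr_ge0 x; lra.
  + move=> A y xA yx; have A0 : 0 < A by exact: lt_le_trans xA.
    rewrite -mulrBr normrM.
    have y1 : `|y| <= 1 + `|x|.
      have : `|y| <= `|y - x| + `|x|.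
        by rewrite -[X in `|X| <= _](subrK x) ler_normD.
      lra.
    have h : `|ai y - C y A| <= 10 / A by apply: (aiP y).2; exact: thr xA yx.
    have := ler_pM (normr_ge0 _) (normr_ge0 _) y1 h.
    move/le_trans; apply; rewrite mulrA ler_pM2r ?invr_gt0//; lra.
(* For x > 0 the derivative of the phase does not vanish on the half-line, so the tail estimate may
   start at A = 0. *)
- move=> x x0.
  have h : (fun A => `|C x A|) A @[A --> +oo] --> `|ai x|.
    by apply: cvg_norm; exact: (aiP x).1.
  apply: (pinfty_le_cst (a := 0) h) => A A0.
  have := @cos_tail x 0 A (lexx _) A0; rewrite expr0n/= add0r => /(_ x0).
  by rewrite C0 subr0.
Qed.

End Primitives.

(** The decay is 2 / (pi x) with pi >= 2. Crude as it is, it excludes the growing solutions of the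
    equation, and that is its role below. *)
Lemma airy_equation : exists Ai' : R -> R,
  [/\ forall x, is_derive x 1 (@Ai R) (Ai' x),
      forall x, is_derive x 1 Ai' (x * Ai x)
    & forall x, 0 < x -> `|Ai x| <= 1 / x].
Proof.
have [C [S [C0 S0 dC dS]]] := oscillatory_primitives.
have [ai [di [aiP dai ddi aib]]] := airy_equation_primitives C0 S0 dC dS.
have pi0 := pi_gt0 R.
have AiE x : Ai x = pi^-1 * ai x.
  congr (_ * _); apply: cvg_lim => //.
  apply: cvg_trans (aiP x); apply: near_eq_cvg; near=> A.
  rewrite (@FTC_itv _ (C x) (fun s => cos (phase x s)) 0 A)//.
  - by rewrite C0 subr0.
  - by move=> s _; exact: cos_phase_continuous.
have -> : @Ai R = (fun x => pi^-1 * ai x) by apply/funext.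
exists (fun x => pi^-1 * di x); split.
- move=> x; eapply is_derive_eq; first by repeat derive_step; exact: dai.
  by rewrite mulr0 addr0.
- move=> x; eapply is_derive_eq; first by repeat derive_step; exact: ddi.
  by rewrite /=; ring.
- move=> x x0; rewrite normrM (gtr0_norm (_ : 0 < pi^-1)) ?invr_gt0//.
  rewrite mulrC ler_pdivrMr//.
  rewrite (le_trans (aib _ x0))// mulrAC ler_pM2r ?invr_gt0// mul1r.
  exact: pi_ge2.
Unshelve. all: by end_near. Qed.

End AiryFunction.

(** * Solutions of the Airy equation on the negative half-line *)

Section AiryEquation.
Context {R : realType}.
Variables (y y' : R -> R) (w1 : R).
Hypothesis dy : forall x : R, is_derive x (1:R) y (y' x).
Hypothesis dy' : forall x : R, is_derive x (1:R) y' (x * y x).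
Hypothesis y_decay : forall x, 0 < x -> `|y x| <= 1 / x.
Hypothesis zero_w1 : y (- w1) = 0.
Hypothesis zeros_le : forall x, y x = 0 -> x <= - w1.
Implicit Types (x z s : R).

(** A primitive of y^2 which vanishes at +oo. It serves both as a monotone quantity and to compute
    the L2 norms of y on half-lines. *)
Definition airy_energy z := z * y z ^+ 2 - y' z ^+ 2.

Lemma is_derive_airy_energy z : is_derive z 1 airy_energy (y z ^+ 2).
Proof.
rewrite /airy_energy; eapply is_derive_eq; first by repeat derive_step; [exact: dy|exact: dy'].
by rewrite /=; ring.
Qed.

Let p z := y z * y' z.

Let dp z : is_derive z 1 p (y' z ^+ 2 + z * y z ^+ 2).
Proof.
rewrite /p; eapply is_derive_eq; first by repeat derive_step; [exact: dy|exact: dy'].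
by rewrite /=; ring.
Qed.

Let dsqr z : is_derive z 1 (fun z => y z ^+ 2) (2 * p z).
Proof.
eapply is_derive_eq; first by repeat derive_step; exact: dy.
by rewrite /p /=; ring.
Qed.

Let p_nondecreasing a b : 0 <= a -> a <= b -> p a <= p b.
Proof.
move=> a0 ab; apply: (derive_ge0_le ab (fun x _ => dp x)) => x /andP[ax _].
by rewrite addr_ge0 ?sqr_ge0// mulr_ge0 ?sqr_ge0// (le_trans a0).
Qed.

(** [p] is half the derivative of y^2 and is nondecreasing on the half-line, so a positive value
    would make y^2 grow at least linearly, against the decay. *)
Let p_le0 z : 0 <= z -> p z <= 0.
Proof.
move=> z0; rewrite leNgt; apply/negP => pz.
(* From [z] to [b] the function y^2 gains at least 2 p(z) + 2, while y(b)^2 <= 1 because b >= 1. *)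
pose b := z + 1 + (p z)^-1.
have i0 : 0 < (p z)^-1 by rewrite invr_gt0.
have zb : z <= b by rewrite /b; lra.
have k : y z ^+ 2 - 2 * p z * z <= y b ^+ 2 - 2 * p z * b.
  apply: (@derive_ge0_le _ (fun x => y x ^+ 2 - 2 * p z * x)
    (fun x => 2 * p x - 2 * p z) z b zb) => x /andP[zx _].
    eapply is_derive_eq; first by repeat derive_step; exact: dy.
    by rewrite /p /=; ring.
  by rewrite subr_ge0 ler_pM2l// p_nondecreasing.
have b1 : 1 <= b by rewrite /b; lra.
have yb : y b ^+ 2 <= 1.
  rewrite -real_normK ?num_real// expr_le1//.
  have b0 : 0 < b by lra.
  by rewrite (le_trans (y_decay b0))// ler_pdivrMr// mul1r.
have : 2 * p z * (b - z) = 2 * p z + 2.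
  by rewrite /b; field; rewrite gt_eqF.
have := sqr_ge0 (y z); lra.
Qed.

Let sqr_nonincreasing a b : 0 <= a -> a <= b -> y b ^+ 2 <= y a ^+ 2.
Proof.
move=> a0 ab; rewrite -lerN2.
apply: (@derive_ge0_le _ (fun x => - y x ^+ 2) (fun x => - (2 * p x)) a b ab) => x /andP[ax _].
  exact/is_derive_lambdaN/dsqr.
by rewrite oppr_ge0 pmulr_rle0// p_le0// (le_trans a0).
Qed.

(** Since y^2 is nonincreasing on the half-line, a zero there would persist at every later point, in
    particular beyond the largest zero - w1. *)
Let y_neq0 z : 0 <= z -> y z != 0.
Proof.
move=> z0; apply/eqP => yz.
pose b := Num.max z (1 - w1).
have zb : z <= b by rewrite le_max lexx.
have /zeros_le : y b = 0.
  apply/eqP; rewrite -sqrf_eq0 eq_le sqr_ge0 andbT.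
  by rewrite (le_trans (sqr_nonincreasing z0 zb))// yz expr0n.
have : 1 - w1 <= b by rewrite le_max lexx orbT.
lra.
Qed.

Lemma airy_first_zero_gt0 : 0 < w1.
Proof.
rewrite ltNge; apply/negP => w1le; have := @y_neq0 (- w1).
by rewrite zero_w1 eqxx oppr_ge0 => /(_ w1le).
Qed.

(** On [0, z] the function y'^2 decreases, so p' >= y'(z)^2 there; it remains to integrate and to
    use p(z) <= 0. *)
Let sqr'_le z : 0 < z -> y' z ^+ 2 <= - p 0 / z.
Proof.
move=> z0; rewrite ler_pdivlMr//.
have ds' x : is_derive x (1:R) (fun x => y' x ^+ 2) (2 * x * p x).
  eapply is_derive_eq; first by repeat derive_step; exact: dy'.
  by rewrite /p /=; ring.
have k : p 0 - y' z ^+ 2 * 0 <= p z - y' z ^+ 2 * z.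
  apply: (@derive_ge0_le _ (fun x => p x - y' z ^+ 2 * x)
    (fun x => y' x ^+ 2 + x * y x ^+ 2 - y' z ^+ 2) 0 z (ltW z0)) => x /andP[x0 xz].
    eapply is_derive_eq; first by repeat derive_step; exact: dp.
    by rewrite /=; ring.
  have k2 : - y' x ^+ 2 <= - y' z ^+ 2.
    apply: (@derive_ge0_le _ (fun x => - y' x ^+ 2) (fun x => - (2 * x * p x)) x z xz) => t /andP[xt _].
    have t0 : 0 <= t by exact: le_trans xt.
    by rewrite oppr_ge0 mulr_ge0_le0 ?mulr_ge0// p_le0.
  by have : 0 <= x * y x ^+ 2 by [rewrite mulr_ge0// sqr_ge0]; lra.
have := p_le0 (ltW z0); lra.
Qed.

Lemma airy_energy_cvg0 : airy_energy z @[z --> +oo] --> 0.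
Proof.
pose K := 1 + - p 0.
have K0 : 0 <= K by rewrite addr_ge0// oppr_ge0 p_le0.
have bd z : 1 <= z -> `|airy_energy z| <= K / z.
  move=> z1; have z0 : 0 < z by lra.
  rewrite (le_trans (ler_normB _ _))// /K mulrDl lerD//.
    rewrite ger0_norm; last by rewrite mulr_ge0 ?sqr_ge0// ltW.
    rewrite -real_normK ?num_real//.
    have : `|y z| ^+ 2 <= (1 / z) ^+ 2.
      by rewrite lerXn2r// ?y_decay// nnegrE divr_ge0// ltW.
    move/(ler_wpM2l (ltW z0))/le_trans; apply.
    by rewrite (_ : z * (1 / z) ^+ 2 = 1 / z)//; field; rewrite gt_eqF.
  by rewrite ger0_norm ?sqr_ge0// sqr'_le.
apply/cvgrPdist_le => e e0.
exists (1 + K / e); split; first exact: num_real.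
move=> z ez; have Ke : 0 <= K / e by rewrite divr_ge0// ltW.
have z1 : 1 <= z by rewrite (le_trans _ (ltW ez))// lerDl.
rewrite sub0r normrN (le_trans (bd _ z1))// ler_pdiv_swap//; first by lra.
by rewrite (le_trans _ (ltW ez))// lerDr.
Qed.

Lemma airy_energy_nondecreasing a b : a <= b -> airy_energy a <= airy_energy b.
Proof.
move=> ab; apply: (derive_ge0_le ab (fun x _ => is_derive_airy_energy x)) => x _.
exact: sqr_ge0.
Qed.

Lemma airy_energy_le0 z : airy_energy z <= 0.
Proof.
have h : - airy_energy x @[x --> +oo] --> - (0 : R) by apply: cvgN; exact: airy_energy_cvg0.
rewrite -lerN2; apply: (pinfty_le_cst (a := z) h) => A zA.
by rewrite lerN2 airy_energy_nondecreasing.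
Qed.

(** If the energy vanished at [z], monotonicity would keep it equal to 0 to the right of [z], and
    its derivative y^2 would vanish beyond - w1. *)
Lemma airy_energy_lt0 z : airy_energy z < 0.
Proof.
rewrite lt_neqAle airy_energy_le0 andbT; apply/eqP => z0.
pose a := Num.max z (1 - w1).
have F0 x : z <= x -> airy_energy x = 0.
  move=> zx; apply/eqP; rewrite eq_le airy_energy_le0/= -z0.
  exact: airy_energy_nondecreasing.
have /zeros_le : y (a + 1) = 0.
  apply/eqP; rewrite -sqrf_eq0; apply/eqP.
  have [_ <-] := is_derive_airy_energy (a + 1).
  have : is_derive (a + 1) (1:R) airy_energy 0.
    apply: (@near_eq_is_derive _ _ _ (fun=> 0)).
    near=> x; rewrite F0//.
    rewrite (@le_trans _ _ a)//; first by rewrite le_max lexx.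
    near: x; exists 1 => //= x /=; rewrite ltr_norml => /andP[]; lra.
  by move=> [].
have : 1 - w1 <= a by rewrite le_max lexx orbT.
lra.
Unshelve. all: by end_near. Qed.

Let P s := - airy_energy (- s).

Let P_E s : P s = s * y (- s) ^+ 2 + y' (- s) ^+ 2.
Proof. by rewrite /P /airy_energy; ring. Qed.

Let P_gt0 s : 0 < P s.
Proof. by rewrite oppr_gt0 airy_energy_lt0. Qed.

Let P_nondecreasing a b : a <= b -> P a <= P b.
Proof. by move=> ab; rewrite lerN2 airy_energy_nondecreasing// lerN2. Qed.

(** The adiabatic invariant of the oscillator with frequency sqrt s: its energy [P s] divided by
    that frequency. Unlike [P] it stays within constant factors as s grows. *)
Let E s := Num.sqrt s * y (- s) ^+ 2 + y' (- s) ^+ 2 / Num.sqrt s.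

Let E1 : E 1 = P 1.
Proof. by rewrite /E P_E sqrtr1 divr1. Qed.

Let dyN s : is_derive s 1 (fun s => y (- s)) (- y' (- s)).
Proof.
eapply is_derive_eq.
  by eapply (@is_derive_lambda_comp _ y (fun s => - s)); [exact: dy|repeat derive_step].
by rewrite /=; ring.
Qed.

Let dy'N s : is_derive s 1 (fun s => y' (- s)) (s * y (- s)).
Proof.
eapply is_derive_eq.
  by eapply (@is_derive_lambda_comp _ y' (fun s => - s)); [exact: dy'|repeat derive_step].
by rewrite /=; ring.
Qed.

(* The cross term cancels the oscillating part of the derivative of [E], leaving
   a relative variation of order s^(-5/2), integrable at infinity. *)
Let E2 s := E s - y (- s) * y' (- s) / (2 * (s * Num.sqrt s)).

Let cross_le s : 0 < s -> `|y (- s) * y' (- s)| <= E s / 2.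
Proof.
move=> s0; have r0 : 0 < Num.sqrt s by rewrite sqrtr_gt0.
set r := Num.sqrt s in r0 *.
have k a b : a * b <= (r * a ^+ 2 + b ^+ 2 / r) / 2.
  rewrite -subr_ge0 (_ : _ - _ = (r * a - b) ^+ 2 / (2 * r)); last by field; rewrite gt_eqF.
  by rewrite divr_ge0 ?sqr_ge0// mulr_ge0// ltW.
rewrite ler_norml /E -/r k andbT lerNl.
by have := k (- y (- s)) (y' (- s)); rewrite sqrrN mulNr.
Qed.

Let E_ge0 s : 0 <= E s.
Proof.
rewrite /E; apply: addr_ge0; first by apply: mulr_ge0; [exact: sqrtr_ge0|exact: sqr_ge0].
by apply: divr_ge0; [exact: sqr_ge0|exact: sqrtr_ge0].
Qed.

Let E2_bounds s : 1 <= s -> 3 / 4 * E s <= E2 s <= 5 / 4 * E s.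
Proof.
move=> s1; have s0 : 0 < s by lra.
have r1 : 1 <= Num.sqrt s by rewrite -sqrtr1 ler_sqrt// ltW.
have sr : 1 <= s * Num.sqrt s by rewrite -[1]mul1r ler_pM.
have sr0 : 0 < 2 * (s * Num.sqrt s) by lra.
have h : `|y (- s) * y' (- s) / (2 * (s * Num.sqrt s))| <= E s / 4.
  rewrite normrM normfV (gtr0_norm sr0) ler_pdivrMr//.
  rewrite (le_trans (cross_le s0))//.
  have : E s * 1 <= E s * (s * Num.sqrt s) by rewrite ler_wpM2l.
  lra.
by move: h; rewrite /E2 ler_norml => /andP[h1 h2]; apply/andP; split; lra.
Qed.

Let dE2 s : 0 < s -> is_derive s 1 E2
  (3 / 4 * (y (- s) * y' (- s)) / (s ^+ 2 * Num.sqrt s)).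
Proof.
move=> s0; have r0 : 0 < Num.sqrt s by rewrite sqrtr_gt0.
have dr := @is_derive1_sqrt R s s0.
rewrite /E2 /E; eapply is_derive_eq.
  repeat derive_step; [exact: dr|exact: dyN|exact: dy'N|by rewrite gt_eqF|exact: dr
   |exact: dyN|exact: dy'N|by rewrite gt_eqF// !mulr_gt0|exact: dr].
rewrite /=.
have e : s = Num.sqrt s ^+ 2 by rewrite sqr_sqrtr// ltW.
move: (y (- s)) (y' (- s)) => a b.
set r := Num.sqrt s in r0 e *; rewrite e.
by field; rewrite gt_eqF.
Qed.

(** Half a power of s is given up, using sqrt s >= 1, to reach the rate 1 / (2 s^2), for which 1 +
    1/s is an explicit integrating factor. *)
Let dE2_le s : 1 <= s ->
  `|3 / 4 * (y (- s) * y' (- s)) / (s ^+ 2 * Num.sqrt s)| <= E2 s / (2 * s ^+ 2).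
Proof.
move=> s1; have s0 : 0 < s by lra.
have r1 : 1 <= Num.sqrt s by rewrite -sqrtr1 ler_sqrt// ltW.
have r0 : 0 < Num.sqrt s by lra.
have q0 : 0 < s ^+ 2 by rewrite exprn_gt0.
have /andP[h1 _] := E2_bounds s1.
rewrite normrM normfV (gtr0_norm (_ : 0 < s ^+ 2 * _)) ?mulr_gt0//.
rewrite invfM mulrA (@le_trans _ _ (`|3 / 4 * (y (- s) * y' (- s))| / s ^+ 2))//.
  by rewrite ler_piMr ?invf_le1// divr_ge0// sqr_ge0.
rewrite (_ : E2 s / (2 * s ^+ 2) = E2 s / 2 / s ^+ 2); last by field; rewrite gt_eqF.
rewrite ler_pM2r ?invr_gt0// normrM ger0_norm//.
have := cross_le s0; lra.
Qed.

Let E2_ge0 s : 1 <= s -> 0 <= E2 s.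
Proof. by move=> /E2_bounds/andP[h _]; apply: le_trans h; rewrite mulr_ge0. Qed.

(** For s >= 1 the logarithmic derivative of m(s) = 1 + 1/s is at most - 1 / (2 s^2), so E2 m
    decreases and E2 / m increases. As m(1) = 2, [E2] stays within a factor 2 of its value at 1; the
    factors 3/4 and 5/4 between [E] and [E2] then give 3/10 and 10/3. *)
Let E_bounds s : 1 <= s -> 3 / 10 * P 1 <= E s <= 10 / 3 * P 1.
Proof.
move=> s1; have /andP[a1 a2] := E2_bounds s1.
have /andP[] := E2_bounds (lexx 1); rewrite E1 => b1 b2.
have dm (t : R) : 0 < t -> is_derive t (1:R) (fun t => 1 + t^-1) (- (t ^+ 2)^-1).
  move=> t0; eapply is_derive_eq; first by repeat derive_step; rewrite gt_eqF.
  by rewrite /=; field; rewrite gt_eqF.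
have up : E2 s * (1 + s^-1) <= E2 1 * (1 + 1^-1).
  rewrite -lerN2.
  apply: (@derive_ge0_le _ (fun t => - (E2 t * (1 + t^-1)))
    (fun t => - (E2 t * (- (t ^+ 2)^-1) + (1 + t^-1) *
      (3 / 4 * (y (- t) * y' (- t)) / (t ^+ 2 * Num.sqrt t)))) 1 s s1) => t /andP[t1 _].
    have t0 : 0 < t by lra.
    apply: is_derive_lambdaN.
    exact: (is_derive_lambdaM (dE2 t0) (dm _ t0)).
  have t0 : 0 < t by lra.
  have := dE2_le t1; set d := (3 / 4 * _) / _ => d1.
  have i1 : 0 < t^-1 <= 1 by rewrite invr_gt0 t0/= invf_le1.
  have : `|(1 + t^-1) * d| <= 2 * (E2 t / (2 * t ^+ 2)).
    rewrite normrM ler_pM// ger0_norm; case/andP: i1; lra.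
  have -> : 2 * (E2 t / (2 * t ^+ 2)) = E2 t * (t ^+ 2)^-1 by field; rewrite gt_eqF.
  by rewrite ler_norml => /andP[_]; lra.
have lo : E2 1 / (1 + 1^-1) <= E2 s / (1 + s^-1).
  apply: (@derive_ge0_le _ (fun t => E2 t / (1 + t^-1))
    (fun t => ((1 + t^-1) * (3 / 4 * (y (- t) * y' (- t)) / (t ^+ 2 * Num.sqrt t))
       + E2 t * (t ^+ 2)^-1) / (1 + t^-1) ^+ 2) 1 s s1) => t /andP[t1 _].
    have t0 : 0 < t by lra.
    have m0 : 0 < 1 + t^-1 by rewrite addr_gt0// invr_gt0.
    eapply is_derive_eq.
      eapply (@is_derive_lambdaM _ E2 (fun t => (1 + t^-1)^-1)); first exact: dE2.
      by eapply (@is_derive_lambdaV _ (fun t => 1 + t^-1)); [rewrite gt_eqF|exact: dm].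
    set d := (3 / 4 * _) / _.
    rewrite /=; move: m0; set m := 1 + t^-1 => m0; clearbody d m.
    by field; rewrite !gt_eqF.
  have t0 : 0 < t by lra.
  have i1 : 0 < t^-1 <= 1 by rewrite invr_gt0 t0/= invf_le1.
  rewrite divr_ge0 ?sqr_ge0//.
  have := dE2_le t1; set d := (3 / 4 * _) / _ => d1.
  have : `|(1 + t^-1) * d| <= 2 * (E2 t / (2 * t ^+ 2)).
    rewrite normrM ler_pM// ger0_norm; case/andP: i1; lra.
  have -> : 2 * (E2 t / (2 * t ^+ 2)) = E2 t * (t ^+ 2)^-1 by field; rewrite gt_eqF.
  by rewrite ler_norml => /andP[+ _]; lra.
have i1 : 0 < s^-1 <= 1 by rewrite invr_gt0 invf_le1 ?s1 ?andbT; lra.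
have up' : E2 s <= 2 * E2 1.
  have : E2 s * 1 <= E2 s * (1 + s^-1).
    by rewrite ler_wpM2l ?E2_ge0// lerDl; case/andP: i1 => /ltW.
  by move: up; rewrite invr1; lra.
have lo' : E2 1 / 2 <= E2 s.
  have : E2 s / (1 + s^-1) <= E2 s.
    have i2 : 1 <= 1 + s^-1 by case/andP: i1 => /ltW i2 _; rewrite lerDl.
    by rewrite ler_piMr ?E2_ge0// invf_le1// (lt_le_trans _ i2).
  by move: lo; rewrite invr1 (_ : (1 + 1 : R) = 2); [lra|ring].
by apply/andP; split; lra.
Qed.

(** These are the sizes w^(1/4) of y' and s^(-1/4) of y, uniformly down to the first zero. Beyond 1
    they are read off [E]; nearer to 0, where [E] is not controlled, off the monotone [P]. *)
Lemma airy_bounds_negative : exists K k : R, [/\ 0 < K, 0 < k &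
  forall w, w1 <= w ->
  [/\ y (- w) = 0 -> k * Num.sqrt w <= y' (- w) ^+ 2 <= K * Num.sqrt w,
      forall t, 0 <= t <= w -> y' (- t) ^+ 2 <= K * Num.sqrt w
   & forall s, w / 2 <= s -> Num.sqrt s * y (- s) ^+ 2 <= K]].
Proof.
have w10 := airy_first_zero_gt0.
pose a := w1 / 2; have a0 : 0 < a by rewrite divr_gt0.
have P1 := P_gt0 1.
have ra0 : 0 < Num.sqrt a by rewrite sqrtr_gt0.
have q1 : 0 < P 1 / a by rewrite divr_gt0.
have q2 : 0 < P 1 / Num.sqrt a by rewrite divr_gt0.
(* The first term serves the arguments beyond 1, the second bounds y^2 on [a, 1], and the third
   bounds y'^2 on [0, 1], where sqrt w >= sqrt a is used. Every s >= w/2 is at least [a]. *)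
pose K := 10 / 3 * P 1 + P 1 / a + P 1 / Num.sqrt a.
have K0 : 0 < K by rewrite /K; lra.
(* The two lower bounds for y'(-w)^2 at a zero: 3/10 P(1) sqrt w from [E] when w > 1, and P(w) >=
   P(w1) with sqrt w <= 1 otherwise. *)
exists K, (Num.min (3 / 10 * P 1) (P w1)); split => //.
  by rewrite lt_min P_gt0 andbT mulr_gt0.
move=> w ww1; have w0 : 0 < w by exact: lt_le_trans ww1.
have rw0 : 0 < Num.sqrt w by rewrite sqrtr_gt0.
have aw : a <= w by rewrite /a; lra.
have up t : 0 <= t <= w -> y' (- t) ^+ 2 <= K * Num.sqrt w.
  move=> /andP[t0 tw]; have [t1|/ltW t1] := leP 1 t.
    have rt : 0 < Num.sqrt t by rewrite sqrtr_gt0; lra.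
    have rtw : Num.sqrt t <= Num.sqrt w by rewrite ler_wsqrtr.
    have /andP[_] := E_bounds t1; rewrite /E => Et.
    have : y' (- t) ^+ 2 / Num.sqrt t <= K.
      have : 0 <= Num.sqrt t * y (- t) ^+ 2 by rewrite mulr_ge0 ?sqr_ge0 ?sqrtr_ge0.
      by rewrite /K; lra.
    rewrite ler_pdivrMr// => /le_trans; apply.
    by rewrite ler_pM2l.
  have : y' (- t) ^+ 2 <= P 1.
    apply: le_trans (P_nondecreasing t1); rewrite P_E lerDr mulr_ge0// sqr_ge0//.
  move=> /le_trans; apply; rewrite (@le_trans _ _ (P 1 / Num.sqrt a * Num.sqrt w))//.
    rewrite mulrAC ler_pdivlMr// ler_pM2l// ler_wsqrtr//.
  by rewrite ler_pM2r// /K; lra.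
split => //.
- move=> yw; apply/andP; split; last by apply: up; rewrite lexx ltW.
  have [wge1|/ltW wle1] := leP 1 w.
    have /andP[+ _] := E_bounds wge1; rewrite /E yw expr0n/= mulr0 add0r ler_pdivlMr//.
    move=> /(le_trans _); apply; rewrite ler_pM2r// ge_min lexx//.
  have Pw : P w1 <= y' (- w) ^+ 2.
    by rewrite (le_trans (P_nondecreasing ww1))// P_E yw expr0n/= mulr0 add0r.
  apply: le_trans Pw.
  rewrite (@le_trans _ _ (Num.min (3 / 10 * P 1) (P w1)))//.
    rewrite ler_piMr//; first by rewrite le_min !ltW// mulr_gt0.
    by rewrite -sqrtr1 ler_wsqrtr.
  by rewrite ge_min lexx orbT.
- move=> s ws; have [s1|/ltW s1] := leP 1 s.
    have /andP[_] := E_bounds s1; rewrite /E => Es.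
    have : 0 <= y' (- s) ^+ 2 / Num.sqrt s by rewrite divr_ge0 ?sqr_ge0 ?sqrtr_ge0.
    by rewrite /K; lra.
  have as_ : a <= s by rewrite /a; lra.
  have s0 : 0 < s by exact: lt_le_trans as_.
  rewrite (@le_trans _ _ (y (- s) ^+ 2))//.
    by rewrite ler_piMl ?sqr_ge0// -sqrtr1 ler_wsqrtr.
  rewrite (@le_trans _ _ (P 1 / a))//; last by rewrite /K; lra.
  rewrite ler_pdivlMr// (le_trans _ (P_nondecreasing s1))// P_E.
  rewrite (@le_trans _ _ (y (- s) ^+ 2 * s))//; first by rewrite ler_wpM2l ?sqr_ge0.
  by rewrite mulrC lerDl sqr_ge0.
Qed.

(** On [-w, 0] the derivative is at most a multiple of w^(1/4) over a length w. On the positive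
    half-line |y| decreases, so the variation there is at most |y(0)|. *)
Lemma airy_total_variation : exists K : R, 0 < K /\
  exists W W' : R -> R, [/\ forall z, is_derive z 1 W (W' z),
  forall z, `|y' z| <= W' z
  & forall w z, w1 <= w -> - w <= z -> W z - W (- w) <= K * (w * Num.sqrt (Num.sqrt w))].
Proof.
have w10 := airy_first_zero_gt0.
have [K [k [K0 _ KP]]] := airy_bounds_negative.
have [W dW] : exists W : R -> R, forall z, is_derive z 1 W (`|y' z|).
  apply: continuous_primitive => z; apply: cvg_norm.
  exact: is_derive1_continuous (dy' z).
pose c := Num.sqrt K.
have c0 : 0 < c by rewrite sqrtr_gt0.
(* [m] is the least value of w^(5/4), by means of which the constant |y(0)| is absorbed into a
   multiple of w^(5/4). *)
pose m := w1 * Num.sqrt (Num.sqrt w1).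
have m0 : 0 < m by rewrite mulr_gt0// !sqrtr_gt0.
have y0 : 0 <= `|y 0| / m by rewrite divr_ge0// ltW.
exists (c + `|y 0| / m); split; first by rewrite ltr_wpDr.
exists W, (fun z => `|y' z|); split => // w z ww1 wz.
have w0 : 0 < w by exact: lt_le_trans ww1.
have W_nd a b : a <= b -> W a <= W b.
  by move=> ab; apply: (derive_ge0_le ab (fun x _ => dW x)) => x _.
pose Z := Num.max z 0.
have h1 : W z - W (- w) <= (W Z - W 0) + (W 0 - W (- w)).
  have : W z <= W Z by apply: W_nd; rewrite le_max lexx.
  lra.
have h2 : W 0 - W (- w) <= c * (w * Num.sqrt (Num.sqrt w)).
  have wle0 : - w <= 0 by rewrite oppr_le0 ltW.
  have := @derive_comparison _ W (fun x => x * (c * Num.sqrt (Num.sqrt w)))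
    (fun x => `|y' x|) (fun=> c * Num.sqrt (Num.sqrt w)) (- w) 0 wle0.
  move=> h; apply: le_trans (ler_norm _) _; move: h.
  rewrite mul0r sub0r mulNr opprK => h.
  rewrite mulrCA; apply: h => [x _|x /andP[x1 x0]].
  - by eapply is_derive_eq; [repeat derive_step|rewrite /=; ring].
  - rewrite normr_id -sqrtrM; last exact: ltW.
    rewrite -sqrtr_sqr ler_wsqrtr//.
    have [_ + _] := KP _ ww1; move=> /(_ (- x)); rewrite opprK; apply.
    by rewrite oppr_ge0 x0 lerNl.
have Z0 : 0 <= Z by rewrite le_max lexx orbT.
have h3 : W Z - W 0 <= `|y 0|.
  have sq0 x : 0 <= x -> 0 < y x ^+ 2.
    by move=> x0; rewrite lt_neqAle sqr_ge0 andbT eq_sym sqrf_eq0 y_neq0.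
  (* The comparison function is - |y|, written as a square root of y^2 > 0 so that it is
     differentiable; its derivative is |y'| because y y' <= 0. *)
  have := @derive_comparison _ W (fun x => - Num.sqrt (y x ^+ 2))
    (fun x => `|y' x|) (fun x => - ((2 * Num.sqrt (y x ^+ 2))^-1 * (2 * p x))) 0 Z Z0.
  move=> h; apply: le_trans (ler_norm _) _; apply: le_trans (h _ _ _) _.
  - move=> x /andP[x0 _]; apply: is_derive_lambdaN.
    exact: (@is_derive_lambda_comp _ _ (fun x => y x ^+ 2) _ _ _
              (is_derive1_sqrt (sq0 _ x0)) (dsqr x)).
  - move=> x /andP[x0 _].
    have yx : 0 < `|y x| by rewrite normr_gt0 y_neq0.
    have := p_le0 x0; rewrite sqrtr_sqr normr_id /p => px.
    rewrite (_ : - _ = - (y x * y' x) / `|y x|); last by field; rewrite gt_eqF.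
    rewrite ler_pdivlMr// -normrM mulrC ler0_norm//.
  by rewrite !sqrtr_sqr; have := normr_ge0 (y Z); lra.
have h4 : `|y 0| <= `|y 0| / m * (w * Num.sqrt (Num.sqrt w)).
  rewrite mulrAC ler_pdivlMr// ler_wpM2l// /m ler_pM ?sqrtr_ge0//; first exact: ltW.
  by rewrite !ler_wsqrtr.
rewrite mulrDl; lra.
Qed.

Lemma airy_energy_oppE w : y (- w) = 0 -> airy_energy (- w) = - y' (- w) ^+ 2.
Proof. by move=> yw; rewrite /airy_energy yw expr0n/= mulr0 sub0r. Qed.

End AiryEquation.

(** * Integrals over the real line *)

Section ParameterIntegrals.
Context d1 d2 (T1 : measurableType d1) (T2 : measurableType d2) (R : realType).
Variable m : {sigma_finite_measure set T2 -> \bar R}.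

(** Tonelli's theorem applied separately to the positive and the negative part of [f]. *)
Lemma measurable_fun_integral_parameter (f : T1 * T2 -> \bar R) :
  measurable_fun setT f ->
  measurable_fun setT (fun x => \int[m]_y f (x, y))%E.
Proof.
move=> mf.
have -> : (fun x => \int[m]_y f (x, y))%E
    = (fun x => fubini_F m f^\+ x - fubini_F m f^\- x)%E.
  apply/funext => x; rewrite integralE /fubini_F.
  by congr (_ - _)%E; apply: eq_integral => y _; rewrite ?funeposE ?funenegE.
apply: emeasurable_funB.
- by apply: measurable_fun_fubini_tonelli_F => //; exact: measurable_funepos.
- by apply: measurable_fun_fubini_tonelli_F => //; exact: measurable_funeneg.
Qed.

Lemma measurable_fun_Rintegral_parameter (f : T1 * T2 -> R) :
  measurable_fun setT f ->
  measurable_fun setT (fun x => \int[m]_y f (x, y)).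
Proof.
move=> mf; rewrite /Rintegral.
apply: measurableT_comp => //.
apply: (@measurable_fun_integral_parameter (EFin \o f)).
exact/measurable_EFinP.
Qed.

End ParameterIntegrals.

Lemma integrable_EFinZl (R : realType) (D : set R) (f : R -> R) k : measurable D ->
  leb.-integrable D (EFin \o f) -> leb.-integrable D (EFin \o (fun x => k * f x)).
Proof.
move=> mD fi; rewrite (_ : _ \o _ = fun x => (k%:E * (f x)%:E)%E).
  by apply: integrableZl.
by apply/funext => x /=; rewrite EFinM.
Qed.

Lemma integrable_EFinZr (R : realType) (D : set R) (f : R -> R) k : measurable D ->
  leb.-integrable D (EFin \o f) -> leb.-integrable D (EFin \o (fun x => f x * k)).
Proof.
move=> mD fi; rewrite (_ : _ \o _ = EFin \o (fun x => k * f x)).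
  exact: integrable_EFinZl.
by apply/funext => x /=; rewrite mulrC.
Qed.

Lemma integrable_EFinD (R : realType) (D : set R) (f g : R -> R) : measurable D ->
  leb.-integrable D (EFin \o f) -> leb.-integrable D (EFin \o g) ->
  leb.-integrable D (EFin \o (fun x => f x + g x)).
Proof.
move=> mD fi gi; rewrite (_ : _ \o _ = fun x => ((f x)%:E + (g x)%:E)%E).
  by apply: integrableD.
by apply/funext => x /=; rewrite EFinD.
Qed.

Section FubiniDominated.
Context {R : realType}.
Implicit Types (g : R * R -> R) (w H : R -> R).

(** The product majorant [w y * H x] yields integrability on the plane and on every slice at once,
    so that all the integrals are finite and Fubini's theorem applies. *)
Lemma Rintegral_dominated_swap g w H :
  measurable_fun setT g ->
  leb.-integrable setT (EFin \o w) -> leb.-integrable setT (EFin \o H) ->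
  (forall y x, `|g (y, x)| <= w y * H x) ->
  \int[leb]_y (\int[leb]_x g (y, x)) = \int[leb]_x (\int[leb]_y g (y, x)).
Proof.
move=> mg iw iH gle.
have mw : measurable_fun setT w by move/measurable_EFinP: (measurable_int leb iw).
have mH : measurable_fun setT H by move/measurable_EFinP: (measurable_int leb iH).
have mgy y : measurable_fun setT (fun x => g (y, x)).
  by apply: measurableT_comp => //; exact: measurable_fun_pair2.
have mgx x : measurable_fun setT (fun y => g (y, x)).
  by apply: measurableT_comp => //; exact: measurable_fun_pair1.
have igy y : leb.-integrable setT (fun x => (g (y, x))%:E).
  have iwH : leb.-integrable setT (fun x => (w y * H x)%:E).
    by under eq_fun do rewrite EFinM; exact: integrableZl.
  apply: (le_integrable measurableT _ _ iwH); first by move/measurable_EFinP: (mgy y).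
  by move=> x _; rewrite lee_fin (le_trans (gle _ _))// ler_norm.
have igx x : leb.-integrable setT (fun y => (g (y, x))%:E).
  have iwH : leb.-integrable setT (fun y => (w y * H x)%:E).
    by under eq_fun do rewrite EFinM; exact: integrableZr.
  apply: (le_integrable measurableT _ _ iwH); first by move/measurable_EFinP: (mgx x).
  by move=> y _; rewrite lee_fin (le_trans (gle _ _))// ler_norm.
have ig : (leb \x leb)%E.-integrable setT (EFin \o g).
  apply/integrable12ltyP; first exact/measurable_EFinP.
  have : leb.-integrable setT (fun y => (`|w y| * \int[leb]_x `|H x|)%:E).
    under eq_fun do rewrite EFinM; apply: integrableZr => //.
    exact: (integrable_norm iw).
  move=> /(integrable_lty measurableT); apply: le_lt_trans.
  apply: ge0_le_integral => //.
  - by move=> y _; exact: integral_ge0.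
  - have := @measurable_fun_integral_parameter _ _ (measurableTypeR R)
      (measurableTypeR R) R leb (fun z => `|(g z)%:E|%E).
    apply; apply: measurableT_comp => //.
    by move/measurable_EFinP: mg.
  - apply/measurable_EFinP; apply: measurable_funM => //.
    exact: measurableT_comp.
  move=> y _ /=.
  rewrite EFinM /Rintegral fineK; last first.
    by apply: integrable_fin_num => //; exact: (integrable_norm iH).
  rewrite -ge0_integralZl//; last first.
    by apply/measurable_EFinP; exact: measurableT_comp.
  apply: ge0_le_integral => //.
  - exact: (measurable_int leb (integrable_abse (igy y))).
  - apply/measurable_EFinP; apply: measurable_funM => //.
    exact: measurableT_comp.
  move=> x _; rewrite -EFinM lee_fin (le_trans (gle _ _))//.
  by rewrite (le_trans (ler_norm _))// normrM.
rewrite [LHS]/Rintegral [RHS]/Rintegral; congr fine.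
transitivity (\int[leb]_y \int[leb]_x (g (y, x))%:E)%E.
  by apply: eq_integral => y _; rewrite fineK//; exact: integrable_fin_num.
rewrite (Fubini ig).
by apply: eq_integral => x _; rewrite fineK//; exact: integrable_fin_num.
Qed.

End FubiniDominated.

(** * Explicit integrals of exponentials and of the Cauchy kernel *)

Section RealLineIntegrals.
Context {R : realType}.
Implicit Types (f F G : R -> R).

Lemma cvg_pinfty_le_inv f (K : R) : (forall x, 1 <= x -> `|f x| <= K / x) ->
  f x @[x --> +oo] --> (0 : R).
Proof.
move=> fK.
have K0 : 0 <= K by have := fK _ (lexx 1); rewrite divr1; exact: le_trans.
apply/cvgrPdist_le => e e0.
exists (1 + K / e); split; first exact: num_real.
move=> z ez; have Ke : 0 <= K / e by rewrite divr_ge0// ltW.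
have z1 : 1 <= z by rewrite (le_trans _ (ltW ez))// lerDl.
rewrite sub0r normrN (le_trans (fK _ z1))// ler_pdiv_swap//; first by lra.
by rewrite (le_trans _ (ltW ez))// lerDr.
Qed.

Lemma ge0_integralT_halves G : (forall x, 0 <= G x) -> continuous G ->
  (\int[leb]_x (G x)%:E = \int[leb]_(x in `[0%R, +oo[) (G x)%:E +
                          \int[leb]_(x in `[0%R, +oo[) (G (- x))%:E)%E.
Proof.
move=> G0 cG.
have mG : measurable_fun [set: R] G by exact: continuous_measurable_fun.
rewrite -(setUv `[0%R, +oo[%classic) ge0_integral_setU//=; last 4 first.
- exact: measurableC.
- by apply/measurable_EFinP; rewrite setUv.
- by move=> x _; rewrite lee_fin.
- exact/disj_setPCl.
congr (_ + _)%E.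
rewrite setCitvr integral_itv_bndo_bndc; last exact/measurable_EFinP/measurable_funTS.
rewrite -{1}oppr0 ge0_integration_by_substitutionNy//.
exact: continuous_subspaceT.
Qed.

Lemma ge0_integral_itvcy_primitive f F (l : R) : (forall x, 0 <= x -> 0 <= f x) ->
  (forall x : R, 0 <= x -> is_derive x 1 F (f x)) -> continuous f ->
  F x @[x --> +oo] --> l ->
  (\int[leb]_(x in `[0%R, +oo[) (f x)%:E = l%:E - (F 0)%:E)%E.
Proof.
move=> f0 dF cf Fl; apply: ge0_continuous_FTC2y => //.
- exact: continuous_subspaceT.
- by move=> x /ltW x0; have [] := dF _ x0.
- by apply: cvg_at_right_filter; exact: is_derive1_continuous (dF _ (lexx 0)).
- by move=> x; rewrite in_itv/= andbT => /ltW /dF[_ <-]; rewrite derive1E.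
Qed.

Lemma ge0_integralT_primitive f F (l l' : R) : (forall x, 0 <= f x) ->
  (forall x : R, is_derive x 1 F (f x)) -> continuous f ->
  F x @[x --> +oo] --> l -> F (- x) @[x --> +oo] --> l' ->
  (\int[leb]_x (f x)%:E = (l - l')%:E)%E.
Proof.
move=> f0 dF cf Fl Fl'.
rewrite ge0_integralT_halves// (ge0_integral_itvcy_primitive _ _ _ Fl)//.
have dFN x : is_derive x (1:R) (fun x => - F (- x)) (f (- x)).
  eapply is_derive_eq.
    eapply (@is_derive_lambdaN _ (fun x => F (- x))).
    by eapply (@is_derive_lambda_comp _ F (fun x => - x)); [exact: dF|repeat derive_step].
  by rewrite /=; ring.
rewrite (@ge0_integral_itvcy_primitive (fun x => f (- x)) (fun x => - F (- x)) (- l'))//.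
- by rewrite oppr0 -!EFinB -EFinD; congr EFin; ring.
- by move=> x; apply: continuous_comp; [exact: opp_continuous|exact: cf].
- exact: cvgN.
Qed.

(** The constant [M] makes the integrand nonnegative, so that the integral over the half-line is the
    increment of a primitive; it is subtracted again in [Rintegral_exp_norm_trig]. *)
Lemma integral_exp_trig (e v M A B : R) : 0 < e -> `|A| + `|B| <= M ->
  (\int[leb]_(y in `[0%R, +oo[)
    (expR (- (e * y)) * (M + (A * cos (v * y) + B * sin (v * y))))%:E
   = (M / e + (A * e + B * v) / (e ^+ 2 + v ^+ 2))%:E)%E.
Proof.
move=> e0 ABM; have D0 : 0 < e ^+ 2 + v ^+ 2 by rewrite ltr_pwDl ?sqr_ge0// exprn_gt0.
set D := e ^+ 2 + v ^+ 2 in D0 *.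
(* Coefficients for which - e^(-e y) (a cos + b sin) / D is a primitive of e^(-e y) (A cos + B
   sin). *)
pose a := A * e + B * v; pose b := B * e - A * v.
pose Q y := M / e + (a * cos (v * y) + b * sin (v * y)) / D.
pose F y := - (expR (- (e * y)) * Q y).
have cs x : `|cos x| <= 1 :> R by rewrite ler_norml cos_geN1 cos_le1.
have sn x : `|sin x| <= 1 :> R by rewrite ler_norml sin_geN1 sin_le1.
have dexp y : is_derive y (1:R) (fun y => expR (- (e * y))) (- e * expR (- (e * y))).
  eapply is_derive_eq.
    eapply (@is_derive_lambda_comp _ expR (fun y => - (e * y))).
      exact: is_derive_expR.
    exact: (is_derive_lambdaN (is_derive_lambda_linear e y)).
  by rewrite /=; ring.
have dtrig y (p q : R) : is_derive y (1:R) (fun y => p * cos (v * y) + q * sin (v * y))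
    (- p * v * sin (v * y) + q * v * cos (v * y)).
  have dv := is_derive_lambda_linear v y.
  by eapply is_derive_eq; [repeat derive_step|rewrite /=; ring].
have dF y : is_derive y (1:R) F (expR (- (e * y)) * (M + (A * cos (v * y) + B * sin (v * y)))).
  rewrite /F /Q; eapply is_derive_eq.
    exact: (is_derive_lambdaN (is_derive_lambdaM (dexp y) (is_derive_lambdaD
      (is_derive_lambda_cst _ y)
      (is_derive_lambdaM (dtrig y a b) (is_derive_lambda_cst _ y))))).
  move: D0; rewrite /D /a /b /= => D0; field.
  by rewrite !gt_eqF.
have Fl : F y @[y --> +oo] --> (0 : R).
  apply: (@cvg_pinfty_le_inv _ ((`|M / e| + (`|a| + `|b|) / D) / e)) => y y1.
  have y0 : 0 < y by lra.
  rewrite /F normrN normrM ger0_norm ?expR_ge0//.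
  have h1 : expR (- (e * y)) <= (e * y)^-1.
    rewrite expRN lef_pV2 ?posrE ?expR_gt0 ?mulr_gt0//.
    by rewrite (le_trans _ (expR_ge1Dx _))// lerDr.
  have h2 : `|Q y| <= `|M / e| + (`|a| + `|b|) / D.
    rewrite (le_trans (ler_normD _ _))// lerD2l normrM normfV (gtr0_norm D0).
    rewrite ler_pM2r ?invr_gt0// (le_trans (ler_normD _ _))// !normrM.
    by rewrite lerD// ler_piMr.
  have := ler_pM (expR_ge0 _) (normr_ge0 _) h1 h2; move/le_trans; apply.
  by rewrite invfM mulrC mulrA.
rewrite (@ge0_integral_itvcy_primitive _ F 0)//.
- rewrite /F /Q !mulr0 oppr0 expR0 cos0 sin0 mulr0 mulr1 addr0 mul1r.
  by rewrite -EFinB; congr EFin; rewrite opprK add0r.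
- move=> y _; rewrite mulr_ge0 ?expR_ge0//.
  have : `|A * cos (v * y) + B * sin (v * y)| <= M.
    rewrite (le_trans (ler_normD _ _))// (le_trans _ ABM)// !normrM.
    by rewrite lerD// ler_piMr.
  by rewrite ler_norml => /andP[+ _]; lra.
- move=> y; apply: cvgM.
    exact: is_derive1_continuous (dexp y).
  apply: cvgD; first exact: cvg_cst.
  exact: is_derive1_continuous (dtrig y A B).
Qed.

Lemma integral_exp_norm_trig (e v M A B : R) : 0 < e -> `|A| + `|B| <= M ->
  (\int[leb]_y
    (expR (- (e * `|y|)) * (M + (A * cos (v * y) + B * sin (v * y))))%:E
   = (2 * M / e + 2 * A * e / (e ^+ 2 + v ^+ 2))%:E)%E.
Proof.
move=> e0 ABM.
have cs x : `|cos x| <= 1 :> R by rewrite ler_norml cos_geN1 cos_le1.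
have sn x : `|sin x| <= 1 :> R by rewrite ler_norml sin_geN1 sin_le1.
rewrite ge0_integralT_halves; last 2 first.
- move=> y; rewrite mulr_ge0 ?expR_ge0//.
  have : `|A * cos (v * y) + B * sin (v * y)| <= M.
    rewrite (le_trans (ler_normD _ _))// (le_trans _ ABM)// !normrM.
    by rewrite lerD// ler_piMr.
  by rewrite ler_norml => /andP[+ _]; lra.
- have cv : continuous (fun y => v * y) by move=> y; apply: cvgM; [exact: cvg_cst|exact: cvg_id].
  move=> y; apply: cvgM.
    apply: continuous_comp; last exact: continuous_expR.
    by apply: cvgN; apply: cvgM; [exact: cvg_cst|apply: cvg_norm; exact: cvg_id].
  apply: cvgD; first exact: cvg_cst.
  apply: cvgD; apply: cvgM; try exact: cvg_cst.
    by apply: continuous_comp; [exact: cv|exact: continuous_cos].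
  by apply: continuous_comp; [exact: cv|exact: continuous_sin].
rewrite (_ : (\int[leb]_(y in _) _)%E = (M / e + (A * e + B * v) / (e ^+ 2 + v ^+ 2))%:E); last first.
  rewrite -integral_exp_trig//; apply: eq_integral => y.
  by rewrite inE/= in_itv/= andbT => y0; rewrite ger0_norm.
rewrite (_ : (\int[leb]_(y in _) _)%E = (M / e + (A * e + (- B) * v) / (e ^+ 2 + v ^+ 2))%:E); last first.
  rewrite -integral_exp_trig ?normrN//; apply: eq_integral => y.
  rewrite inE/= in_itv/= andbT => y0; rewrite normrN ger0_norm//.
  by rewrite mulrN cosN sinN mulrN mulNr.
rewrite -EFinD; congr EFin; field.
by rewrite !gt_eqF// ltr_pwDl ?sqr_ge0// exprn_gt0.
Qed.

Lemma integrable_exp_norm (e : R) : 0 < e ->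
  leb.-integrable setT (fun y : R => (expR (- (e * `|y|)))%:E).
Proof.
move=> e0; have me : measurable_fun setT (fun y : R => expR (- (e * `|y|))).
  apply: continuous_measurable_fun => y.
  apply: continuous_comp; last exact: continuous_expR.
  by apply: cvgN; apply: cvgM; [exact: cvg_cst|apply: cvg_norm; exact: cvg_id].
apply/integrableP; split; first by move/measurable_EFinP: me.
have := @integral_exp_norm_trig e 0 1 0 0 e0; rewrite normr0 addr0 => /(_ ler01).
under eq_integral => y _ do rewrite !mul0r !addr0 mulr1.
move=> h; under eq_integral => y _ do rewrite gee0_abs ?lee_fin ?expR_ge0//.
by rewrite h ltry.
Qed.

(** The Fourier transform of e^(-e |y|) is the Cauchy kernel 2e / (e^2 + v^2); the sine part cancels
    by oddness. *)
Lemma Rintegral_exp_norm_trig (e v A B : R) : 0 < e ->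
  \int[leb]_y (expR (- (e * `|y|)) * (A * cos (v * y) + B * sin (v * y)))
  = A * (2 * e / (e ^+ 2 + v ^+ 2)).
Proof.
move=> e0; pose M := `|A| + `|B|.
have i1 : leb.-integrable setT (fun y : R => (expR (- (e * `|y|)) * M)%:E).
  by under eq_fun do rewrite EFinM; apply: integrableZr => //; exact: integrable_exp_norm.
have ABM : `|A| + `|B| <= M by [].
have h := @integral_exp_norm_trig e v M A B e0 ABM.
have M0 : `|0 : R| + `|0 : R| <= M by rewrite normr0 addr0 addr_ge0.
have h0 := @integral_exp_norm_trig e 0 M 0 0 e0 M0.
have cs x : `|cos x| <= 1 :> R by rewrite ler_norml cos_geN1 cos_le1.
have sn x : `|sin x| <= 1 :> R by rewrite ler_norml sin_geN1 sin_le1.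
have i2 : leb.-integrable setT (fun y : R =>
    (expR (- (e * `|y|)) * (M + (A * cos (v * y) + B * sin (v * y))))%:E).
  apply/integrableP; split.
    have cv : continuous (fun y => v * y) by move=> y; apply: cvgM; [exact: cvg_cst|exact: cvg_id].
    apply/measurable_EFinP; apply: continuous_measurable_fun => y; apply: cvgM.
      apply: continuous_comp; last exact: continuous_expR.
      by apply: cvgN; apply: cvgM; [exact: cvg_cst|apply: cvg_norm; exact: cvg_id].
    apply: cvgD; first exact: cvg_cst.
    apply: cvgD; apply: cvgM; try exact: cvg_cst.
      by apply: continuous_comp; [exact: cv|exact: continuous_cos].
    by apply: continuous_comp; [exact: cv|exact: continuous_sin].
  rewrite (_ : (\int[leb]_x _)%E = (2 * M / e + 2 * A * e / (e ^+ 2 + v ^+ 2))%:E) ?ltry//.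
  rewrite -h; apply: eq_integral => y _; rewrite gee0_abs// lee_fin mulr_ge0 ?expR_ge0//.
  have : `|A * cos (v * y) + B * sin (v * y)| <= M.
    rewrite (le_trans (ler_normD _ _))// !normrM.
    by rewrite lerD// ler_piMr.
  by rewrite ler_norml => /andP[+ _]; lra.
transitivity (\int[leb]_y (expR (- (e * `|y|)) * (M + (A * cos (v * y) + B * sin (v * y)))
    - expR (- (e * `|y|)) * M)).
  by apply: eq_Rintegral => y _; ring.
rewrite RintegralB// /Rintegral h.
have -> : (\int[leb]_x (expR (- (e * `|x|)) * M)%:E
    = (2 * M / e + 2 * 0 * e / (e ^+ 2 + 0 ^+ 2))%:E)%E.
  rewrite -h0; apply: eq_integral => y _; congr EFin; ring.
rewrite /=; field.
by rewrite !gt_eqF// ltr_pwDl ?sqr_ge0// exprn_gt0.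
Qed.

(** The mass does not depend on the width [e]. This makes the kernel an approximate identity in
    Plancherel's identity, and later bounds the time integral of the dispersive majorant whatever
    its width. *)
Lemma integral_Cauchy_kernel (e c x : R) : 0 < e -> 0 < c ->
  (\int[leb]_y (2 * e / (e ^+ 2 + (c * (x - y)) ^+ 2))%:E = (2 * pi / c)%:E)%E.
Proof.
move=> e0 c0.
have D0 y : 0 < e ^+ 2 + (c * (x - y)) ^+ 2 by rewrite ltr_pwDl ?sqr_ge0// exprn_gt0.
pose F y := 2 / c * atan (c / e * (y - x)).
have aty : (fun y => atan (c / e * (y - x))) y @[y --> +oo] --> (pi / 2 : R).
  apply: (@cvg_comp _ _ _ (fun y => c / e * (y - x)) atan); last exact: cvgy_atan.
  apply/cvgryPge => K; exists (K * (e / c) + x); split; first exact: num_real.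
  move=> y; rewrite -ltrBrDr => h.
  rewrite (_ : K = c / e * (K * (e / c))); last by field; rewrite !gt_eqF.
  by rewrite ler_pM2l ?divr_gt0// ltW.
have atNy : (fun y => atan (c / e * (- y - x))) y @[y --> +oo] --> (- (pi / 2) : R).
  have -> : (fun y => atan (c / e * (- y - x))) = (fun y => - atan (c / e * (y + x))).
    by apply/funext => y; rewrite -atanN; congr atan; ring.
  apply: cvgN; apply: (@cvg_comp _ _ _ (fun y => c / e * (y + x)) atan); last exact: cvgy_atan.
  apply/cvgryPge => K; exists (K * (e / c) - x); split; first exact: num_real.
  move=> y; rewrite ltrBlDr => h.
  rewrite (_ : K = c / e * (K * (e / c))); last by field; rewrite !gt_eqF.
  by rewrite ler_pM2l ?divr_gt0// ltW.
have f0 y : 0 <= 2 * e / (e ^+ 2 + (c * (x - y)) ^+ 2).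
  by rewrite divr_ge0//; [rewrite mulr_ge0// ltW|exact: ltW].
have dF y : is_derive y (1:R) F (2 * e / (e ^+ 2 + (c * (x - y)) ^+ 2)).
  rewrite /F; eapply is_derive_eq.
    exact: (is_derive_lambdaM (is_derive_lambda_cst (2 / c) y)
      (@is_derive_lambda_comp _ atan (fun y => c / e * (y - x)) y _ _ (is_derive1_atan _)
        (is_derive_lambdaM (is_derive_lambda_cst (c / e) y)
          (is_derive_lambdaD (is_derive_lambda_id y) (is_derive_lambda_cst (- x) y))))).
  have := D0 y => Dy; rewrite /=; field.
  rewrite !gt_eqF//=.
have cf : continuous (fun y => 2 * e / (e ^+ 2 + (c * (x - y)) ^+ 2)).
  move=> y; apply: cvgM; first exact: cvg_cst.
  apply: cvgV; first by rewrite gt_eqF.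
  apply: cvgD; first exact: cvg_cst.
  by rewrite expr2; apply: cvgM; (apply: cvgM; first exact: cvg_cst);
    (apply: cvgB; [exact: cvg_cst|exact: cvg_id]).
have Fl : F y @[y --> +oo] --> 2 / c * (pi / 2) by apply: cvgM => //; exact: cvg_cst.
have Fl' : F (- y) @[y --> +oo] --> 2 / c * - (pi / 2) by apply: cvgM => //; exact: cvg_cst.
rewrite (ge0_integralT_primitive f0 dF cf Fl Fl').
by congr EFin; field; rewrite gt_eqF.
Qed.

End RealLineIntegrals.

(** * Plancherel's identity *)

Section CompactSupport.
Context {R : realType}.
Variables (f : R -> R) (a b : R).
Hypothesis cf : continuous f.
Hypothesis f_out : forall x, x \notin `[a, b] -> f x = 0.

Lemma compact_support_integrable : leb.-integrable setT (EFin \o f).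
Proof.
have -> : EFin \o f = (EFin \o f) \_ `[a, b].
  apply/funext => x; rewrite patchE; case: ifPn => // xab.
  by rewrite /= f_out//; move: xab; rewrite notin_setE/= => /negP.
have h := @continuous_integrable_itv _ f a b (fun x _ => @cf x).
exact: ((@integrable_mkcond _ _ _ leb `[a, b]%classic (EFin \o f) (measurable_itv `[a, b])).1 h).
Qed.

Lemma compact_support_bounded : exists2 M, 0 <= M & forall x, `|f x| <= M.
Proof.
have [ab|ba] := leP a b; last first.
  exists 0 => // x; rewrite f_out ?normr0// in_itv/=; apply/negP => /andP[h1 h2].
  by have := le_trans h1 h2; rewrite leNgt ba.
have [|c cab cM] := @EVT_max R (fun x => `|f x|) a b ab.
  by apply: continuous_subspaceT => x; apply: cvg_norm; exact: cf.
exists `|f c| => // x; have [xab|xab] := boolP (x \in `[a, b]); first exact: cM.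
by rewrite f_out// normr0.
Qed.

End CompactSupport.

Section Plancherel.
Context {R : realType}.
Variables (f1 f2 : R -> R) (a b c : R).
Hypothesis c0 : 0 < c.
Hypothesis cf1 : continuous f1.
Hypothesis cf2 : continuous f2.
Hypothesis f1_out : forall x, x \notin `[a, b] -> f1 x = 0.
Hypothesis f2_out : forall x, x \notin `[a, b] -> f2 x = 0.

(** [p] and [q] are the real and imaginary parts of f(x) e^(i c y x) with f = f1 + i f2, so [P] + i
    [Q] is a Fourier integral of f. *)
Let p y x := f1 x * cos (c * y * x) - f2 x * sin (c * y * x).
Let q y x := f1 x * sin (c * y * x) + f2 x * cos (c * y * x).
Let P (y : R) : R := \int[leb]_x p y x.
Let Q (y : R) : R := \int[leb]_x q y x.
Let H (x : R) : R := `|f1 x| + `|f2 x|.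
Let w (e y : R) : R := expR (- (e * `|y|)).
Let N2 (x : R) : R := f1 x ^+ 2 + f2 x ^+ 2.

Let cs x : `|cos x| <= 1 :> R.
Proof. by rewrite ler_norml cos_geN1 cos_le1. Qed.
Let sn x : `|sin x| <= 1 :> R.
Proof. by rewrite ler_norml sin_geN1 sin_le1. Qed.

Let H_ge0 x : 0 <= H x.
Proof. by rewrite addr_ge0. Qed.

Let p_le y x : `|p y x| <= H x.
Proof.
rewrite /p /H (le_trans (ler_normB _ _))// !normrM.
by rewrite lerD// ler_piMr.
Qed.

Let q_le y x : `|q y x| <= H x.
Proof.
rewrite /q /H (le_trans (ler_normD _ _))// !normrM.
by rewrite lerD// ler_piMr.
Qed.

Let cH : continuous H.
Proof. by move=> x; apply: cvgD; apply: cvg_norm; [exact: cf1|exact: cf2]. Qed.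

Let H_out x : x \notin `[a, b] -> H x = 0.
Proof. by move=> xab; rewrite /H f1_out// f2_out// normr0 addr0. Qed.

Let iH : leb.-integrable setT (EFin \o H).
Proof. exact: compact_support_integrable cH H_out. Qed.

Let mf1 : measurable_fun setT f1.
Proof. exact: continuous_measurable_fun. Qed.
Let mf2 : measurable_fun setT f2.
Proof. exact: continuous_measurable_fun. Qed.

Let mphase : measurable_fun setT (fun z : R * R => c * z.1 * z.2).
Proof. by apply: measurable_funM => //; apply: measurable_funM. Qed.

Let mcos : measurable_fun setT (fun z : R * R => cos (c * z.1 * z.2)).
Proof.
have m := continuous_measurable_fun (@continuous_cos R).
exact: (measurableT_comp m mphase).
Qed.

Let msin : measurable_fun setT (fun z : R * R => sin (c * z.1 * z.2)).
Proof.
have m := continuous_measurable_fun (@continuous_sin R).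
exact: (measurableT_comp m mphase).
Qed.

Let mp : measurable_fun setT (fun z : R * R => p z.1 z.2).
Proof.
apply: measurable_funB; apply: measurable_funM => //.
  exact: (measurableT_comp mf1).
exact: (measurableT_comp mf2).
Qed.

Let mq : measurable_fun setT (fun z : R * R => q z.1 z.2).
Proof.
apply: measurable_funD; apply: measurable_funM => //.
  exact: (measurableT_comp mf1).
exact: (measurableT_comp mf2).
Qed.

Let mP : measurable_fun setT P.
Proof.
exact: (@measurable_fun_Rintegral_parameter _ _ (measurableTypeR R)
  (measurableTypeR R) R leb (fun z => p z.1 z.2)).
Qed.

Let mQ : measurable_fun setT Q.
Proof.
exact: (@measurable_fun_Rintegral_parameter _ _ (measurableTypeR R)
  (measurableTypeR R) R leb (fun z => q z.1 z.2)).
Qed.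

Let ip y : leb.-integrable setT (EFin \o p y).
Proof.
apply: (le_integrable measurableT _ _ iH).
  by move/measurable_EFinP: (measurable_fun_pair2 y mp).
by move=> x _; rewrite lee_fin (le_trans (p_le _ _))// ler_norm.
Qed.

Let iq y : leb.-integrable setT (EFin \o q y).
Proof.
apply: (le_integrable measurableT _ _ iH).
  by move/measurable_EFinP: (measurable_fun_pair2 y mq).
by move=> x _; rewrite lee_fin (le_trans (q_le _ _))// ler_norm.
Qed.

Let K := \int[leb]_x H x.

Let P_le y : `|P y| <= K.
Proof.
rewrite (le_trans (le_normr_Rintegral _ _))//.
apply: le_Rintegral => //; exact: (integrable_norm (ip y)).
Qed.

Let Q_le y : `|Q y| <= K.
Proof.
rewrite (le_trans (le_normr_Rintegral _ _))//.
apply: le_Rintegral => //; exact: (integrable_norm (iq y)).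
Qed.

Let mw e : measurable_fun setT (w e).
Proof.
apply: continuous_measurable_fun => y.
apply: continuous_comp; last exact: continuous_expR.
by apply: cvgN; apply: cvgM; [exact: cvg_cst|apply: cvg_norm; exact: cvg_id].
Qed.

Let iw e : 0 < e -> leb.-integrable setT (EFin \o w e).
Proof. by move=> e0; exact: integrable_exp_norm. Qed.

Let weighted_swap e : 0 < e ->
  \int[leb]_y (w e y * (P y ^+ 2 + Q y ^+ 2))
  = \int[leb]_x (\int[leb]_y (w e y * (P y * p y x + Q y * q y x))).
Proof.
move=> e0.
have -> : \int[leb]_y (w e y * (P y ^+ 2 + Q y ^+ 2))
    = \int[leb]_y (\int[leb]_x (w e y * (P y * p y x + Q y * q y x))).
  apply: eq_Rintegral => y _.
  rewrite RintegralZl//; last first.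
    by apply: integrable_EFinD => //; exact: integrable_EFinZl.
  rewrite RintegralD//; last 2 first.
    exact: integrable_EFinZl.
    exact: integrable_EFinZl.
  by rewrite !RintegralZl.
pose g (z : R * R) := w e z.1 * (P z.1 * p z.1 z.2 + Q z.1 * q z.1 z.2).
apply: (@Rintegral_dominated_swap _ g (fun y => w e y * (2 * K)) H) => //.
- apply: measurable_funM.
    exact: (measurableT_comp (mw e)).
  by apply: measurable_funD; apply: measurable_funM => //;
    [exact: (measurableT_comp mP)|exact: (measurableT_comp mQ)].
- by apply: integrable_EFinZr => //; exact: iw.
- move=> y x; rewrite /g /= normrM ger0_norm ?expR_ge0// -mulrA ler_wpM2l ?expR_ge0//.
  rewrite (le_trans (ler_normD _ _))// !normrM.
  have := ler_pM (normr_ge0 _) (normr_ge0 _) (P_le y) (p_le y x).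
  have := ler_pM (normr_ge0 _) (normr_ge0 _) (Q_le y) (q_le y x).
  lra.
Qed.

Let kernel (e v : R) : R := 2 * e / (e ^+ 2 + v ^+ 2).
(** The real part of f(x) times the conjugate of the Cauchy mean of f around [x], of mass 2 pi /
    c. *)
Let T (e x : R) : R := \int[leb]_t ((f1 x * f1 t + f2 x * f2 t) * kernel e (c * (x - t))).

(** By the addition formulas [p y t * p y x + q y t * q y x] depends on y only through the angle c
    (x - t) y, so the integral over y is the transform of the weight. *)
Let inner_swap e x : 0 < e ->
  \int[leb]_y (w e y * (P y * p y x + Q y * q y x)) = T e x.
Proof.
move=> e0.
have trig y t : p y t * p y x + q y t * q y x
    = (f1 x * f1 t + f2 x * f2 t) * cos (c * (x - t) * y)
      + (f1 t * f2 x - f2 t * f1 x) * - sin (c * (x - t) * y).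
  have -> : c * (x - t) * y = c * y * x - c * y * t by ring.
  by rewrite cosB sinB /p /q; ring.
have -> : \int[leb]_y (w e y * (P y * p y x + Q y * q y x))
    = \int[leb]_y (\int[leb]_t (w e y * (p y t * p y x + q y t * q y x))).
  apply: eq_Rintegral => y _.
  rewrite RintegralZl//; last first.
    by apply: integrable_EFinD => //; exact: integrable_EFinZr.
  rewrite RintegralD//; last 2 first.
    exact: integrable_EFinZr.
    exact: integrable_EFinZr.
  by rewrite !RintegralZr.
pose g (z : R * R) := w e z.1 * (p z.1 z.2 * p z.1 x + q z.1 z.2 * q z.1 x).
have mpx : measurable_fun setT (fun z : R * R => p z.1 x).
  by apply: (measurableT_comp (f := fun y => p y x)) => //; exact: (measurable_fun_pair1 x mp).
have mqx : measurable_fun setT (fun z : R * R => q z.1 x).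
  by apply: (measurableT_comp (f := fun y => q y x)) => //; exact: (measurable_fun_pair1 x mq).
rewrite (@Rintegral_dominated_swap _ g (fun y => w e y * (2 * H x)) H) => //.
- apply: eq_Rintegral => t _; rewrite /g/=.
  under eq_Rintegral => y _ do rewrite trig mulrN -mulNr.
  by rewrite Rintegral_exp_norm_trig.
- apply: measurable_funM.
    exact: (measurableT_comp (mw e)).
  by apply: measurable_funD; apply: measurable_funM.
- by apply: integrable_EFinZr => //; exact: iw.
- move=> y t; rewrite /g /= normrM ger0_norm ?expR_ge0// -mulrA ler_wpM2l ?expR_ge0//.
  rewrite (le_trans (ler_normD _ _))// !normrM.
  have := ler_pM (normr_ge0 _) (normr_ge0 _) (p_le y x) (p_le y t).
  have := ler_pM (normr_ge0 _) (normr_ge0 _) (q_le y x) (q_le y t).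
  lra.
Qed.

Let D0 e v : 0 < e -> 0 < e ^+ 2 + v ^+ 2 :> R.
Proof. by move=> e0; rewrite ltr_pwDl ?sqr_ge0// exprn_gt0. Qed.

Let kernel_ge0 e v : 0 < e -> 0 <= kernel e v.
Proof.
move=> e0; rewrite /kernel divr_ge0//; first by rewrite mulr_ge0// ltW.
by rewrite ltW// D0.
Qed.

Let kernel_continuous e : 0 < e -> continuous (kernel e).
Proof.
move=> e0 v; apply: cvgM; first exact: cvg_cst.
apply: cvgV; first by rewrite gt_eqF// D0.
apply: cvgD; first exact: cvg_cst.
by rewrite expr2; apply: cvgM; exact: cvg_id.
Qed.

Let kernel_integral e d x : 0 < e -> 0 < d ->
  leb.-integrable setT (EFin \o (fun t => kernel e (d * (x - t)))) /\
  \int[leb]_t kernel e (d * (x - t)) = 2 * pi / d.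
Proof.
move=> e0 d0; have h := integral_Cauchy_kernel x e0 d0.
have mk : measurable_fun setT (fun t : R => kernel e (d * (x - t))).
  apply: continuous_measurable_fun => t.
  apply: (@continuous_comp _ _ _ (fun t => d * (x - t)) (kernel e)).
    by apply: cvgM; [exact: cvg_cst|apply: cvgB; [exact: cvg_cst|exact: cvg_id]].
  exact: kernel_continuous.
split; last by rewrite /Rintegral h.
apply/integrableP; split; first by move/measurable_EFinP: mk.
rewrite (_ : (\int[leb]_x0 _)%E = (2 * pi / d)%:E) ?ltry//.
rewrite -h; apply: eq_integral => t _.
by rewrite gee0_abs// lee_fin kernel_ge0.
Qed.

Let bound : exists2 M, 0 <= M & forall x, `|f1 x| <= M /\ `|f2 x| <= M.
Proof.
have [M1 M10 h1] := compact_support_bounded cf1 f1_out.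
have [M2 M20 h2] := compact_support_bounded cf2 f2_out.
exists (M1 + M2) => [|x]; first exact: addr_ge0.
by split; [rewrite (le_trans (h1 _))// lerDl|rewrite (le_trans (h2 _))// lerDr].
Qed.

(** Continuity at [x] and boundedness combined into one inequality. The ratio replaces the usual
    splitting into near and far points: it vanishes to second order at [x], which compensates the
    concentration of the kernel. *)
Let modulus (f : R -> R) M x : continuous f -> (forall x, `|f x| <= M) -> 0 <= M ->
  forall e, 0 < e -> exists2 L, 0 <= L & forall t,
    `|f t - f x| <= e + L * ((x - t) ^+ 2 / (1 + (x - t) ^+ 2)).
Proof.
move=> cf fM M0 e e0.
have /cvgrPdist_le/(_ _ e0)[d /= d0 dP] := cf x.
have d2 : 0 < d ^+ 2 by rewrite exprn_gt0.
have L0 : 0 <= 2 * M * ((1 + d ^+ 2) / d ^+ 2).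
  apply: mulr_ge0; first exact: mulr_ge0.
  by apply: divr_ge0; [apply: addr_ge0 => //|]; exact: ltW.
(* At distance at least d the ratio is at least d^2 / (1 + d^2), so this constant recovers the
   trivial bound 2M. *)
exists (2 * M * ((1 + d ^+ 2) / d ^+ 2)) => [//|t].
have s0 := sqr_ge0 (x - t).
have q0 : 0 <= (x - t) ^+ 2 / (1 + (x - t) ^+ 2) by rewrite divr_ge0// addr_ge0.
have [xt|xt] := ltP `|x - t| d.
  by rewrite distrC (le_trans (dP _ xt))// lerDl; exact: mulr_ge0.
rewrite (le_trans (ler_normB _ _))//.
have := fM t; have := fM x => h1 h2.
suff : 2 * M * 1 <= 2 * M * ((1 + d ^+ 2) / d ^+ 2) * ((x - t) ^+ 2 / (1 + (x - t) ^+ 2)) by lra.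
rewrite -[leRHS]mulrA ler_wpM2l ?mulr_ge0//.
have dx : d ^+ 2 <= (x - t) ^+ 2.
  by rewrite -(real_normK (num_real (x - t))) lerXn2r// nnegrE// ltW.
rewrite mulf_div ler_pdivlMr; last by rewrite mulr_gt0// ltr_pwDl.
by rewrite mul1r; lra.
Qed.

Let mT e : 0 < e -> measurable_fun setT (T e).
Proof.
move=> e0.
apply: (@measurable_fun_Rintegral_parameter _ _ (measurableTypeR R)
  (measurableTypeR R) R leb
  (fun z => (f1 z.1 * f1 z.2 + f2 z.1 * f2 z.2) * kernel e (c * (z.1 - z.2)))).
apply: measurable_funM; last first.
  have m : measurable_fun setT (fun z : R * R => c * (z.1 - z.2)).
    by apply: measurable_funM => //; exact: measurable_funB.
  have mk := continuous_measurable_fun (kernel_continuous e0).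
  exact: (measurableT_comp mk m).
apply: measurable_funD; apply: measurable_funM.
- exact: (measurableT_comp mf1).
- exact: (measurableT_comp mf1).
- exact: (measurableT_comp mf2).
- exact: (measurableT_comp mf2).
Qed.

Let integrable_kernelM (k : R -> R) B e x : 0 < e -> continuous k ->
  (forall t, `|k t| <= B) ->
  leb.-integrable setT (EFin \o (fun t => k t * kernel e (c * (x - t)))).
Proof.
move=> e0 ck kB; have [ik _] := kernel_integral x e0 c0.
apply: (le_integrable measurableT _ _ (integrable_EFinZl B measurableT ik)).
  have mk := continuous_measurable_fun ck.
  have mker : measurable_fun setT (fun t : R => kernel e (c * (x - t))).
    by move/measurable_EFinP: (measurable_int leb ik).
  by move/measurable_EFinP: (measurable_funM mk mker).
move=> t _ /=; rewrite lee_fin [leLHS]normrM [leRHS]normrM (ger0_norm (kernel_ge0 _ e0)).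
rewrite ler_wpM2r ?kernel_ge0// (le_trans (kB t))//.
by rewrite ler_norm.
Qed.

Let T_le e M x : 0 < e -> (forall x, `|f1 x| <= M /\ `|f2 x| <= M) ->
  `|T e x| <= H x * (M * (2 * pi / c)).
Proof.
move=> e0 fM; have [ik ikE] := kernel_integral x e0 c0.
have kB t : `|f1 x * f1 t + f2 x * f2 t| <= H x * M.
  rewrite (le_trans (ler_normD _ _))// !normrM /H mulrDl.
  by have [? ?] := fM t; rewrite lerD// ler_wpM2l.
have ck : continuous (fun t => f1 x * f1 t + f2 x * f2 t).
  by move=> t; apply: cvgD; apply: cvgM; try exact: cvg_cst; [exact: cf1|exact: cf2].
have iT := integrable_kernelM x e0 ck kB.
rewrite /T (le_trans (le_normr_Rintegral measurableT iT))//.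
rewrite mulrA -ikE -RintegralZl//.
apply: le_Rintegral => //; [exact: (integrable_norm iT)|exact: integrable_EFinZl|].
move=> t _; rewrite normrM (ger0_norm (kernel_ge0 _ e0)).
by rewrite ler_wpM2r ?kernel_ge0.
Qed.

Let T_approx M x e' : (forall x, `|f1 x| <= M /\ `|f2 x| <= M) -> 0 <= M -> 0 < e' ->
  exists2 L, 0 <= L & forall e, 0 < e ->
  `|T e x - 2 * pi / c * N2 x| <= H x * (e' * (2 * pi / c) + L * (e / c ^+ 2 * (2 * pi))).
Proof.
move=> fM M0 e'0.
have [L1 L10 h1] := modulus x cf1 (fun x => (fM x).1) M0 e'0.
have [L2 L20 h2] := modulus x cf2 (fun x => (fM x).2) M0 e'0.
exists (L1 + L2) => [|e e0]; first exact: addr_ge0.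
have [ik ikE] := kernel_integral x e0 c0.
have [ik1 ik1E] := kernel_integral x ltr01 ltr01.
have kB t : `|f1 x * f1 t + f2 x * f2 t| <= H x * M.
  rewrite (le_trans (ler_normD _ _))// !normrM /H mulrDl.
  by have [? ?] := fM t; rewrite lerD// ler_wpM2l.
have ck : continuous (fun t => f1 x * f1 t + f2 x * f2 t).
  by move=> t; apply: cvgD; apply: cvgM; try exact: cvg_cst; [exact: cf1|exact: cf2].
have iT := integrable_kernelM x e0 ck kB.
have -> : T e x - 2 * pi / c * N2 x
    = \int[leb]_t ((f1 x * (f1 t - f1 x) + f2 x * (f2 t - f2 x)) * kernel e (c * (x - t))).
  rewrite /T -ikE mulrC -RintegralZl// -RintegralB//; last exact: integrable_EFinZl.
  by apply: eq_Rintegral => t _; rewrite /N2; ring.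
have ckd : continuous (fun t => f1 x * (f1 t - f1 x) + f2 x * (f2 t - f2 x)).
  move=> t; apply: cvgD; apply: cvgM; try exact: cvg_cst;
    (apply: cvgB; last exact: cvg_cst); [exact: cf1|exact: cf2].
have kBd t : `|f1 x * (f1 t - f1 x) + f2 x * (f2 t - f2 x)| <= H x * (2 * M).
  rewrite (le_trans (ler_normD _ _))// !normrM /H mulrDl.
  have [? ?] := fM t; have [? ?] := fM x.
  have g1 : `|f1 t - f1 x| <= 2 * M by rewrite (le_trans (ler_normB _ _))//; lra.
  have g2 : `|f2 t - f2 x| <= 2 * M by rewrite (le_trans (ler_normB _ _))//; lra.
  by rewrite lerD// ler_wpM2l.
have iD := integrable_kernelM x e0 ckd kBd.
rewrite (le_trans (le_normr_Rintegral measurableT iD))//.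
have -> : H x * (e' * (2 * pi / c) + (L1 + L2) * (e / c ^+ 2 * (2 * pi)))
    = \int[leb]_t (H x * (e' * kernel e (c * (x - t)) +
                          (L1 + L2) * (e / c ^+ 2 * kernel 1 (1 * (x - t))))).
  have i1 := integrable_EFinZl e' measurableT ik.
  have i2 := integrable_EFinZl (L1 + L2) measurableT (integrable_EFinZl (e / c ^+ 2) measurableT ik1).
  rewrite RintegralZl//; last exact: integrable_EFinD.
  have E1 := RintegralZl e' measurableT ik.
  have i3 := integrable_EFinZl (e / c ^+ 2) measurableT ik1.
  have E2 := RintegralZl (L1 + L2) measurableT i3.
  have E3 := RintegralZl (e / c ^+ 2) measurableT ik1.
  by rewrite RintegralD// E1 E2 E3 ikE ik1E divr1.
apply: le_Rintegral => //; first exact: (integrable_norm iD).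
  apply: integrable_EFinZl => //; apply: integrable_EFinD => //.
    exact: integrable_EFinZl.
  by apply: integrable_EFinZl => //; exact: integrable_EFinZl.
move=> t _; rewrite normrM (ger0_norm (kernel_ge0 _ e0)).
set r := (x - t) ^+ 2 / (1 + (x - t) ^+ 2).
have r0 : 0 <= r by rewrite divr_ge0 ?sqr_ge0// addr_ge0 ?sqr_ge0.
have g : `|f1 x * (f1 t - f1 x) + f2 x * (f2 t - f2 x)| <= H x * (e' + (L1 + L2) * r).
  rewrite (le_trans (ler_normD _ _))// !normrM /H mulrDl.
  rewrite lerD// ler_wpM2l//.
    by rewrite (le_trans (h1 t))// lerD2l ler_wpM2r// lerDl.
  by rewrite (le_trans (h2 t))// lerD2l ler_wpM2r// lerDr.
have := ler_wpM2r (kernel_ge0 (c * (x - t)) e0) g; move/le_trans; apply.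
(* Since s / (e^2 + c^2 s) <= 1 / c^2, the product of the ratio and the kernel of width [e] is at
   most e / c^2 times the kernel of width 1, which is integrable and fixed. *)
suff hk : r * kernel e (c * (x - t)) <= e / c ^+ 2 * kernel 1 (1 * (x - t)).
  move: hk; set k1 := kernel e _; set k2 := kernel 1 _ => hk.
  rewrite (_ : H x * _ * k1 = H x * (e' * k1 + (L1 + L2) * (r * k1))); last by ring.
  by rewrite ler_wpM2l// lerD2l ler_wpM2l// addr_ge0.
rewrite /r /kernel mul1r expr1n mulr1.
have s0 := sqr_ge0 (x - t).
rewrite exprMn; move: s0; set s := (x - t) ^+ 2 => s0.
have c20 : 0 < c ^+ 2 by rewrite exprn_gt0.
have e20 : 0 < e ^+ 2 by rewrite exprn_gt0.
have s1 : 0 < 1 + s by rewrite ltr_pwDl.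
have d1 : 0 < e ^+ 2 + c ^+ 2 * s by rewrite ltr_pwDl// mulr_ge0// ltW.
rewrite -subr_ge0 (_ : _ - _ = 2 * e * e ^+ 2 / (c ^+ 2 * (1 + s) * (e ^+ 2 + c ^+ 2 * s))).
  by rewrite divr_ge0// !mulr_ge0// ltW.
by field; rewrite !gt_eqF.
Qed.

(** With the weight e^(-e |y|) all the integrals converge absolutely and Fubini's theorem turns the
    left side into the integral of [T e]. As e tends to 0 the left side converges by monotone
    convergence, which does not presuppose its finiteness, and the right side by dominated
    convergence. *)
Lemma Plancherel :
  (\int[leb]_y ((P y ^+ 2 + Q y ^+ 2)%:E) = (2 * pi / c * \int[leb]_x N2 x)%:E)%E.
Proof.
have [M M0 fM] := bound.
(* A decreasing sequence, so that the weights increase to 1. *)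
pose e_ n : R := n.+1%:R^-1.
have e0 n : 0 < e_ n by rewrite invr_gt0.
have PQ0 y : 0 <= P y ^+ 2 + Q y ^+ 2 by rewrite addr_ge0 ?sqr_ge0.
have mPQ : measurable_fun setT (fun y => P y ^+ 2 + Q y ^+ 2).
  by apply: measurable_funD; exact: measurable_funX.
have iS n : leb.-integrable setT (EFin \o (fun y => w (e_ n) y * (P y ^+ 2 + Q y ^+ 2))).
  apply: (le_integrable measurableT _ _ (integrable_EFinZr (2 * K ^+ 2) measurableT (iw (e0 n)))).
    by move/measurable_EFinP: (measurable_funM (mw (e_ n)) mPQ).
  move=> y _ /=; rewrite lee_fin [leLHS]normrM [leRHS]normrM (ger0_norm (expR_ge0 _)) ler_wpM2l ?expR_ge0//.
  rewrite (ger0_norm (PQ0 y)) (le_trans _ (ler_norm _))//.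
  have g1 : P y ^+ 2 <= K ^+ 2.
    by rewrite -(real_normK (num_real (P y))) lerXn2r// nnegrE ?P_le// (le_trans _ (P_le y)).
  have g2 : Q y ^+ 2 <= K ^+ 2.
    by rewrite -(real_normK (num_real (Q y))) lerXn2r// nnegrE ?Q_le// (le_trans _ (P_le y)).
  lra.
have cvg1 : (\int[leb]_y (w (e_ n) y * (P y ^+ 2 + Q y ^+ 2))%:E)%E @[n --> \oo]
    --> (\int[leb]_y ((P y ^+ 2 + Q y ^+ 2)%:E))%E.
  have -> : (\int[leb]_y ((P y ^+ 2 + Q y ^+ 2)%:E))%E
     = (\int[leb]_y limn (fun n => (w (e_ n) y * (P y ^+ 2 + Q y ^+ 2))%:E))%E.
    apply: eq_integral => y _; apply/esym/cvg_lim => //.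
    apply: cvg_EFin; first by near=> n.
    rewrite -[X in _ --> X]mul1r; apply: cvgM; last exact: cvg_cst.
    rewrite -expR0 -[X in _ --> expR X]oppr0 -[X in _ --> expR (- X)](mul0r `|y|).
    apply: continuous_cvg; first exact: continuous_expR.
    by apply: cvgN; apply: cvgM; [exact: cvg_harmonic|exact: cvg_cst].
  apply: (@cvg_monotone_convergence _ _ _ leb setT measurableT
    (fun n y => (w (e_ n) y * (P y ^+ 2 + Q y ^+ 2))%:E)).
  - by move=> n; exact: measurable_int (iS n).
  - by move=> n y _; rewrite lee_fin mulr_ge0// expR_ge0.
  - move=> y _ n m nm; rewrite lee_fin ler_wpM2r// ler_expR lerN2 ler_wpM2r//.
    by rewrite lef_pV2 ?posrE// ler_nat.
have S_T n : (\int[leb]_y (w (e_ n) y * (P y ^+ 2 + Q y ^+ 2))%:E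
    = \int[leb]_x (T (e_ n) x)%:E)%E.
  have iT : leb.-integrable setT (EFin \o T (e_ n)).
    apply: (le_integrable measurableT _ _ (integrable_EFinZr (M * (2 * pi / c)) measurableT iH)).
      by move/measurable_EFinP: (mT (e0 n)).
    by move=> x _ /=; rewrite lee_fin (le_trans (T_le _ (e0 n) fM))// ler_norm.
  have := weighted_swap (e0 n).
  under [X in _ = X -> _]eq_Rintegral => x _ do rewrite (inner_swap x (e0 n)).
  rewrite /Rintegral => h.
  rewrite -(fineK (integrable_fin_num measurableT (iS n))).
  by rewrite -(fineK (integrable_fin_num measurableT iT)) h.
have cvg2 : (\int[leb]_x (T (e_ n) x)%:E)%E @[n --> \oo]
    --> (\int[leb]_x (2 * pi / c * N2 x)%:E)%E.
  apply: (@dominated_cvg _ _ _ leb setT measurableT (fun n x => (T (e_ n) x)%:E)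
     (fun x => (2 * pi / c * N2 x)%:E) (fun x => (H x * (M * (2 * pi / c)))%:E)) => //.
  - by move=> n; move/measurable_EFinP: (mT (e0 n)).
  - move=> x _; apply: cvg_EFin; first by near=> n.
    apply/cvgrPdist_le => e1 e10.
    pose B := H x * (2 * pi / c) + 1.
    have B0 : 0 < B by rewrite ltr_wpDl// mulr_ge0// divr_ge0 ?mulr_ge0 ?pi_ge0// ltW.
    have e20 : 0 < e1 / 2 / B by rewrite !divr_gt0.
    have [L L0 LP] := T_approx x fM M0 e20.
    pose B' := H x * (L * (1 / c ^+ 2 * (2 * pi))).
    have h0 : e_ n @[n --> \oo] --> (0 : R) by exact: cvg_harmonic.
    have B'0 : 0 <= B'.
      do 2 apply: mulr_ge0 => //; apply: mulr_ge0; first by rewrite divr_ge0// sqr_ge0.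
      by rewrite mulr_ge0// pi_ge0.
    have e30 : 0 < e1 / 2 / (B' + 1) by rewrite !divr_gt0// ltr_wpDl.
    move/cvgrPdist_le : h0 => /(_ _ e30) h0; near=> n.
    rewrite distrC (le_trans (LP _ (e0 n)))//.
    have en : e_ n <= e1 / 2 / (B' + 1).
      have : `|0 - e_ n| <= e1 / 2 / (B' + 1) by near: n.
      by rewrite sub0r normrN ger0_norm// ltW.
    have -> : H x * (e1 / 2 / B * (2 * pi / c) + L * (e_ n / c ^+ 2 * (2 * pi)))
      = e1 / 2 / B * (H x * (2 * pi / c)) + e_ n * B' by rewrite /B'; ring.
    have g1 : e1 / 2 / B * (H x * (2 * pi / c)) <= e1 / 2.
      rewrite mulrAC ler_pdivrMr// ler_wpM2l//; first by rewrite divr_ge0// ltW.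
      by rewrite /B lerDl.
    have g2 : e_ n * B' <= e1 / 2.
      rewrite (le_trans (ler_wpM2r B'0 en))// mulrAC ler_pdivrMr ?ltr_wpDl//.
      by rewrite ler_wpM2l ?lerDl// divr_ge0// ltW.
    lra.
  - by apply: integrable_EFinZr.
  - by move=> n x _; rewrite lee_fin T_le.
have -> : (2 * pi / c * \int[leb]_x N2 x)%:E = (\int[leb]_x (2 * pi / c * N2 x)%:E)%E.
  have iN : leb.-integrable setT (EFin \o N2).
    apply: (@compact_support_integrable R N2 a b).
      by move=> x; apply: cvgD; rewrite expr2; apply: cvgM; first [exact: cf1|exact: cf2].
    by move=> x xab; rewrite /N2 f1_out// f2_out// expr0n/= addr0.
  rewrite -RintegralZl// /Rintegral fineK//.
  by apply: integrable_fin_num => //; exact: integrable_EFinZl.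
have E : (fun n => (\int[leb]_y (w (e_ n) y * (P y ^+ 2 + Q y ^+ 2))%:E)%E)
  = (fun n => (\int[leb]_x (T (e_ n) x)%:E)%E) by apply/funext.
move: cvg1; rewrite E => cvg1.
exact: (cvg_unique _ cvg1 cvg2).
Unshelve. all: by end_near. Qed.

End Plancherel.

(** * Amplitude and phase of the gallery modes *)

Section CubeRoot.
Context {R : realType}.
Implicit Types x y : R.

(** Every fractional power in a gallery mode is an integral power of this root, which makes the
    identities below rational. *)
Definition cbrt x := x `^ (1 / 3).

Lemma cbrt_gt0 x : 0 < x -> 0 < cbrt x.
Proof. exact: powR_gt0. Qed.

Lemma cbrtX x n : 0 <= x -> cbrt x ^+ n = x `^ (n%:R / 3).
Proof.
by move=> x0; rewrite /cbrt -powR_mulrn ?powR_ge0// -powRrM; congr (_ `^ _); ring.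
Qed.

Lemma cbrtK x : 0 <= x -> cbrt x ^+ 3 = x.
Proof. by move=> x0; rewrite cbrtX// divff// powRr1. Qed.

Lemma cbrtM x y : 0 <= x -> 0 <= y -> cbrt (x * y) = cbrt x * cbrt y.
Proof. by move=> x0 y0; rewrite /cbrt powRM. Qed.

Lemma cbrt_div x y : 0 < x -> 0 < y -> cbrt (x / y) = cbrt x / cbrt y.
Proof.
move=> x0 y0; have xy : x = x / y * y by rewrite divfK// gt_eqF.
have xy0 : 0 <= x / y by apply: divr_ge0; exact: ltW.
rewrite [in RHS]xy (cbrtM xy0 (ltW y0)).
by rewrite mulfK// gt_eqF// cbrt_gt0.
Qed.

Lemma is_derive_cbrt x : 0 < x -> is_derive x 1 cbrt (3 * cbrt x ^+ 2)^-1.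
Proof.
move=> x0; have := @is_derive1_powR R (1 / 3) x x0.
rewrite (_ : 1 / 3 * _ = (3 * cbrt x ^+ 2)^-1)//.
rewrite cbrtX ?(ltW x0)// invfM -powRN mul1r; congr (_ * _ `^ _).
by field.
Qed.

Lemma cbrt_bounds x : 1 / 2 <= x <= 3 / 2 -> 1 / 2 <= cbrt x <= 6 / 5.
Proof.
move=> /andP[x1 x2]; have x0 : 0 < x by lra.
have c0 := cbrt_gt0 x0; have cK := cbrtK (ltW x0).
apply/andP; split; rewrite leNgt; apply/negP => h.
  have : cbrt x ^+ 3 < (1 / 2) ^+ 3 by rewrite ltrXn2r //; lra.
  by rewrite cK; lra.
have : (6 / 5) ^+ 3 < cbrt x ^+ 3 by rewrite ltrXn2r //; lra.
by rewrite cK; lra.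
Qed.

End CubeRoot.

Section OscillatoryIntegral.
Context {R : realType}.
Implicit Types (P g k : R -> R) (a b l : R).

(** The primitive [J] of cos P vanishing at [a] is bounded on [a, b], van der Corput's lemma being
    applied on each [a, x]. Integrating by parts, both boundary terms vanish, since J(a) = 0 and
    g(b) = 0, and the variation of [g], carried by [k], remains. *)
Lemma van_der_Corput_amplitude P (P' P'' : R -> R) g (g' : R -> R) k (k' : R -> R) l a b :
  a <= b -> 0 < l ->
  (forall x, a <= x <= b -> is_derive x 1 P (P' x)) ->
  (forall x, a <= x <= b -> is_derive x 1 P' (P'' x)) ->
  (forall x, a <= x <= b -> l <= P'' x) ->
  (forall x, a <= x <= b -> is_derive x 1 g (g' x)) ->
  (forall x, a <= x <= b -> is_derive x 1 k (k' x)) ->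
  (forall x, a <= x <= b -> `|g' x| <= k' x) -> g b = 0 ->
  `|\int[leb]_(x in `[a, b]) (cos (P x) * g x)|
    <= (2 * pi + 1) / Num.sqrt l * (k b - k a).
Proof.
move=> ab l0 dP dP' lP dg dk gk gb.
have cP x : a <= x <= b -> {for x, continuous (fun x => cos (P x))}.
  move=> xab; apply: continuous_comp; last exact: continuous_cos.
  exact: is_derive1_continuous (dP _ xab).
have [F dF] := continuous_primitive_itv ab cP.
pose J x := F x - F a.
pose C := (2 * pi + 1) / Num.sqrt l.
have dJ x : a <= x <= b -> is_derive x (1:R) J (cos (P x)).
  move=> xab; rewrite -[cos (P x)]addr0 -oppr0.
  exact: (is_derive_lambdaD (dF _ xab) (is_derive_lambdaN (is_derive_lambda_cst (F a) x))).
have JC x : a <= x <= b -> `|J x| <= C.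
  move=> /andP[ax xb]; have sub t : a <= t <= x -> a <= t <= b.
    by move=> /andP[-> tx]; exact: le_trans xb.
  apply: (van_der_Corput_primitive ax l0 (P := P) (P' := P') (P'' := P'')).
  - by move=> t /sub; exact: dP.
  - by move=> t /sub; exact: dP'.
  - by move=> t /sub; exact: lP.
  - by move=> t /sub; exact: dF.
have := @Rintegral_comparison R (fun x => cos (P x) * g x) (fun x => J x * g x)
  (fun x => J x * g' x + g x * cos (P x)) (fun x => C * k x) (fun x => C * k' x) a b ab.
rewrite gb mulr0 /J subrr mul0r subr0 subr0 -mulrBr; apply.
- move=> x xab; apply: cvgM; first exact: cP.
  exact: is_derive1_continuous (dg _ xab).
- by move=> x xab; exact: (is_derive_lambdaM (dJ _ xab) (dg _ xab)).
- move=> x xab; have := is_derive_lambdaM (is_derive_lambda_cst C x) (dk _ xab).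
  by rewrite mulr0 addr0.
- move=> x xab; rewrite (_ : _ - _ = - (J x * g' x)); last by rewrite /J; ring.
  by rewrite normrN normrM ler_pM// ?JC// gk.
Qed.

Lemma Rintegral_supported (f : R -> R) a b : (forall x, x \notin `[a, b] -> f x = 0) ->
  \int[leb]_x f x = \int[leb]_(x in `[a, b]) f x.
Proof.
move=> f0; rewrite [RHS]Rintegral_mkcond; apply: eq_Rintegral => x _.
rewrite patchE; case: ifPn => // xab.
by rewrite f0//; move: xab; rewrite notin_setE/= => /negP.
Qed.

End OscillatoryIntegral.

(** * Integral and total variation of the amplitude *)

Section AmplitudeBounds.
Context {R : realType}.
Variables (y y' : R -> R) (w1 : R).
Hypothesis dy : forall x : R, is_derive x (1:R) y (y' x).
Hypothesis dy' : forall x : R, is_derive x (1:R) y' (x * y x).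
Hypothesis y_decay : forall x, 0 < x -> `|y x| <= 1 / x.
Hypothesis zero_w1 : y (- w1) = 0.
Hypothesis zeros_le : forall x, y x = 0 -> x <= - w1.
Implicit Types (X w x : R).

Let F := airy_energy y y'.
Let dF x : is_derive x (1:R) F (y x ^+ 2).
Proof. exact: is_derive_airy_energy. Qed.
Let F_nd a b : a <= b -> F a <= F b.
Proof. exact: airy_energy_nondecreasing. Qed.
Let F_le0 x : F x <= 0.
Proof. exact: (airy_energy_le0 dy dy' y_decay). Qed.
Let w1_gt0 : 0 < w1.
Proof. exact: (airy_first_zero_gt0 dy dy' y_decay zero_w1 zeros_le). Qed.

Let arg X w x := cbrt x ^+ 2 * X - w.

Let darg X w x : 0 < x -> is_derive x (1:R) (arg X w) (2 / 3 * X / cbrt x).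
Proof.
move=> x0; have c0 := cbrt_gt0 x0.
have h := is_derive_lambdaD (is_derive_lambdaM (is_derive_lambdaX 2 (is_derive_cbrt x0))
  (is_derive_lambda_cst X x)) (is_derive_lambda_cst (- w) x).
apply: (is_derive_eq h); rewrite /=; field; by rewrite gt_eqF.
Qed.

(** If X <= w/4 the argument stays below - w/2 and y is pointwise O(w^(-1/4)). Otherwise the
    argument moves with speed at least w/12: with m = w^(1/4), |y| <= (1/m + m y^2) / 2, and after
    the change of variable y^2 integrates to an increment of energy, at most y'(-w)^2 <= K m^2. This
    leaves 12 K m^3 / w = 12 K / m. *)
Lemma airy_argument_primitive : exists2 K, 0 < K & forall w, w1 <= w -> y (- w) = 0 ->
  forall X, 0 < X -> exists k k' : R -> R, [/\
    forall x, 1 / 2 <= x <= 3 / 2 -> is_derive x (1:R) k (k' x),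
    forall x, 1 / 2 <= x <= 3 / 2 -> `|y (cbrt x ^+ 2 * X - w)| <= k' x
  & k (3 / 2) - k (1 / 2) <= K / Num.sqrt (Num.sqrt w)].
Proof.
have [K [c [K0 _ KP]]] := airy_bounds_negative dy dy' y_decay zero_w1 zeros_le.
exists (2 * K + 1 + (1 + 12 * K)) => [|w ww1 yw X X0]; first by lra.
have w0 : 0 < w by exact: lt_le_trans ww1.
set m := Num.sqrt (Num.sqrt w).
have m0 : 0 < m by rewrite !sqrtr_gt0.
have m2 : m ^+ 2 = Num.sqrt w by rewrite sqr_sqrtr// sqrtr_ge0.
have m4 : m ^+ 4 = w by rewrite (exprM m 2 2) m2 sqr_sqrtr// ltW.
have i0 : 0 < m^-1 by rewrite invr_gt0.
have [up _ pw] := KP _ ww1.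
have [Xw|wX] := leP X (w / 4).
  exists (fun x => (2 * K + 1) / m * x), (fun=> (2 * K + 1) / m); split.
  - by move=> x _; exact: is_derive_lambda_linear.
  - move=> x /cbrt_bounds/andP[c1 c2].
    have c22 : cbrt x ^+ 2 <= 2.
      have : cbrt x ^+ 2 <= (6 / 5) ^+ 2 by rewrite lerXn2r// nnegrE; lra.
      lra.
    pose s := w - cbrt x ^+ 2 * X.
    have sw : w / 2 <= s.
      have : cbrt x ^+ 2 * X <= 2 * (w / 4) by rewrite ler_pM// ?sqr_ge0// ltW.
      rewrite /s; lra.
    have s0 : 0 < s by lra.
    rewrite (_ : _ - w = - s); last by rewrite /s; ring.
    have ys := pw _ sw.
    have q : Num.sqrt w / 2 <= Num.sqrt s.
      have -> : Num.sqrt w / 2 = Num.sqrt (w / 4).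
        rewrite sqrtrM ?(ltW w0)// (_ : (4^-1 : R) = 2^-1 ^+ 2); last by field.
        by rewrite sqrtr_sqr ger0_norm.
      by rewrite ler_wsqrtr//; lra.
    have y2 : (m * `|y (- s)|) ^+ 2 <= (2 * K + 1) ^+ 2.
      rewrite exprMn m2 real_normK ?num_real//.
      have : Num.sqrt w / 2 * y (- s) ^+ 2 <= Num.sqrt s * y (- s) ^+ 2.
        by rewrite ler_wpM2r// sqr_ge0.
      have := sqr_ge0 (2 * K); rewrite !expr2; lra.
    rewrite ler_pdivlMr// mulrC -(@ler_pXn2r _ 2)//.
    + by rewrite nnegrE mulr_ge0// ltW.
    + by rewrite nnegrE; lra.
  - by rewrite -mulrBr (_ : 3 / 2 - 1 / 2 = 1); [rewrite mulr1 ler_pM2r//; lra|field].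
have dk x : 1 / 2 <= x <= 3 / 2 -> is_derive x (1:R)
    (fun x => 1 / 2 * (m^-1 * x + m * (12 / w) * F (arg X w x)))
    (1 / 2 * (m^-1 + m * (12 / w) * (y (arg X w x) ^+ 2 * (2 / 3 * X / cbrt x)))).
  move=> /andP[x1 _]; have x0 : 0 < x by lra.
  have h := is_derive_lambdaM (is_derive_lambda_cst (1 / 2) x)
    (is_derive_lambdaD (is_derive_lambda_linear m^-1 x)
      (is_derive_lambdaM (is_derive_lambda_cst (m * (12 / w)) x)
        (is_derive_lambda_comp (dF (arg X w x)) (darg X w x0)))).
  apply: (is_derive_eq h); rewrite /=; ring.
exists (fun x => 1 / 2 * (m^-1 * x + m * (12 / w) * F (arg X w x))),
  (fun x => 1 / 2 * (m^-1 + m * (12 / w) * (y (arg X w x) ^+ 2 * (2 / 3 * X / cbrt x)))).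
split => //.
- move=> x xab; have /andP[c1 c2] := cbrt_bounds xab.
  have c0 : 0 < cbrt x by lra.
  rewrite -/(arg X w x); set v := y _.
  have am : 2 * `|v| <= m^-1 + m * v ^+ 2.
    rewrite -real_normK ?num_real// -subr_ge0.
    rewrite (_ : _ - _ = m^-1 * (1 - m * `|v|) ^+ 2); last by field; rewrite gt_eqF.
    by rewrite mulr_ge0 ?sqr_ge0// ltW.
  have h : v ^+ 2 <= 12 / w * (v ^+ 2 * (2 / 3 * X / cbrt x)).
    rewrite mulrCA -[leLHS]mulr1 ler_wpM2l ?sqr_ge0//.
    rewrite mulrA ler_pdivlMr// mul1r mulrAC ler_pdivlMr//.
    have : cbrt x * w <= 2 * w by rewrite ler_pM2r//; lra.
    lra.
  have := ler_wpM2l (ltW m0) h; rewrite mulrA; lra.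
- have a1 : - w <= arg X w (1 / 2).
    by rewrite /arg lerDr mulr_ge0 ?sqr_ge0// ltW.
  have Fd : F (arg X w (3 / 2)) - F (arg X w (1 / 2)) <= K * m ^+ 2.
    have := F_le0 (arg X w (3 / 2)); have := F_nd a1.
    rewrite [F (- w)]airy_energy_oppE// m2.
    by have /andP[_] := up yw; lra.
  have g : m * (12 / w) * (F (arg X w (3 / 2)) - F (arg X w (1 / 2))) <= 12 * K * m^-1.
    have : m * (12 / w) * (F (arg X w (3 / 2)) - F (arg X w (1 / 2))) <= m * (12 / w) * (K * m ^+ 2).
      by rewrite ler_wpM2l// ltW// mulr_gt0// divr_gt0.
    move/le_trans; apply.
    by rewrite -m4 le_eqVlt; apply/orP; left; apply/eqP; field; rewrite gt_eqF.
  have : 0 < K * m^-1 by rewrite mulr_gt0.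
  lra.
Qed.

(** Where the derivative falls on y, the change of variable turns the integral into the variation of
    y along the range of its argument, of order w^(5/4). The other terms are controlled by the
    integral of |y|, of order w^(-1/4). *)
Lemma airy_amplitude_bounds M : 0 <= M -> exists2 K, 0 < K &
  forall w, w1 <= w -> y (- w) = 0 -> forall X, 0 < X ->
  forall f f' : R -> R,
  (forall x, 1 / 2 <= x <= 3 / 2 -> is_derive x (1:R) f (f' x)) ->
  (forall x, 1 / 2 <= x <= 3 / 2 -> `|f x| <= M) ->
  (forall x, 1 / 2 <= x <= 3 / 2 -> `|f' x| <= M) ->
  exists g' k k' v v' : R -> R,
  let g x := f x * (cbrt x * y (cbrt x ^+ 2 * X - w)) in
  [/\ forall x, 1 / 2 <= x <= 3 / 2 ->
        [/\ is_derive x (1:R) g (g' x), is_derive x (1:R) k (k' x)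
          & is_derive x (1:R) v (v' x)],
      forall x, 1 / 2 <= x <= 3 / 2 -> `|g x| <= k' x /\ `|g' x| <= v' x,
      k (3 / 2) - k (1 / 2) <= K / Num.sqrt (Num.sqrt w)
    & v (3 / 2) - v (1 / 2) <= K * (w * Num.sqrt (Num.sqrt w))].
Proof.
move=> M0.
have [K1 K10 K1P] := airy_argument_primitive.
have [K2 [K20 [W [W' [dW yW KW]]]]] :=
  airy_total_variation dy dy' y_decay zero_w1 zeros_le.
(* [m1] is w1^(3/2): it absorbs w^(-1/4) into a multiple of w^(5/4). *)
pose m1 := w1 * Num.sqrt (Num.sqrt w1) ^+ 2.
have m10 : 0 < m1 by rewrite mulr_gt0// exprn_gt0// !sqrtr_gt0.
have j0 : 0 <= K1 / m1 by rewrite divr_ge0// ltW.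
pose K := 2 * M * K1 + 4 * M * (K1 / m1) + 2 * M * K2 + 1.
have MK1 : 0 <= M * K1 by rewrite mulr_ge0// ltW.
have MK2 : 0 <= M * K2 by rewrite mulr_ge0// ltW.
have MKj : 0 <= M * (K1 / m1) by rewrite mulr_ge0.
exists K => [|w ww1 yw X X0 f f' df fM f'M]; first by rewrite /K; lra.
have w0 : 0 < w by exact: lt_le_trans ww1.
have [k0 [k0' [dk0 yk0 k0K]]] := K1P _ ww1 yw _ X0.
set m := Num.sqrt (Num.sqrt w) in k0K *.
have m0 : 0 < m by rewrite !sqrtr_gt0.
pose g' x := f x * (cbrt x * (y' (arg X w x) * (2 / 3 * X / cbrt x))
    + y (arg X w x) * (3 * cbrt x ^+ 2)^-1)
  + cbrt x * y (arg X w x) * f' x.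
exists g', (fun x => 2 * M * k0 x), (fun x => 2 * M * k0' x),
  (fun x => 4 * M * k0 x + 2 * M * W (arg X w x)),
  (fun x => 4 * M * k0' x + 2 * M * (W' (arg X w x) * (2 / 3 * X / cbrt x))).
have Mk0 x : 1 / 2 <= x <= 3 / 2 -> 0 <= k0' x by move=> /yk0; exact: le_trans.
split.
- move=> x xab; have x0 : 0 < x by case/andP: xab; lra.
  split.
  + have h := is_derive_lambdaM (df _ xab) (is_derive_lambdaM (is_derive_cbrt x0)
      (is_derive_lambda_comp (dy (arg X w x)) (darg X w x0))).
    exact: h.
  + have h := is_derive_lambdaM (is_derive_lambda_cst (2 * M) x) (dk0 _ xab).
    by apply: (is_derive_eq h); ring.
  + have h := is_derive_lambdaD (is_derive_lambdaM (is_derive_lambda_cst (4 * M) x) (dk0 _ xab))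
     (is_derive_lambdaM (is_derive_lambda_cst (2 * M) x)
        (is_derive_lambda_comp (dW (arg X w x)) (darg X w x0))).
    by apply: (is_derive_eq h); ring.
- move=> x xab; have /andP[c1 c2] := cbrt_bounds xab.
  have c0 : 0 < cbrt x by lra.
  have fx := fM _ xab; have f'x := f'M _ xab; have yx := yk0 _ xab.
  have c1' : `|cbrt x| <= 2 by rewrite gtr0_norm//; lra.
  have cy : `|cbrt x * y (arg X w x)| <= 2 * k0' x by rewrite normrM ler_pM.
  split.
    by rewrite normrM; have := ler_pM (normr_ge0 _) (normr_ge0 _) fx cy; rewrite /arg; lra.
  have ic : (3 * cbrt x ^+ 2)^-1 <= 2.
    have c22 : 1 / 4 <= cbrt x ^+ 2.
      have : (1 / 2) ^+ 2 <= cbrt x ^+ 2 by rewrite lerXn2r// nnegrE; lra.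
      lra.
    by rewrite invf_ple ?posrE//; lra.
  have ic0 : 0 <= (3 * cbrt x ^+ 2)^-1 by rewrite invr_ge0 mulr_ge0// sqr_ge0.
  have t1 : `|y (arg X w x) * (3 * cbrt x ^+ 2)^-1| <= 2 * k0' x.
    by rewrite normrM (ger0_norm ic0) mulrC ler_pM.
  have p0 : 0 <= 2 / 3 * X / cbrt x.
    by apply: divr_ge0; [rewrite mulr_ge0// ltW|exact: ltW].
  have t2 : `|cbrt x * (y' (arg X w x) * (2 / 3 * X / cbrt x))|
      <= 2 * (W' (arg X w x) * (2 / 3 * X / cbrt x)).
    by rewrite normrM ler_pM// normrM (ger0_norm p0) ler_wpM2r.
  have t3 := ler_normD (cbrt x * (y' (arg X w x) * (2 / 3 * X / cbrt x)))
    (y (arg X w x) * (3 * cbrt x ^+ 2)^-1).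
  rewrite /g'; set A := cbrt x * (_ * _) + _ in t3 *.
  have t4 : `|A| <= 2 * (W' (arg X w x) * (2 / 3 * X / cbrt x)) + 2 * k0' x by lra.
  have t5 := ler_pM (normr_ge0 _) (normr_ge0 _) fx t4.
  have t6 := ler_pM (normr_ge0 _) (normr_ge0 _) cy f'x.
  rewrite (le_trans (ler_normD _ _))// [leLHS](_ : _ = `|f x| * `|A| + `|cbrt x * y (arg X w x)| * `|f' x|);
    last by rewrite !normrM.
  lra.
- rewrite -mulrBr (@le_trans _ _ (2 * M * (K1 / m)))//.
    by rewrite ler_wpM2l// mulr_ge0.
  by rewrite mulrA ler_pM2r ?invr_gt0// /K; lra.
- have a1 : - w <= arg X w (1 / 2).
    by rewrite /arg lerDr mulr_ge0 ?sqr_ge0// ltW.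
  have a2 : - w <= arg X w (3 / 2).
    by rewrite /arg lerDr mulr_ge0 ?sqr_ge0// ltW.
  have W1 : W (- w) <= W (arg X w (1 / 2)).
    by apply: (derive_ge0_le a1 (fun x _ => dW x)) => x _; exact: le_trans (yW x).
  have h1 := KW _ _ ww1 a2; rewrite -/m in h1.
  have wm : 0 <= w * m by rewrite mulr_ge0// ltW.
  have h2 : K1 / m <= K1 / m1 * (w * m).
    rewrite mulrAC ler_pdivlMr// mulrAC ler_pdivrMr// -mulrA ler_pM2l//.
    rewrite -mulrA -expr2 /m1 ler_pM ?(ltW w1_gt0) ?sqr_ge0//.
    by rewrite lerXn2r ?nnegrE ?sqrtr_ge0// !ler_wsqrtr.
  have g1 : M * (k0 (3 / 2) - k0 (1 / 2)) <= M * (K1 / m1 * (w * m)).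
    by rewrite ler_wpM2l// (le_trans k0K).
  have g2 : M * (W (arg X w (3 / 2)) - W (arg X w (1 / 2))) <= M * (K2 * (w * m)).
    by rewrite ler_wpM2l//; lra.
  have g3 : 0 <= M * K1 * (w * m) by rewrite mulr_ge0.
  rewrite /K; lra.
Qed.

End AmplitudeBounds.

(** * The phase and its second derivative *)

Section GalleryPhase.
Context {R : realType}.
Variables (kap w : R).
Hypothesis kap_gt0 : 0 < kap.
Hypothesis w_gt0 : 0 < w.
Implicit Types (x : R).

Let u x := cbrt x / kap.
Let S x := Num.sqrt (u x ^+ 2 + w).

(** With theta = x / h = u^3, the root of the eigenvalue theta^2 + w theta^(4/3) factors as u^2
    sqrt(u^2 + w). *)
Definition gallery_phase x := u x ^+ 2 * S x.
Definition gallery_phase' x := (3 * u x ^+ 2 + 2 * w) / (3 * kap ^+ 3 * u x * S x).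
Definition gallery_phase'' x :=
  - (w * (u x ^+ 2 + 2 * w) / (9 * kap ^+ 6 * u x ^+ 4 * S x ^+ 3)).

Let u_gt0 x : 0 < x -> 0 < u x.
Proof. by move=> x0; rewrite divr_gt0// cbrt_gt0. Qed.

Let S_gt0 x : 0 < S x.
Proof. by rewrite sqrtr_gt0 ltr_wpDl// sqr_ge0. Qed.

Let S2 x : S x ^+ 2 = u x ^+ 2 + w.
Proof. by rewrite sqr_sqrtr// addr_ge0 ?sqr_ge0// ltW. Qed.

Let du x : 0 < x -> is_derive x (1:R) u (3 * kap ^+ 3 * u x ^+ 2)^-1.
Proof.
move=> x0; have c0 := cbrt_gt0 x0.
have h := is_derive_lambdaM (is_derive_cbrt x0) (is_derive_lambda_cst kap^-1 x).
apply: (is_derive_eq h); rewrite /u; field.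
by rewrite !gt_eqF.
Qed.

Let dS x : 0 < x -> is_derive x (1:R) S (3 * kap ^+ 3 * u x * S x)^-1.
Proof.
move=> x0; have u0 := u_gt0 x0; have s0 := S_gt0 x.
have q0 : 0 < u x ^+ 2 + w by rewrite ltr_wpDl// sqr_ge0.
have h := @is_derive_lambda_comp _ Num.sqrt (fun x => u x ^+ 2 + w) x _ _
  (is_derive1_sqrt q0)
  (is_derive_lambdaD (is_derive_lambdaX 2 (du x0)) (is_derive_lambda_cst w x)).
apply: (is_derive_eq h); rewrite -/(S x) /=.
move: (u x) (S x) u0 s0 => v s v0 s0; field.
by rewrite !gt_eqF.
Qed.

Lemma is_derive_gallery_phase x : 0 < x -> is_derive x (1:R) gallery_phase (gallery_phase' x).
Proof.
move=> x0; have u0 := u_gt0 x0; have s0 := S_gt0 x.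
have h := is_derive_lambdaM (is_derive_lambdaX 2 (du x0)) (dS x0).
apply: (is_derive_eq h); rewrite /gallery_phase' /=.
(* Eliminating w makes the identity rational in the two quantities u and S. *)
have -> : w = S x ^+ 2 - u x ^+ 2 by rewrite S2; ring.
move: (u x) (S x) u0 s0 => v s v0 s0; field.
by rewrite !gt_eqF.
Qed.

Lemma is_derive_gallery_phase' x : 0 < x -> is_derive x (1:R) gallery_phase' (gallery_phase'' x).
Proof.
move=> x0; have u0 := u_gt0 x0; have s0 := S_gt0 x.
have d0 : 0 < 3 * kap ^+ 3 * u x * S x.
  by do 3 apply: mulr_gt0 => //; exact: exprn_gt0.
have h := is_derive_lambdaM
  (is_derive_lambdaD (is_derive_lambdaM (is_derive_lambda_cst 3 x) (is_derive_lambdaX 2 (du x0)))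
    (is_derive_lambda_cst (2 * w) x))
  (@is_derive_lambdaV _ (fun x => 3 * kap ^+ 3 * u x * S x) x _ (lt0r_neq0 d0)
    (is_derive_lambdaM (is_derive_lambdaM (is_derive_lambda_cst (3 * kap ^+ 3) x) (du x0)) (dS x0))).
apply: (is_derive_eq h); rewrite /gallery_phase'' /=.
have -> : w = S x ^+ 2 - u x ^+ 2 by rewrite S2; ring.
move: (u x) (S x) u0 s0 => v s v0 s0; field.
by rewrite !gt_eqF.
Qed.

(** Since u^2 + 2w >= S^2, minus the second derivative is at least w / (9 kap) divided by kap^5 u^4
    S = cbrt(x)^4 kap S. Here (kap S)^2 = cbrt(x)^2 + w kap^2 is bounded because w kap^2 <= 1, and
    the product is at most (36/25)^2 8/5 <= 4; hence 36. *)
Lemma gallery_phase''_le x : w * kap ^+ 2 <= 1 -> 1 / 2 <= x <= 3 / 2 ->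
  w / (36 * kap) <= - gallery_phase'' x.
Proof.
move=> wk xab; have x0 : 0 < x by case/andP: xab; lra.
have u0 := u_gt0 x0; have s0 := S_gt0 x; have c0 := cbrt_gt0 x0.
have /andP[c1 c2] := cbrt_bounds xab.
rewrite /gallery_phase'' opprK.
have c22 : cbrt x ^+ 2 <= 36 / 25.
  have : cbrt x ^+ 2 <= (6 / 5) ^+ 2 by rewrite lerXn2r// nnegrE; lra.
  lra.
have ks : kap * S x <= 8 / 5.
  rewrite -(@ler_pXn2r _ 2)// ?nnegrE ?mulr_ge0 ?(ltW s0) ?(ltW kap_gt0)//.
  rewrite exprMn S2 /u mulrDr expr_div_n mulrCA divff ?mulr1; last by rewrite gt_eqF// exprn_gt0.
  by rewrite mulrC in wk; lra.
have k4 : kap ^+ 5 * u x ^+ 4 * S x <= 4.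
  have -> : kap ^+ 5 * u x ^+ 4 * S x = (cbrt x ^+ 2) ^+ 2 * (kap * S x).
    by rewrite /u; field; rewrite gt_eqF.
  have h4 : (cbrt x ^+ 2) ^+ 2 <= (36 / 25) ^+ 2.
    by rewrite lerXn2r ?nnegrE ?sqr_ge0.
  have : (cbrt x ^+ 2) ^+ 2 * (kap * S x) <= (36 / 25) ^+ 2 * (8 / 5).
    by rewrite ler_pM ?sqr_ge0// mulr_ge0// ltW.
  lra.
have q0 : 0 < u x ^+ 2 + 2 * w by rewrite ltr_wpDl ?sqr_ge0// mulr_gt0.
have D0 : 0 < 9 * kap ^+ 6 * u x ^+ 4 * S x ^+ 3.
  by do 3 (apply: mulr_gt0; last exact: exprn_gt0).
rewrite ler_pdivlMr// mulrAC ler_pdivrMr ?mulr_gt0//.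
have h : S x ^+ 2 <= u x ^+ 2 + 2 * w by rewrite S2 lerD2l; have := w_gt0; lra.
have h2 : kap ^+ 5 * u x ^+ 4 * S x * S x ^+ 2 <= 4 * (u x ^+ 2 + 2 * w).
  apply: ler_pM => //; last exact: sqr_ge0.
  by apply: mulr_ge0; [apply: mulr_ge0; apply: exprn_ge0|]; exact: ltW.
have wk0 : 0 <= w * (9 * kap) by rewrite mulr_ge0// ?mulr_ge0// ltW.
have := ler_wpM2l wk0 h2.
rewrite (_ : w * (9 * kap) * (kap ^+ 5 * u x ^+ 4 * S x * S x ^+ 2)
  = w * (9 * kap ^+ 6 * u x ^+ 4 * S x ^+ 3)); last by ring.
by move/le_trans; apply; rewrite le_eqVlt; apply/orP; left; apply/eqP; ring.
Qed.

End GalleryPhase.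

Section GalleryOscillatoryIntegral.
Context {R : realType}.
Variables (y y' : R -> R) (w1 : R).
Hypothesis dy : forall x : R, is_derive x (1:R) y (y' x).
Hypothesis dy' : forall x : R, is_derive x (1:R) y' (x * y x).
Hypothesis y_decay : forall x, 0 < x -> `|y x| <= 1 / x.
Hypothesis zero_w1 : y (- w1) = 0.
Hypothesis zeros_le : forall x, y x = 0 -> x <= - w1.

(** The bounds are uniform in [b] and [c]: the space variable enters the phase linearly and does not
    affect its second derivative, and a constant shift of the phase turns cosines into sines. *)
Lemma gallery_oscillatory_bound (f f' : R -> R) (M : R) : 0 <= M ->
  (forall x : R, 1 / 2 <= x <= 3 / 2 -> is_derive x (1:R) f (f' x)) ->
  (forall x : R, 1 / 2 <= x <= 3 / 2 -> `|f x| <= M) ->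
  (forall x : R, 1 / 2 <= x <= 3 / 2 -> `|f' x| <= M) -> f (3 / 2) = 0 ->
  exists2 K, 0 < K & forall w, w1 <= w -> y (- w) = 0 -> forall X, 0 < X ->
  forall kap t b c, 0 < kap ->
  let I := \int[leb]_(x in `[1 / 2, 3 / 2])
    (cos (t * gallery_phase kap w x + b * x + c)
     * (f x * (cbrt x * y (cbrt x ^+ 2 * X - w)))) in
  `|I| <= K / Num.sqrt (Num.sqrt w) /\
  (w * kap ^+ 2 <= 1 -> t != 0 ->
   `|I| <= K / Num.sqrt (`|t| * (w / (36 * kap))) * (w * Num.sqrt (Num.sqrt w))).
Proof.
move=> M0 df fM f'M fb.
have w10 := airy_first_zero_gt0 dy dy' y_decay zero_w1 zeros_le.
have [K K0 KP] := airy_amplitude_bounds dy dy' y_decay zero_w1 zeros_le M0.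
have p1 : 1 <= 2 * pi + 1 :> R by rewrite lerDr mulr_ge0// pi_ge0.
have p0 : 0 <= 2 * pi + 1 :> R by lra.
exists ((2 * pi + 1) * K) => [|w ww1 yw X X0 kap t b c kap0].
  by rewrite mulr_gt0//; lra.
have w0 : 0 < w by exact: lt_le_trans ww1.
have [g' [k [k' [v [v' /= [d gk kK vK]]]]]] := KP _ ww1 yw _ X0 f f' df fM f'M.
set g := fun x => f x * (cbrt x * y (cbrt x ^+ 2 * X - w)).
pose P x := t * gallery_phase kap w x + b * x + c.
have pos (x : R) : 1 / 2 <= x <= 3 / 2 -> 0 < x by move=> /andP[]; lra.
have dP (x : R) : 1 / 2 <= x <= 3 / 2 -> is_derive x (1:R) P (t * gallery_phase' kap w x + b).
  move=> /pos x0.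
  have h := is_derive_lambdaD (is_derive_lambdaD
    (is_derive_lambdaM (is_derive_lambda_cst t x) (is_derive_gallery_phase kap0 w0 x0))
    (is_derive_lambda_linear b x)) (is_derive_lambda_cst c x).
  by apply: (is_derive_eq h); ring.
have dP' (x : R) : 1 / 2 <= x <= 3 / 2 ->
    is_derive x (1:R) (fun x => t * gallery_phase' kap w x + b) (t * gallery_phase'' kap w x).
  move=> /pos x0.
  have h := is_derive_lambdaD
    (is_derive_lambdaM (is_derive_lambda_cst t x) (is_derive_gallery_phase' kap0 w0 x0))
    (is_derive_lambda_cst b x).
  by apply: (is_derive_eq h); ring.
have ab : 1 / 2 <= 3 / 2 :> R by lra.
split.
  rewrite (@le_trans _ _ (k (3 / 2) - k (1 / 2)))//; last first.
    by rewrite (le_trans kK)// ler_wpM2r ?invr_ge0 ?sqrtr_ge0// ler_peMl// ltW.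
  apply: (@Rintegral_itv_le_primitive _ _ k k') => //.
  - move=> x xab; apply: cvgM.
      apply: continuous_comp; last exact: continuous_cos.
      exact: is_derive1_continuous (dP _ xab).
    have [dg _ _] := d _ xab; exact: is_derive1_continuous dg.
  - by move=> x /d[].
  - move=> x xab; rewrite normrM; have [gx _] := gk _ xab.
    by rewrite (le_trans _ gx)// ler_piMl// ler_norml cos_geN1 cos_le1.
move=> wk t0.
have gb : g (3 / 2) = 0 by rewrite /g fb mul0r.
have l0 : 0 < `|t| * (w / (36 * kap)).
  by rewrite mulr_gt0 ?normr_gt0// divr_gt0// mulr_gt0.
set l := `|t| * _ in l0 *.
have rl : 0 <= (2 * pi + 1) / Num.sqrt l by rewrite divr_ge0// sqrtr_ge0.
have key (Q Q' Q'' : R -> R) :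
  (forall x : R, 1 / 2 <= x <= 3 / 2 -> is_derive x (1:R) Q (Q' x)) ->
  (forall x : R, 1 / 2 <= x <= 3 / 2 -> is_derive x (1:R) Q' (Q'' x)) ->
  (forall x : R, 1 / 2 <= x <= 3 / 2 -> l <= Q'' x) ->
  `|\int[leb]_(x in `[1 / 2, 3 / 2]) (cos (Q x) * g x)|
    <= (2 * pi + 1) * K / Num.sqrt l * (w * Num.sqrt (Num.sqrt w)).
  move=> dQ dQ' lQ.
  have := @van_der_Corput_amplitude R Q Q' Q'' g g' v v' l _ _ ab l0 dQ dQ' lQ
    (fun x xab => let: And3 dg _ _ := d x xab in dg)
    (fun x xab => let: And3 _ _ dv := d x xab in dv)
    (fun x xab => (gk x xab).2) gb.
  move/le_trans; apply.
  have := ler_wpM2l rl vK; move/le_trans; apply.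
  by rewrite le_eqVlt; apply/orP; left; apply/eqP; ring.
(* The second derivative of [gallery_phase] is negative. For t >= 0 the phase is replaced by its
   opposite, the cosine being even. *)
have [tneg|tpos] := ltP t 0.
  apply: (key P _ _ dP dP') => x xab.
  rewrite /l ltr0_norm// -[leRHS]mulrNN ler_wpM2l ?oppr_ge0 ?(ltW tneg)//.
  exact: gallery_phase''_le.
have -> : \int[leb]_(x in `[1 / 2, 3 / 2]) (cos (t * gallery_phase kap w x + b * x + c) * g x)
   = \int[leb]_(x in `[1 / 2, 3 / 2]) (cos (- P x) * g x).
  by apply: eq_Rintegral => x _; rewrite cosN.
apply: (key (fun x => - P x) (fun x => - (t * gallery_phase' kap w x + b))
  (fun x => - (t * gallery_phase'' kap w x))).
- by move=> x xab; apply: is_derive_lambdaN; exact: dP.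
- by move=> x xab; exact: (is_derive_lambdaN (dP' x xab)).
- move=> x xab; rewrite /l ger0_norm// -mulrN ler_wpM2l//.
  exact: gallery_phase''_le.
Qed.

End GalleryOscillatoryIntegral.

(** * The L2 norm of a gallery mode *)

Section ModeParts.
Context {R : realType}.
Variables (psi : R -> R[i]) (omega : nat -> R) (k : nat) (h : R) (s : bool).
Implicit Types (t x y eta : R).

Let psi1 eta := complex.Re (psi eta).
Let psi2 eta := complex.Im (psi eta).
Let alpha t eta := (-1) ^+ s * t * Num.sqrt (gallery_eigval omega k (eta / h)).
Let E x eta := gallery_eigfun omega k x (eta / h).

(** Together with [mode_im], the integrand without its factor e^(i y eta / h), which plays the role
    of the Fourier kernel at scale 1/h. *)
Definition mode_re t x eta :=
  (cos (alpha t eta) * psi1 eta - sin (alpha t eta) * psi2 eta) * E x eta.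
Definition mode_im t x eta :=
  (sin (alpha t eta) * psi1 eta + cos (alpha t eta) * psi2 eta) * E x eta.

Lemma gallery_modeE t x y : gallery_mode psi omega k h s t x y =
  Complex (h^-1 * \int[leb]_eta (mode_re t x eta * cos (h^-1 * y * eta)
                                 - mode_im t x eta * sin (h^-1 * y * eta)))
          (h^-1 * \int[leb]_eta (mode_re t x eta * sin (h^-1 * y * eta)
                                 + mode_im t x eta * cos (h^-1 * y * eta))).
Proof.
rewrite /gallery_mode.
have e eta : h^-1 * y * eta = y * eta / h by ring.
rewrite (_ : cintegral _ = Complex
    (\int[leb]_eta (mode_re t x eta * cos (h^-1 * y * eta)
                     - mode_im t x eta * sin (h^-1 * y * eta)))
    (\int[leb]_eta (mode_re t x eta * sin (h^-1 * y * eta)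
                     + mode_im t x eta * cos (h^-1 * y * eta)))).
  by simpc.
rewrite /cintegral; congr Complex; apply: eq_Rintegral => eta _;
  rewrite e /mode_re /mode_im /psi1 /psi2 /E /alpha /expi;
  by case: (psi eta) => p q /=; ring.
Qed.
End ModeParts.

Lemma continuous_sqrD {R : realType} (f g : R -> R) : continuous f -> continuous g ->
  continuous (fun x => f x ^+ 2 + g x ^+ 2).
Proof. by move=> cf cg x; apply: cvgD; rewrite expr2; apply: cvgM; first [exact: cf|exact: cg]. Qed.

Section ModeNorm.
Context {R : realType}.
Variables (omega : nat -> R) (psi : R -> R[i]) (Ai' : R -> R).
Hypothesis Ho : airy_zeros omega.
Hypothesis Hpsi : smooth_supported (1 / 2) (3 / 2) psi.
Hypothesis dAi : forall x : R, is_derive x (1:R) (@Ai R) (Ai' x).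
Hypothesis dAi' : forall x : R, is_derive x (1:R) Ai' (x * Ai x).
Hypothesis Ai_decay : forall x : R, 0 < x -> `|Ai x| <= 1 / x.

Lemma Ai_zero k : (1 <= k)%N -> Ai (- omega k) = 0.
Proof.
move=> k1; have [_ e] := Ho.
suff : [set z | Ai z = 0] (- omega k) by [].
by rewrite -e; exists k.
Qed.

Lemma omega_ge1 k : (1 <= k)%N -> omega 1%N <= omega k.
Proof.
have [inc _] := Ho.
elim: k => [//|[_ _|k IH _]]; first by [].
by rewrite (le_trans (IH _))// ltW// inc.
Qed.

Lemma Ai_zeros_le (x : R) : Ai x = 0 -> x <= - omega 1%N.
Proof.
move=> Aix; have [_ e] := Ho.
have : [set z : R | Ai z = 0] x by [].
by rewrite -e => -[k /= k1 <-]; rewrite lerN2 omega_ge1.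
Qed.

Let zero1 := Ai_zero (leqnn 1).

Lemma omega_gt0 k : (1 <= k)%N -> 0 < omega k.
Proof.
move=> k1; apply: lt_le_trans (omega_ge1 k1).
exact: (airy_first_zero_gt0 dAi dAi' Ai_decay zero1 Ai_zeros_le).
Qed.

Let cAi : continuous (@Ai R).
Proof. by move=> x; exact: is_derive1_continuous (dAi x). Qed.

Lemma Ai'_zero_neq0 k : (1 <= k)%N -> Ai' (- omega k) != 0.
Proof.
move=> k1; have w0 := omega_gt0 k1.
have [K [c [_ c0 KP]]] := airy_bounds_negative dAi dAi' Ai_decay zero1 Ai_zeros_le.
have [up _ _] := KP _ (omega_ge1 k1).
have /andP[h _] := up (Ai_zero k1).
have : 0 < Ai' (- omega k) ^+ 2.
  by apply: lt_le_trans h; rewrite mulr_gt0// sqrtr_gt0.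
by apply: contraTneq => ->; rewrite expr0n/= ltxx.
Qed.

(** The energy at a x - w, divided by a, is a primitive of the integrand and vanishes at +oo; at x =
    0 the argument is a zero of Ai, where the energy is - Ai'(-w)^2. *)
Lemma integral_Ai_sqr k (a : R) : (1 <= k)%N -> 0 < a ->
  (\int[leb]_(x in `[0%R, +oo[) (Ai (a * x - omega k) ^+ 2)%:E
   = (Ai' (- omega k) ^+ 2 / a)%:E)%E.
Proof.
move=> k1 a0; pose F := airy_energy (@Ai R) Ai'.
have dF x : is_derive x (1:R) (fun x => a^-1 * F (a * x - omega k)) (Ai (a * x - omega k) ^+ 2).
  have h := is_derive_lambdaM (is_derive_lambda_cst a^-1 x)
    (@is_derive_lambda_comp _ F (fun x => a * x - omega k) x _ _
      (is_derive_airy_energy dAi dAi' _)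
      (is_derive_lambdaD (is_derive_lambda_linear a x) (is_derive_lambda_cst (- omega k) x))).
  by apply: (is_derive_eq h); rewrite /=; field; rewrite gt_eqF.
have f0 (x : R) : 0 <= x -> 0 <= Ai (a * x - omega k) ^+ 2 by move=> _; exact: sqr_ge0.
have dF0 (x : R) : 0 <= x ->
    is_derive x (1:R) (fun x => a^-1 * F (a * x - omega k)) (Ai (a * x - omega k) ^+ 2).
  by move=> _; exact: dF.
have cf : continuous (fun x => Ai (a * x - omega k) ^+ 2).
  have ca : continuous (fun x => Ai (a * x - omega k)).
    move=> x; apply: (@continuous_comp _ _ _ (fun x => a * x - omega k) (@Ai R)).
      by apply: cvgB; [apply: cvgM; [exact: cvg_cst|exact: cvg_id]|exact: cvg_cst].
    exact: cAi.
  by move=> x; apply: cvgM; exact: ca.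
have Fl : a^-1 * F (a * x - omega k) @[x --> +oo] --> (0 : R).
  rewrite -[X in _ --> X](mulr0 a^-1); apply: cvgM; first exact: cvg_cst.
  apply: (@cvg_comp _ _ _ (fun x => a * x - omega k) F); last first.
    exact: (airy_energy_cvg0 dAi dAi' Ai_decay).
  apply/cvgryPge => K; exists ((K + omega k) / a); split; first exact: num_real.
  by move=> y; rewrite ltr_pdivrMr// => yK; rewrite mulrC; lra.
rewrite (ge0_integral_itvcy_primitive f0 dF0 cf Fl).
rewrite mulr0 sub0r -EFinB /F airy_energy_oppE ?Ai_zero//.
by congr EFin; field; rewrite gt_eqF.
Qed.

(** Consequently the normalizing factor sqrt(2 pi) / sqrt(L') of the eigenfunctions is simply 1 /
    |Ai'(-w)|. *)
Lemma LprimeE k : (1 <= k)%N -> Lprime (omega k) = 2 * pi * Ai' (- omega k) ^+ 2.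
Proof.
move=> k1; rewrite /Lprime; congr (_ * _).
have e := @integral_Ai_sqr k 1 k1 ltr01; rewrite divr1 in e.
suff -> : \int[leb]_(x in `[0, +oo[) Ai (x - omega k) ^+ 2
    = fine (\int[leb]_(x in `[0%R, +oo[) (Ai (1 * x - omega k) ^+ 2)%:E)%E by rewrite e.
by apply: eq_Rintegral => x _; rewrite mul1r.
Qed.

Section FixedMode.
Variables (k : nat) (h : R) (s : bool).
Hypothesis k1 : (1 <= k)%N.
Hypothesis h0 : 0 < h.

Let w := omega k.
Let w0 : 0 < w. Proof. exact: omega_gt0. Qed.
Let kap := cbrt h.
Let kap0 : 0 < kap. Proof. exact: cbrt_gt0. Qed.
Let A1 := `|Ai' (- w)|.
Let A10 : 0 < A1. Proof. by rewrite normr_gt0; exact: Ai'_zero_neq0. Qed.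

Lemma gallery_eigfun_cbrt (x eta : R) : 0 < eta ->
  gallery_eigfun omega k x (eta / h)
  = (kap * A1)^-1 * (cbrt eta * Ai (cbrt eta ^+ 2 * (x / kap ^+ 2) - w)).
Proof.
move=> e0; have eh : 0 < eta / h by rewrite divr_gt0.
rewrite /gallery_eigfun LprimeE// (gtr0_norm eh).
rewrite -[_ `^ (1 / 3)]/(cbrt (eta / h)) -cbrtX ?ltW//.
have p2 : 0 <= 2 * pi :> R by rewrite mulr_ge0// pi_ge0.
rewrite cbrt_div// -/kap (sqrtrM _ p2) sqrtr_sqr -/w -/A1.
have p0 : 0 < Num.sqrt (2 * pi) :> R by rewrite sqrtr_gt0 mulr_gt0// pi_gt0.
rewrite (_ : (cbrt eta / kap) ^+ 2 * x = cbrt eta ^+ 2 * (x / kap ^+ 2)); last first.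
  by field; rewrite gt_eqF.
by field; rewrite !gt_eqF.
Qed.

Lemma gallery_eigval_cbrt (eta : R) : 0 < eta ->
  Num.sqrt (gallery_eigval omega k (eta / h)) = gallery_phase kap w eta.
Proof.
move=> e0; have eh : 0 < eta / h by rewrite divr_gt0.
rewrite /gallery_eigval (gtr0_norm eh) -[in X in X ^+ 2](cbrtK (ltW eh)).
rewrite -(cbrtX 4 (ltW eh)) cbrt_div// -/kap -/w /gallery_phase.
set u := cbrt eta / kap.
rewrite (_ : u ^+ 3 ^+ 2 + w * u ^+ 4 = (u ^+ 2) ^+ 2 * (u ^+ 2 + w)); last by ring.
by rewrite sqrtrM ?sqr_ge0// sqrtr_sqr ger0_norm ?sqr_ge0.
Qed.

Lemma continuous_pos_ext (f g : R -> R) : (forall x, 0 < x -> f x = g x) ->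
  (forall x, 0 < x -> {for x, continuous g}) -> forall x, 0 < x -> {for x, continuous f}.
Proof.
move=> fg cg x x0; rewrite /prop_for /continuous_at fg//.
apply: cvg_trans (cg _ x0); apply: near_eq_cvg; near=> z.
apply/esym/fg; near: z; exact: lt_nbhsr.
Unshelve. all: by end_near. Qed.

(** The support stays away from 0, where the fractional powers are not smooth, so only continuity at
    positive points has to be known. *)
Lemma continuous_supported (f : R -> R) :
  (forall x, x \notin `[1 / 2, 3 / 2] -> f x = 0) ->
  (forall x, 0 < x -> {for x, continuous f}) -> continuous f.
Proof.
move=> f0 cf x; have [x0|x0] := ltP 0 x; first exact: cf.
have fz z : z < 1 / 2 -> f z = 0.
  by move=> z2; rewrite f0// in_itv/= negb_and -ltNge z2.
rewrite /continuous_at fz; last lra.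
have c0 : (fun=> 0 : R) @ x --> (0 : R) by exact: cvg_cst.
apply: cvg_trans c0; apply: near_eq_cvg; near=> z.
apply/esym/fz; near: z.
exists (1 / 2) => [|z /=]; first by rewrite /=; lra.
by rewrite ltr_norml => /andP[]; lra.
Unshelve. all: by end_near. Qed.

Lemma smooth_continuous (f : R -> R) : smooth f -> continuous f.
Proof.
by move=> sf x; apply: differentiable_continuous; apply/derivable1_diffP; exact: (sf 0%N).
Qed.

Let psi1 eta := complex.Re (psi eta).
Let psi2 eta := complex.Im (psi eta).
Let cpsi1 : continuous psi1. Proof. by have [? _ _] := Hpsi; exact: smooth_continuous. Qed.
Let cpsi2 : continuous psi2. Proof. by have [_ ? _] := Hpsi; exact: smooth_continuous. Qed.
Let psi1_out x : x \notin `[1 / 2, 3 / 2] -> psi1 x = 0.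
Proof. by have [_ _ hp] := Hpsi; move=> /hp; rewrite /psi1 => ->. Qed.
Let psi2_out x : x \notin `[1 / 2, 3 / 2] -> psi2 x = 0.
Proof. by have [_ _ hp] := Hpsi; move=> /hp; rewrite /psi2 => ->. Qed.

Let E x eta := gallery_eigfun omega k x (eta / h).
Let alpha t eta := (-1) ^+ s * t * Num.sqrt (gallery_eigval omega k (eta / h)).

Let cE x eta : 0 < eta -> {for eta, continuous (E x)}.
Proof.
move: eta; apply: (continuous_pos_ext (gallery_eigfun_cbrt x)) => eta e0.
have cc : {for eta, continuous (@cbrt R)} by exact: is_derive1_continuous (is_derive_cbrt e0).
apply: cvgM; first exact: cvg_cst.
apply: cvgM; first exact: cc.
apply: (@continuous_comp _ _ _ (fun eta => cbrt eta ^+ 2 * (x / kap ^+ 2) - w) (@Ai R)); last exact: cAi.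
apply: cvgB; last exact: cvg_cst.
apply: cvgM; last exact: cvg_cst.
by rewrite expr2; apply: cvgM; exact: cc.
Qed.

Let calpha t eta : 0 < eta -> {for eta, continuous (alpha t)}.
Proof.
move: eta; apply: (@continuous_pos_ext _ (fun eta => (-1) ^+ s * t * gallery_phase kap w eta)).
  by move=> eta e0; rewrite /alpha gallery_eigval_cbrt.
move=> eta e0; apply: cvgM; first exact: cvg_cst.
exact: is_derive1_continuous (is_derive_gallery_phase kap0 w0 e0).
Qed.

Let cmode t x : continuous (mode_re psi omega k h s t x) /\ continuous (mode_im psi omega k h s t x).
Proof.
split; apply: continuous_supported.
- by move=> eta he; rewrite /mode_re -/(psi1 eta) -/(psi2 eta) psi1_out// psi2_out//; ring.
- move=> eta e0; apply: cvgM; last exact: cE.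
  apply: cvgB; apply: cvgM; try exact: cpsi1; try exact: cpsi2.
    by apply: continuous_comp; [exact: calpha|exact: continuous_cos].
  by apply: continuous_comp; [exact: calpha|exact: continuous_sin].
- by move=> eta he; rewrite /mode_im -/(psi1 eta) -/(psi2 eta) psi1_out// psi2_out//; ring.
- move=> eta e0; apply: cvgM; last exact: cE.
  apply: cvgD; apply: cvgM; try exact: cpsi1; try exact: cpsi2.
    by apply: continuous_comp; [exact: calpha|exact: continuous_sin].
  by apply: continuous_comp; [exact: calpha|exact: continuous_cos].
Qed.

Let mode_out t x eta : eta \notin `[1 / 2, 3 / 2] ->
  mode_re psi omega k h s t x eta = 0 /\ mode_im psi omega k h s t x eta = 0.
Proof.
move=> he; rewrite /mode_re /mode_im -/(psi1 eta) -/(psi2 eta) psi1_out// psi2_out//.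
by split; ring.
Qed.

Let N eta := psi1 eta ^+ 2 + psi2 eta ^+ 2.

(** The propagator acts as a rotation of angle [alpha t eta] and preserves the modulus: here the
    dependence on time disappears from the L2 norm. *)
Let mode_sqr t x eta : mode_re psi omega k h s t x eta ^+ 2 + mode_im psi omega k h s t x eta ^+ 2
  = N eta * E x eta ^+ 2.
Proof.
rewrite /mode_re /mode_im -/(alpha t eta) -/(E x eta) -/(psi1 eta) -/(psi2 eta) /N.
have := cos2Dsin2 (alpha t eta); move: (cos _) (sin _) => c d cd.
transitivity ((c ^+ 2 + d ^+ 2) * ((psi1 eta ^+ 2 + psi2 eta ^+ 2) * E x eta ^+ 2)).
  by ring.
by rewrite cd mul1r.
Qed.

Lemma normc_ge0 (z : R[i]) : 0 <= Normc.normc z.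
Proof. by case: z => a b; exact: sqrtr_ge0. Qed.

Lemma normc_sqr (a b : R) : Normc.normc (Complex a b) ^+ 2 = a ^+ 2 + b ^+ 2.
Proof. by rewrite /= sqr_sqrtr// addr_ge0 ?sqr_ge0. Qed.

Let mpow (p : R) : measurable_fun setT (fun eta : R => `|eta / h| `^ p).
Proof.
apply: (measurableT_comp (measurable_powR p)).
apply: (measurableT_comp (f := @Num.norm R R)) => //.
exact: measurable_funM.
Qed.

Let mE : measurable_fun setT (fun z : R * R => E z.1 z.2).
Proof.
rewrite /E /gallery_eigfun; apply: measurable_funM.
  apply: measurable_funM => //; apply: measurable_funM => //.
  exact: (measurableT_comp (mpow (1 / 3)) measurable_snd).
have mA := continuous_measurable_fun cAi.
apply: (measurableT_comp mA); apply: measurable_funB => //.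
apply: measurable_funM => //.
exact: (measurableT_comp (mpow (2 / 3)) measurable_snd).
Qed.

Let malpha t : measurable_fun setT (alpha t).
Proof.
rewrite /alpha; apply: measurable_funM => //.
have ms := continuous_measurable_fun (@sqrt_continuous R).
apply: (measurableT_comp ms); rewrite /gallery_eigval.
apply: measurable_funD; last by apply: measurable_funM => //; exact: mpow.
apply: measurable_funX; apply: (measurableT_comp (f := @Num.norm R R)) => //.
exact: measurable_funM.
Qed.

Let mpsi1 := continuous_measurable_fun cpsi1.
Let mpsi2 := continuous_measurable_fun cpsi2.
Let mcos := continuous_measurable_fun (@continuous_cos R).
Let msin := continuous_measurable_fun (@continuous_sin R).

Let mmode t : measurable_fun setT (fun z : R * R => mode_re psi omega k h s t z.1 z.2) /\
  measurable_fun setT (fun z : R * R => mode_im psi omega k h s t z.1 z.2).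
Proof.
have mc : measurable_fun setT (fun z : R * R => cos (alpha t z.2)).
  exact: (measurableT_comp mcos (measurableT_comp (malpha t) measurable_snd)).
have ms : measurable_fun setT (fun z : R * R => sin (alpha t z.2)).
  exact: (measurableT_comp msin (measurableT_comp (malpha t) measurable_snd)).
have m1 : measurable_fun setT (fun z : R * R => psi1 z.2).
  exact: (measurableT_comp mpsi1 measurable_snd).
have m2 : measurable_fun setT (fun z : R * R => psi2 z.2).
  exact: (measurableT_comp mpsi2 measurable_snd).
split; apply: measurable_funM; try exact: mE.
  by apply: measurable_funB; exact: measurable_funM.
by apply: measurable_funD; exact: measurable_funM.
Qed.

Let gallery_sqr t (z : R * R) : R :=
  Normc.normc (gallery_mode psi omega k h s t z.1 z.2) ^+ 2.

Lemma measurable_gallery_mode_sqr t : measurable_fun setT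
  (fun z : R * R => Normc.normc (gallery_mode psi omega k h s t z.1 z.2) ^+ 2).
Proof.
have [m1 m2] := mmode t.
have mx : measurable_fun setT (fun z : (R * R) * R => (z.1.1, z.2)).
  apply/measurable_fun_pairP; split => /=; last exact: measurable_snd.
  exact: (measurableT_comp measurable_fst measurable_fst).
have my : measurable_fun setT (fun z : (R * R) * R => z.1.2).
  exact: (measurableT_comp measurable_snd measurable_fst).
have mph : measurable_fun setT (fun z : (R * R) * R => h^-1 * z.1.2 * z.2).
  by apply: measurable_funM => //; apply: measurable_funM.
have mc := measurableT_comp mcos mph.
have ms := measurableT_comp msin mph.
have mr := measurableT_comp m1 mx.
have mi := measurableT_comp m2 mx.
have mP : measurable_fun setT (fun z : R * R => \int[leb]_eta
    (mode_re psi omega k h s t z.1 eta * cos (h^-1 * z.2 * eta)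
     - mode_im psi omega k h s t z.1 eta * sin (h^-1 * z.2 * eta))).
  apply: (@measurable_fun_Rintegral_parameter _ _ (measurableTypeR R * measurableTypeR R)%type
    (measurableTypeR R) R leb (fun z => mode_re psi omega k h s t z.1.1 z.2 * cos (h^-1 * z.1.2 * z.2)
     - mode_im psi omega k h s t z.1.1 z.2 * sin (h^-1 * z.1.2 * z.2))).
  by apply: measurable_funB; exact: measurable_funM.
have mQ : measurable_fun setT (fun z : R * R => \int[leb]_eta
    (mode_re psi omega k h s t z.1 eta * sin (h^-1 * z.2 * eta)
     + mode_im psi omega k h s t z.1 eta * cos (h^-1 * z.2 * eta))).
  apply: (@measurable_fun_Rintegral_parameter _ _ (measurableTypeR R * measurableTypeR R)%type
    (measurableTypeR R) R leb (fun z => mode_re psi omega k h s t z.1.1 z.2 * sin (h^-1 * z.1.2 * z.2)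
     + mode_im psi omega k h s t z.1.1 z.2 * cos (h^-1 * z.1.2 * z.2))).
  by apply: measurable_funD; exact: measurable_funM.
under eq_fun do rewrite gallery_modeE normc_sqr.
by apply: measurable_funD; apply: measurable_funX; exact: measurable_funM.
Qed.

Lemma integral_gallery_mode_sqr t x :
  (\int[leb]_y (Normc.normc (gallery_mode psi omega k h s t x y) ^+ 2)%:E
   = (2 * pi / h * \int[leb]_eta (N eta * E x eta ^+ 2))%:E)%E.
Proof.
have [c1 c2] := cmode t x.
have hV : 0 < h^-1 by rewrite invr_gt0.
have := @Plancherel R _ _ (1 / 2) (3 / 2) _ hV c1 c2 (fun eta he => (mode_out t x he).1)
  (fun eta he => (mode_out t x he).2).
pose P y := \int[leb]_eta (mode_re psi omega k h s t x eta * cos (h^-1 * y * eta)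
     - mode_im psi omega k h s t x eta * sin (h^-1 * y * eta)).
pose Q y := \int[leb]_eta (mode_re psi omega k h s t x eta * sin (h^-1 * y * eta)
     + mode_im psi omega k h s t x eta * cos (h^-1 * y * eta)).
rewrite -/(P _) -/(Q _) => PQ.
have nE (y : R) : Normc.normc (gallery_mode psi omega k h s t x y) ^+ 2
    = (h^-1 ^+ 2) * (P y ^+ 2 + Q y ^+ 2).
  by rewrite gallery_modeE normc_sqr !exprMn -mulrDr.
have PQE (y : R) : P y ^+ 2 + Q y ^+ 2
    = h ^+ 2 * Normc.normc (gallery_mode psi omega k h s t x y) ^+ 2.
  by rewrite nE mulrA -exprMn divff ?expr1n ?mul1r// gt_eqF.
have mPQ : measurable_fun setT (fun y => P y ^+ 2 + Q y ^+ 2).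
  under eq_fun do rewrite PQE; apply: measurable_funM => //.
  exact: (measurable_fun_pair2 x (measurable_gallery_mode_sqr t)).
transitivity (\int[leb]_y ((h^-1 ^+ 2)%:E * (P y ^+ 2 + Q y ^+ 2)%:E))%E.
  by apply: eq_integral => y _; rewrite nE EFinM.
rewrite ge0_integralZl//; last 3 first.
- exact/measurable_EFinP.
- by move=> y _; rewrite lee_fin addr_ge0 ?sqr_ge0.
- by rewrite lee_fin sqr_ge0.
rewrite PQ -EFinM; congr EFin.
under eq_Rintegral => eta _ do rewrite mode_sqr.
by field; rewrite gt_eqF.
Qed.

Let N_ge0 eta : 0 <= N eta.
Proof. by rewrite addr_ge0 ?sqr_ge0. Qed.

Let N_out eta : eta \notin `[1 / 2, 3 / 2] -> N eta = 0.
Proof. by move=> he; rewrite /N psi1_out// psi2_out// expr0n/= addr0. Qed.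

Let iNE x : leb.-integrable setT (EFin \o (fun eta => N eta * E x eta ^+ 2)).
Proof.
apply: (@compact_support_integrable R _ (1 / 2) (3 / 2)).
  have [c1 c2] := cmode 0 x.
  have -> : (fun eta => N eta * E x eta ^+ 2) = (fun eta =>
     mode_re psi omega k h s 0 x eta ^+ 2 + mode_im psi omega k h s 0 x eta ^+ 2).
    by apply/funext => eta; rewrite mode_sqr.
  exact: continuous_sqrD c1 c2.
by move=> eta he; rewrite (N_out he) mul0r.
Qed.

Let integral_E eta : eta \in `[1 / 2, 3 / 2] ->
  (\int[leb]_(x in `]0%R, +oo[) (E x eta ^+ 2)%:E = 1)%E.
Proof.
rewrite in_itv/= => /andP[e1 _]; have e0 : 0 < eta by lra.
have mEx : measurable_fun setT (fun x => E x eta ^+ 2).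
  by apply: measurable_funX; exact: (measurable_fun_pair1 eta mE).
rewrite integral_itv_obnd_cbnd; last by apply/measurable_EFinP; exact: measurable_funTS.
have u0 : 0 < cbrt eta / kap by rewrite divr_gt0// cbrt_gt0.
have a0 : 0 < (cbrt eta / kap) ^+ 2 by rewrite exprn_gt0.
transitivity (\int[leb]_(x in `[0%R, +oo[) (((cbrt eta / kap / A1) ^+ 2)%:E
    * (Ai ((cbrt eta / kap) ^+ 2 * x - omega k) ^+ 2)%:E))%E.
  apply: eq_integral => x _; rewrite /E gallery_eigfun_cbrt// -EFinM; congr EFin.
  rewrite (_ : cbrt eta ^+ 2 * (x / kap ^+ 2) = (cbrt eta / kap) ^+ 2 * x).
    by field; rewrite !gt_eqF.
  by field; rewrite gt_eqF.
have mA : measurable_fun setT (fun x => Ai ((cbrt eta / kap) ^+ 2 * x - omega k) ^+ 2).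
  apply: measurable_funX; apply: (measurableT_comp (continuous_measurable_fun cAi)).
  by apply: measurable_funB => //; exact: measurable_funM.
rewrite ge0_integralZl//; last 3 first.
- by apply/measurable_EFinP; exact: measurable_funTS.
- by move=> x _; rewrite lee_fin sqr_ge0.
- by rewrite lee_fin sqr_ge0.
rewrite integral_Ai_sqr// -EFinM; congr EFin.
rewrite -[Ai' _ ^+ 2](real_normK (num_real _)) -/w -/A1.
by field; rewrite !gt_eqF// cbrt_gt0.
Qed.

Let mNE : measurable_fun setT (fun z : R * R => N z.2 * E z.1 z.2 ^+ 2).
Proof.
apply: measurable_funM; last exact: measurable_funX.
apply: measurable_funD; apply: measurable_funX.
  exact: (measurableT_comp mpsi1 measurable_snd).
exact: (measurableT_comp mpsi2 measurable_snd).
Qed.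

Lemma Lr2_gallery_mode t :
  Lr_Omega2 2%:E (gallery_mode psi omega k h s t)
  = ((2 * pi / h * \int[leb]_eta (complex.Re (psi eta) ^+ 2 + complex.Im (psi eta) ^+ 2))%:E
     `^ 2^-1)%E.
Proof.
rewrite -/(\int[leb]_eta N eta).
(* The restriction to x > 0 is carried as a factor, so that after Tonelli's theorem it becomes the
   half-line on which e_k is normalized. *)
pose one : R -> R := \1_`]0%R, +oo[.
have mone : measurable_fun setT (fun z : R * R => one z.1).
  exact: (measurableT_comp (measurable_indic (measurable_itv _)) measurable_fst).
have oneE (x : R) : one x = (0 < x)%R%:R.
  by rewrite /one indicE; congr (_%:R); rewrite mem_setE in_itv/= andbT.
have N0 eta : 0 <= N eta by apply: addr_ge0; exact: sqr_ge0.
have one0 x : 0 <= one x by rewrite oneE.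
rewrite /Lr_Omega2 unlock; congr (_ `^ _)%E.
transitivity (\int[leb \x leb]_z (one z.1 * gallery_sqr t z)%:E)%E.
  apply: eq_integral => z _; rewrite patchE oneE.
  have [z0|z0] := boolP (0 < z.1).
    rewrite mem_set//= mul1r /gallery_sqr ger0_norm ?normc_ge0//.
    by rewrite powR_mulrn ?normc_ge0.
  by rewrite memNset//= ?normr0 ?powR0 ?mul0r//; exact/negP.
rewrite fubini_tonelli1; last 2 first.
- by apply/measurable_EFinP; exact: (measurable_funM mone (measurable_gallery_mode_sqr t)).
- by move=> z; rewrite lee_fin mulr_ge0// sqr_ge0.
rewrite /fubini_F.
have p0 : 0 <= 2 * pi / h by rewrite divr_ge0// ?mulr_ge0 ?pi_ge0// ltW.
transitivity (\int[leb]_x \int[leb]_eta (one x * (2 * pi / h * (N eta * E x eta ^+ 2)))%:E)%E.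
  apply: eq_integral => x _.
  transitivity ((one x)%:E * \int[leb]_y (gallery_sqr t (x, y))%:E)%E.
    rewrite -ge0_integralZl//.
    - by apply/measurable_EFinP; exact: (measurable_fun_pair2 x (measurable_gallery_mode_sqr t)).
    - by move=> y _; rewrite lee_fin sqr_ge0.
    - by rewrite lee_fin.
  rewrite /gallery_sqr/= integral_gallery_mode_sqr -EFinM mulrA.
  have iN := integrable_EFinZl (one x * (2 * pi / h)) measurableT (iNE x).
  under [RHS]eq_integral do rewrite mulrA.
  rewrite -(fineK (integrable_fin_num measurableT iN)); congr EFin.
  by rewrite -[RHS]/(Rintegral _ _ _) RintegralZl.
have mK : measurable_fun setT (fun z : R * R => one z.1 * (2 * pi / h * (N z.2 * E z.1 z.2 ^+ 2))).
  exact: (measurable_funM mone (measurable_funM (measurable_cst _) mNE)).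
rewrite (@fubini_tonelli _ _ _ _ _ leb leb
  (fun z => (one z.1 * (2 * pi / h * (N z.2 * E z.1 z.2 ^+ 2)))%:E)); last 2 first.
- exact/measurable_EFinP.
- move=> z; rewrite lee_fin; apply: mulr_ge0; first exact: one0.
  apply: mulr_ge0; first exact: p0.
  by apply: mulr_ge0; [exact: N0|exact: sqr_ge0].
transitivity (\int[leb]_eta (2 * pi / h * N eta)%:E)%E.
  apply: eq_integral => eta _ /=.
  have [he|he] := boolP (eta \in `[1 / 2, 3 / 2]); last first.
    rewrite (N_out he) mulr0 -[RHS](@integral0 _ _ _ leb setT); apply: eq_integral => x _.
    by rewrite mul0r !mulr0.
  transitivity ((2 * pi / h * N eta)%:E * \int[leb]_(x in `]0%R, +oo[) (E x eta ^+ 2)%:E)%E.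
    have mEx : measurable_fun setT (fun x => E x eta ^+ 2).
      by apply: measurable_funX; exact: (measurable_fun_pair1 eta mE).
    rewrite -ge0_integralZl//; last 3 first.
    - by apply/measurable_EFinP; exact: measurable_funTS.
    - by move=> x _; rewrite lee_fin sqr_ge0.
    - by rewrite lee_fin; apply: mulr_ge0; [exact: p0|exact: N0].
    rewrite [RHS]integral_mkcond; apply: eq_integral => x _; rewrite patchE oneE.
    rewrite mem_setE in_itv/= andbT; case: ifPn => x0; last by rewrite mul0r.
    by rewrite -EFinM; congr EFin; rewrite mul1r mulrA.
  by rewrite integral_E// mule1.
have iN : leb.-integrable setT (EFin \o N).
  apply: (@compact_support_integrable R _ (1 / 2) (3 / 2)) => //.
  exact: continuous_sqrD cpsi1 cpsi2.
rewrite -RintegralZl// /Rintegral fineK//.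
by apply: integrable_fin_num => //; exact: integrable_EFinZl.
Qed.

End FixedMode.
End ModeNorm.

(** * The dispersive bound *)

Section SmoothSupported.
Context {R : realType}.
Implicit Types f : R -> R.

Lemma continuous_bounded_itv f a b : a <= b -> continuous f ->
  exists2 M, 0 <= M & forall x, a <= x <= b -> `|f x| <= M.
Proof.
move=> ab cf; have [|c cab cM] := @EVT_max R (fun x => `|f x|) a b ab.
  by apply: continuous_subspaceT => x; apply: (@continuous_comp _ _ _ f); [exact: cf|exact: norm_continuous].
by exists `|f c| => // x xab; apply: cM; rewrite in_itv.
Qed.

Lemma smooth_is_derive f : smooth f -> forall x, is_derive x (1:R) f ((derive1 f) x).
Proof. by move=> sf x; rewrite derive1E; apply/derivableP; exact: (sf 0%N). Qed.

Lemma smooth_derive_continuous f : smooth f -> continuous (derive1 f).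
Proof.
by move=> sf x; apply: differentiable_continuous; apply/derivable1_diffP; exact: (sf 1%N).
Qed.

(** Continuity from the right at the end of the support; this kills the boundary term in van der
    Corput's lemma. *)
Lemma supported_endpoint f a b : continuous f ->
  (forall x, x \notin `[a, b] -> f x = 0) -> f b = 0.
Proof.
move=> cf f0; have : f x @[x --> b^'+] --> f b by apply: cvg_at_right_filter; exact: cf.
move/cvg_lim => <- //; apply: cvg_lim => //.
apply: (@cvg_trans _ (@cst R R 0 @ b^'+)); last exact: cvg_cst.
apply: near_eq_cvg; near=> x; rewrite f0// in_itv/= negb_and -!ltNge.
by apply/orP; right; near: x; exact: nbhs_right_gt.
Unshelve. all: by end_near. Qed.

End SmoothSupported.

(** * Pointwise bounds on a mode and their time integral *)

Section Pointwise.
Context {R : realType}.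
Variables (omega : nat -> R) (psi : R -> R[i]) (Ai' : R -> R).
Hypothesis Ho : airy_zeros omega.
Hypothesis Hpsi : smooth_supported (1 / 2) (3 / 2) psi.
Hypothesis dAi : forall x : R, is_derive x (1:R) (@Ai R) (Ai' x).
Hypothesis dAi' : forall x : R, is_derive x (1:R) Ai' (x * Ai x).
Hypothesis Ai_decay : forall x : R, 0 < x -> `|Ai x| <= 1 / x.

Let psi1 eta := complex.Re (psi eta).
Let psi2 eta := complex.Im (psi eta).

Let J (f : R -> R) kap w X t b c := \int[leb]_(x in `[1 / 2, 3 / 2])
  (cos (t * gallery_phase kap w x + b * x + c)
     * (f x * (cbrt x * Ai (cbrt x ^+ 2 * X - w)))).

Let J_bound : exists2 K, 0 < K & forall f, f = psi1 \/ f = psi2 ->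
  forall k, (1 <= k)%N -> let w := omega k in forall X, 0 < X ->
  forall kap t b c, 0 < kap -> let I := J f kap w X t b c in
  `|I| <= K / Num.sqrt (Num.sqrt w) /\
  (w * kap ^+ 2 <= 1 -> t != 0 ->
   `|I| <= K / Num.sqrt (`|t| * (w / (36 * kap))) * (w * Num.sqrt (Num.sqrt w))).
Proof.
have [s1 s2 out] := Hpsi.
have key f : smooth f -> (forall x, x \notin `[1 / 2, 3 / 2] -> f x = 0) ->
  exists2 K, 0 < K & forall k, (1 <= k)%N -> let w := omega k in forall X, 0 < X ->
  forall kap t b c, 0 < kap -> let I := J f kap w X t b c in
  `|I| <= K / Num.sqrt (Num.sqrt w) /\
  (w * kap ^+ 2 <= 1 -> t != 0 ->
   `|I| <= K / Num.sqrt (`|t| * (w / (36 * kap))) * (w * Num.sqrt (Num.sqrt w))).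
  move=> sf f0; have h12 : 1 / 2 <= 3 / 2 :> R by lra.
  have cf := smooth_continuous sf.
  have [M1 M10 fM1] := continuous_bounded_itv h12 cf.
  have [M2 M20 fM2] := continuous_bounded_itv h12 (smooth_derive_continuous sf).
  have le1 : M1 <= M1 + M2 by lra.
  have le2 : M2 <= M1 + M2 by lra.
  have zero1 := Ai_zero Ho (leqnn 1).
  have [K K0 KP] := gallery_oscillatory_bound dAi dAi' Ai_decay zero1 (Ai_zeros_le Ho)
    (le_trans M10 le1) (fun x _ => smooth_is_derive sf x)
    (fun x h => le_trans (fM1 x h) le1) (fun x h => le_trans (fM2 x h) le2)
    (supported_endpoint cf f0).
  exists K => // k k1 w X X0 kap t b c kap0.
  exact: (KP w (omega_ge1 Ho k1) (Ai_zero Ho k1) X X0 kap t b c kap0).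
have [K1 K10 P1] := key _ s1 (fun x h => congr1 (@complex.Re R) (out x h)).
have [K2 K20 P2] := key _ s2 (fun x h => congr1 (@complex.Im R) (out x h)).
exists (K1 + K2); first by rewrite addr_gt0.
have mono K : 0 <= K -> K <= K1 + K2 -> forall a b : R, 0 <= b ->
    K / Num.sqrt a * b <= (K1 + K2) / Num.sqrt a * b.
  by move=> K0 KK a b b0; rewrite ler_wpM2r// ler_wpM2r// invr_ge0 sqrtr_ge0.
have mono1 K : 0 <= K -> K <= K1 + K2 -> forall a : R, K / Num.sqrt a <= (K1 + K2) / Num.sqrt a.
  by move=> K0 KK a; have := mono _ K0 KK a 1 ler01; rewrite !mulr1.
have l1 : K1 <= K1 + K2 by lra.
have l2 : K2 <= K1 + K2 by lra.
move=> f [->|->] k k1 w X X0 kap t b c kap0; have w0 := omega_gt0 Ho dAi dAi' Ai_decay k1.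
  have [h1 h2] := P1 k k1 X X0 kap t b c kap0; split.
    by rewrite (le_trans h1)// mono1// ltW.
  move=> wk t0; rewrite (le_trans (h2 wk t0))// mono//; first exact: ltW.
  by rewrite mulr_ge0 ?sqrtr_ge0// ltW.
have [h1 h2] := P2 k k1 X X0 kap t b c kap0; split.
  by rewrite (le_trans h1)// mono1// ltW.
move=> wk t0; rewrite (le_trans (h2 wk t0))// mono//; first exact: ltW.
by rewrite mulr_ge0 ?sqrtr_ge0// ltW.
Qed.

Let A1 (k : nat) := `|Ai' (- omega k)|.

Let cpsi f : f = psi1 \/ f = psi2 -> continuous f.
Proof. by have [s1 s2 _] := Hpsi; case=> ->; exact: smooth_continuous. Qed.

Let cJ (f : R -> R) (kap w X t b c : R) : f = psi1 \/ f = psi2 -> 0 < kap -> 0 < w -> forall x : R,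
  1 / 2 <= x <= 3 / 2 -> {for x, continuous (fun x =>
    cos (t * gallery_phase kap w x + b * x + c) * (f x * (cbrt x * Ai (cbrt x ^+ 2 * X - w))))}.
Proof.
move=> fp kap0 w0 x /andP[x1 _]; have x0 : 0 < x by lra.
have cc : {for x, continuous (@cbrt R)} := is_derive1_continuous (is_derive_cbrt x0).
apply: cvgM.
  apply: (@continuous_comp _ _ _ (fun x => t * gallery_phase kap w x + b * x + c));
    last exact: continuous_cos.
  have h := is_derive_lambdaD (is_derive_lambdaD
    (is_derive_lambdaM (is_derive_lambda_cst t x) (is_derive_gallery_phase kap0 w0 x0))
    (is_derive_lambda_linear b x)) (is_derive_lambda_cst c x).
  exact: is_derive1_continuous h.
apply: cvgM; first exact: cpsi.
apply: cvgM; first exact: cc.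
apply: (@continuous_comp _ _ _ (fun x => cbrt x ^+ 2 * X - w) (@Ai R)).
  apply: cvgB; last exact: cvg_cst.
  by apply: cvgM; [rewrite expr2; apply: cvgM; exact: cc|exact: cvg_cst].
exact: is_derive1_continuous (dAi _).
Qed.

(** A sine is a cosine shifted by - pi/2, so the real and imaginary parts of a mode are combinations
    of four values of the same integral [J]. *)
Let gallery_mode_split (k : nat) (h : R) (s : bool) (t x y : R) : (1 <= k)%N -> 0 < h ->
  let J' (f : R -> R) := J f (cbrt h) (omega k) (x / cbrt h ^+ 2) ((-1) ^+ s * t) (h^-1 * y) in
  gallery_mode psi omega k h s t x y
  = Complex (h^-1 * ((cbrt h * A1 k)^-1 * (J' psi1 0 - J' psi2 (- (pi / 2)))))
            (h^-1 * ((cbrt h * A1 k)^-1 * (J' psi1 (- (pi / 2)) + J' psi2 0))).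
Proof.
move=> k1 h0 J'; rewrite gallery_modeE.
have [_ _ out] := Hpsi.
have w0 := omega_gt0 Ho dAi dAi' Ai_decay k1; have kap0 := cbrt_gt0 h0.
have iJ (f : R -> R) (c : R) : f = psi1 \/ f = psi2 ->
    leb.-integrable `[1 / 2, 3 / 2] (EFin \o (fun eta : R =>
    cos ((-1) ^+ s * t * gallery_phase (cbrt h) (omega k) eta + h^-1 * y * eta + c)
    * (f eta * (cbrt eta * Ai (cbrt eta ^+ 2 * (x / cbrt h ^+ 2) - omega k))))).
  by move=> fp; apply: continuous_integrable_itv; exact: cJ.
have i1 c := iJ psi1 c (or_introl erefl); have i2 c := iJ psi2 c (or_intror erefl).
rewrite !(@Rintegral_supported R _ (1 / 2) (3 / 2)).
- set F := fun (f : R -> R) (c eta : R) => cos ((-1) ^+ s * t * gallery_phase (cbrt h) (omega k) eta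
    + h^-1 * y * eta + c) * (f eta * (cbrt eta * Ai (cbrt eta ^+ 2 * (x / cbrt h ^+ 2) - omega k))).
  have iB : leb.-integrable `[1 / 2, 3 / 2]
      (EFin \o (fun eta => F psi1 0 eta - F psi2 (- (pi / 2)) eta)).
    apply: continuous_integrable_itv => z zab; apply: cvgB; apply: cJ => //; by [left|right].
  have iD : leb.-integrable `[1 / 2, 3 / 2]
      (EFin \o (fun eta => F psi1 (- (pi / 2)) eta + F psi2 0 eta)).
    apply: continuous_integrable_itv => z zab; apply: cvgD; apply: cJ => //; by [left|right].
  rewrite /J' /J -(@RintegralB _ _ _ leb _ _ _ (measurable_itv _) (i1 0) (i2 (- (pi / 2))))
    -(@RintegralD _ _ _ leb _ _ _ (measurable_itv _) (i1 (- (pi / 2))) (i2 0)).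
  rewrite -(@RintegralZl _ _ _ leb _ _ (cbrt h * A1 k)^-1 (measurable_itv _) iB)
    -(@RintegralZl _ _ _ leb _ _ (cbrt h * A1 k)^-1 (measurable_itv _) iD).
  have pos12 (z : R) : 1 / 2 <= z -> 0 < z by lra.
  congr Complex; congr (_ * _); apply: eq_Rintegral => eta;
    rewrite inE/= in_itv/= => /andP[e1 _]; have e0 : 0 < eta := pos12 _ e1;
    rewrite /F /mode_re /mode_im (gallery_eigfun_cbrt Ho dAi dAi' Ai_decay k1 h0 _ e0)
      (gallery_eigval_cbrt omega k h0 e0) -/(psi1 eta) -/(psi2 eta)
      cosBpihalf addr0 sinD cosD; ring.
- by move=> eta /out e; rewrite /mode_re /mode_im e/=; ring.
- by move=> eta /out e; rewrite /mode_re /mode_im e/=; ring.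
Qed.

Let normc_le (a b : R) : Normc.normc (Complex a b) <= `|a| + `|b|.
Proof.
rewrite -ler_sqr ?nnegrE ?normc_ge0 ?addr_ge0// normc_sqr sqrrD !real_normK ?num_real//.
by rewrite lerD2r lerDl mulrn_wge0// mulr_ge0.
Qed.

(** The factor 4 counts the four integrals; kap^-3 is the h^-1 in front of a mode, and kap^-1
    together with |Ai'(-w)|^-1 comes from the eigenfunction. *)
Let gallery_mode_le (k : nat) (h : R) (s : bool) (t x y B : R) : (1 <= k)%N -> 0 < h ->
  (forall (f : R -> R) (c : R), f = psi1 \/ f = psi2 ->
     `|J f (cbrt h) (omega k) (x / cbrt h ^+ 2) ((-1) ^+ s * t) (h^-1 * y) c| <= B) ->
  Normc.normc (gallery_mode psi omega k h s t x y) <= 4 / (cbrt h ^+ 4 * A1 k) * B.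
Proof.
move=> k1 h0 JB; rewrite gallery_mode_split//.
have kap0 := cbrt_gt0 h0.
have A10 : 0 < A1 k by rewrite normr_gt0; exact: (Ai'_zero_neq0 Ho dAi dAi' Ai_decay).
rewrite (le_trans (normc_le _ _))//.
have hE : h^-1 = (cbrt h ^+ 3)^-1 by rewrite cbrtK// ltW.
have c0 : 0 <= h^-1 * (cbrt h * A1 k)^-1 by rewrite mulr_ge0// invr_ge0 ltW// mulr_gt0.
have J1 := fun c => JB psi1 c (or_introl erefl).
have J2 := fun c => JB psi2 c (or_intror erefl).
rewrite !mulrA ![`|h^-1 * _ * _|]normrM (ger0_norm c0) -mulrDr.
apply: (@le_trans _ _ (h^-1 * (cbrt h * A1 k)^-1 * (B + B + (B + B)))).
  rewrite ler_wpM2l// lerD//.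
    by rewrite (le_trans (ler_normB _ _))// lerD.
  by rewrite (le_trans (ler_normD _ _))// lerD.
rewrite hE; move: (cbrt h) kap0 => kap kap0.
by rewrite le_eqVlt; apply/orP; left; apply/eqP; field; rewrite !gt_eqF.
Qed.

(** In the fourth power every root becomes an integral power: |Ai'(-w)|^4 >= c^2 w, and the two
    bounds on [J] contribute K^4 / w and 36^2 K^4 kap^2 w^3 / t^2. The second bound is multiplied by
    t^2 so that it includes t = 0 and can be added to the first. *)
Lemma gallery_mode_pow4 : exists2 D, 0 < D &
  forall (k : nat) (h : R) (s : bool) (t x y : R), (1 <= k)%N -> 0 < h -> 0 < x ->
  let kap := cbrt h in let w := omega k in
  let U := Normc.normc (gallery_mode psi omega k h s t x y) in
  U ^+ 4 <= D / (kap ^+ 16 * w ^+ 2) /\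
  (w * kap ^+ 2 <= 1 -> U ^+ 4 * t ^+ 2 <= D / (kap ^+ 16 * w ^+ 2) * (kap * w ^+ 2) ^+ 2).
Proof.
have [K K0 KP] := J_bound.
have [K2 [c [K20 c0 cP]]] := airy_bounds_negative dAi dAi' Ai_decay (Ai_zero Ho (leqnn 1)) (Ai_zeros_le Ho).
have n0 : 0 < 4 ^+ 4 * 36 ^+ 2 * K ^+ 4 / c ^+ 2.
  have q0 : 0 < 4 ^+ 4 * 36 ^+ 2 :> R by apply: mulr_gt0; apply: exprn_gt0; rewrite ltr0n.
  by apply: divr_gt0; [apply: mulr_gt0 => //; exact: exprn_gt0|exact: exprn_gt0].
exists (4 ^+ 4 * 36 ^+ 2 * K ^+ 4 / c ^+ 2) => [//|k h s t x y k1 h0 x0 kap w U].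
have w0 : 0 < w := omega_gt0 Ho dAi dAi' Ai_decay k1.
have kap0 : 0 < kap := cbrt_gt0 h0.
have [/(_ (Ai_zero Ho k1))/andP[cA _] _ _] := cP _ (omega_ge1 Ho k1).
have A10 : 0 < A1 k by rewrite normr_gt0; exact: (Ai'_zero_neq0 Ho dAi dAi' Ai_decay).
have sw0 : 0 < Num.sqrt w by rewrite sqrtr_gt0.
have A4 : c ^+ 2 * w <= A1 k ^+ 4.
  have -> : A1 k ^+ 4 = (Ai' (- w) ^+ 2) ^+ 2.
    by rewrite -(real_normK (num_real (Ai' (- w)))) -exprM.
  rewrite -[in leLHS](sqr_sqrtr (ltW w0)) -exprMn ler_pXn2r// nnegrE ?sqr_ge0//.
  by rewrite mulr_ge0// ltW.
have X0 : 0 < x / kap ^+ 2 by rewrite divr_gt0// exprn_gt0.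
have U0 : 0 <= U := normc_ge0 _.
have ww : Num.sqrt (Num.sqrt w) ^+ 4 = w.
  by rewrite (exprM _ 2 2) !sqr_sqrtr// ltW.
have fin B : U <= 4 / (kap ^+ 4 * A1 k) * B -> U ^+ 4 <= 4 ^+ 4 / (kap ^+ 16 * (c ^+ 2 * w)) * B ^+ 4.
  move=> UB; have : U ^+ 4 <= (4 / (kap ^+ 4 * A1 k) * B) ^+ 4.
    by rewrite ler_pXn2r// nnegrE// (le_trans U0).
  move/le_trans; apply.
  rewrite exprMn expr_div_n exprMn -exprM.
  rewrite ler_wpM2r//; first by rewrite (exprM _ 2 2) sqr_ge0.
  rewrite ler_pM2l ?exprn_gt0//.
  rewrite lef_pV2 ?posrE ?mulr_gt0 ?exprn_gt0//.
  by rewrite ler_pM2l ?exprn_gt0.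
have kn : kap != 0 by rewrite gt_eqF.
have wn : w != 0 by rewrite gt_eqF.
have cn : c != 0 by rewrite gt_eqF.
split.
  have := fin (K / Num.sqrt (Num.sqrt w)).
  rewrite expr_div_n ww => H; apply: le_trans (H _) _.
    apply: gallery_mode_le => // f c' fp.
    by have [] := KP f fp k k1 _ X0 kap ((-1) ^+ s * t) (h^-1 * y) c' kap0.
  rewrite [leRHS](_ : _ = 4 ^+ 4 / (kap ^+ 16 * (c ^+ 2 * w)) * (K ^+ 4 / w) * 36 ^+ 2); last first.
    by field; rewrite kn wn cn.
  have n36 : 1 <= 36 ^+ 2 :> R by rewrite -natrX ler1n.
  apply: ler_peMr n36; apply/ltW/mulr_gt0; apply: divr_gt0 => //; try exact: exprn_gt0.
  by apply: mulr_gt0; [|apply: mulr_gt0 => //]; exact: exprn_gt0.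
move=> wk; have [->|t0] := eqVneq t 0.
  rewrite expr0n/= mulr0; apply: mulr_ge0; last exact: sqr_ge0.
  apply/ltW/divr_gt0 => //; apply: mulr_gt0; exact: exprn_gt0.
have st : (-1) ^+ s * t != 0 by rewrite mulf_neq0// signr_eq0.
have nst : `|(-1) ^+ s * t| = `|t| by rewrite normrM normr_sign mul1r.
have l0 : 0 < `|t| * (w / (36 * kap)).
  by rewrite mulr_gt0 ?normr_gt0// divr_gt0// mulr_gt0.
have B4 : (K / Num.sqrt (`|t| * (w / (36 * kap))) * (w * Num.sqrt (Num.sqrt w))) ^+ 4
    = K ^+ 4 / (t ^+ 2 * (w / (36 * kap)) ^+ 2) * (w ^+ 4 * w).
  rewrite exprMn expr_div_n [(w * _) ^+ 4]exprMn ww (exprM (Num.sqrt _) 2 2).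
  by rewrite (sqr_sqrtr (ltW l0)) [(`|t| * _) ^+ 2]exprMn (real_normK (num_real t)).
have H := fin (K / Num.sqrt (`|t| * (w / (36 * kap))) * (w * Num.sqrt (Num.sqrt w))).
rewrite B4 in H.
feed H.
  apply: gallery_mode_le => // f c' fp.
  have [_] := KP f fp k k1 _ X0 kap ((-1) ^+ s * t) (h^-1 * y) c' kap0.
  by rewrite nst; apply.
apply: le_trans (ler_wpM2r (sqr_ge0 t) H) _.
by rewrite le_eqVlt; apply/orP; left; apply/eqP; field; rewrite t0 kn wn cn.
Qed.

(* If w kap^2 <= 1, the two bounds combine into a Cauchy kernel in t of width
   kap w^2; otherwise w^(-2) <= kap makes the first bound alone sufficient. *)
Lemma gallery_mode_majorant : exists2 D, 0 < D &
  forall (k : nat) (h : R) (s : bool), (1 <= k)%N -> 0 < h <= 1 ->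
  forall T : R, 0 < T -> exists b : R -> R,
  [/\ continuous b, forall t, 0 <= b t,
      (\int[leb]_(t in `[(- T)%R, T]) (b t)%:E <= (D * (1 + T) / h ^+ 5)%:E)%E
    & forall t x y : R, 0 < x -> Normc.normc (gallery_mode psi omega k h s t x y) ^+ 4 <= b t].
Proof.
have [D D0 DP] := gallery_mode_pow4.
have pi0 := @pi_gt0 R.
have p0 : 0 < 2 * pi :> R by rewrite mulr_gt0.
have p2 : 0 < 2 * pi + 2 :> R by lra.
(* 2 pi is the mass of the Cauchy kernel in the first case; 2 comes from the length 2T of the time
   interval in the second. *)
exists ((2 * pi + 2) * D) => [|k h s k1 /andP[h0 h1] T T0]; first exact: mulr_gt0.
set kap := cbrt h; set w := omega k.
have w0 : 0 < w := omega_gt0 Ho dAi dAi' Ai_decay k1.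
have kap0 : 0 < kap := cbrt_gt0 h0.
have kE : kap ^+ 3 = h by rewrite cbrtK// ltW.
have kn : kap != 0 by rewrite gt_eqF.
have wn : w != 0 by rewrite gt_eqF.
pose a := D / (kap ^+ 16 * w ^+ 2).
have a0 : 0 < a by rewrite divr_gt0// mulr_gt0 ?exprn_gt0.
have h5 : 0 < h ^+ 5 by exact: exprn_gt0.
have hk : h ^+ 5 = kap ^+ 15 by rewrite -kE -exprM.
have [wk|wk] := leP (w * kap ^+ 2) 1.
  pose e := kap * w ^+ 2; have e0 : 0 < e by rewrite mulr_gt0// exprn_gt0.
  have De (t : R) : 0 < e ^+ 2 + (1 * (0 - t)) ^+ 2 by rewrite ltr_pwDl ?sqr_ge0// exprn_gt0.
  (* Adding the two bounds gives |u|^4 (e^2 + t^2) <= 2 a e^2, hence this multiple of the Cauchy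
     kernel. Its total mass 2 pi a e = 2 pi D / kap^15 no longer contains w. *)
  pose b t := (a * e) * (2 * e / (e ^+ 2 + (1 * (0 - t)) ^+ 2)).
  have ae0 : 0 <= a * e by rewrite mulr_ge0// ltW.
  have b0 t : 0 <= b t.
    by rewrite mulr_ge0// divr_ge0 ?(ltW (De t))// mulr_ge0// ltW.
  have cb : continuous b.
    move=> t; apply: cvgM; first exact: cvg_cst.
    apply: cvgM; first exact: cvg_cst.
    apply: cvgV; first by rewrite gt_eqF.
    apply: cvgD; first exact: cvg_cst.
    by rewrite expr2; apply: cvgM; (apply: cvgM; [exact: cvg_cst|]; apply: cvgB; [exact: cvg_cst|exact: cvg_id]).
  exists b; split => //.
    have mb : measurable_fun setT b by exact: continuous_measurable_fun.
    apply: (@le_trans _ _ (\int[leb]_t (b t)%:E)%E).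
      apply: ge0_subset_integral => //; first exact/measurable_EFinP.
      by move=> t _; rewrite lee_fin.
    have mb2 : measurable_fun setT (fun t : R => 2 * e / (e ^+ 2 + (1 * (0 - t)) ^+ 2)).
      have -> : (fun t : R => 2 * e / (e ^+ 2 + (1 * (0 - t)) ^+ 2)) = (fun t => (a * e)^-1 * b t).
        by apply/funext => t; rewrite mulKf// gt_eqF// mulr_gt0.
      exact: measurable_funM.
    have -> : (\int[leb]_t (b t)%:E
        = (a * e)%:E * \int[leb]_t (2 * e / (e ^+ 2 + (1 * (0 - t)) ^+ 2))%:E)%E.
      rewrite -ge0_integralZl//; first exact/measurable_EFinP.
      by move=> t _; rewrite lee_fin divr_ge0 ?(ltW (De t))// mulr_ge0// ltW.
    rewrite integral_Cauchy_kernel// -EFinM lee_fin hk.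
    rewrite (_ : a * e * _ = 2 * pi * D / kap ^+ 15); last first.
      by rewrite /a /e; field; rewrite kn wn.
    rewrite ler_pM2r ?invr_gt0 ?exprn_gt0//.
    rewrite [leLHS]mulrC [leRHS]mulrAC [leRHS]mulrC ler_pM2l//.
    by move: (2 * pi) p0 => P P0; nra.
  move=> t x y x0; have [U1 U2] := DP k h s t x y k1 h0 x0.
  rewrite /b mulrA ler_pdivlMr ?De//.
  have := U2 wk; have := ler_wpM2r (sqr_ge0 e) U1.
  rewrite -/kap -/w -/a -/e; set U := Normc.normc _ ^+ 4 => h3 h4.
  by rewrite mul1r sub0r sqrrN; lra.
exists (fun=> a); split => //.
- by move=> t; exact: cvg_cst.
- by move=> t; exact: ltW.
- rewrite integral_cst//= lebesgue_measure_itv/= lte_fin ifT; last lra.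
  rewrite -EFinB -EFinM lee_fin hk.
  (* kap^15 <= kap^12 because kap <= 1, and kap^12 <= kap^16 w^2 because w kap^2 >= 1. *)
  have ak : a <= D / kap ^+ 15.
    rewrite /a ler_pM2l// lef_pV2 ?posrE ?mulr_gt0 ?exprn_gt0//.
    have k1' : kap <= 1.
      rewrite leNgt; apply/negP => k1'.
      by have : 1 < kap ^+ 3; [rewrite exprn_egt1|rewrite kE ltNge h1].
    have wk2 : 1 <= (w * kap ^+ 2) ^+ 2 by rewrite exprn_ege1// ltW.
    apply: (@le_trans _ _ (kap ^+ 12 * (w * kap ^+ 2) ^+ 2)).
      apply: (@le_trans _ _ (kap ^+ 12 * 1)); last by rewrite ler_wpM2l// exprn_ge0// ltW.
      by rewrite mulr1 ler_wiXn2l// ltW.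
    by rewrite le_eqVlt; apply/orP; left; apply/eqP; ring.
  apply: (@le_trans _ _ (D / kap ^+ 15 * (T - - T))).
    by rewrite ler_wpM2r//; lra.
  have q0 : 0 < D / kap ^+ 15 by rewrite divr_gt0// exprn_gt0.
  rewrite [leRHS](_ : _ = D / kap ^+ 15 * ((2 * pi + 2) * (1 + T))); last by ring.
  by rewrite ler_pM2l//; move: (2 * pi) p0 => P P0; nra.
- by move=> t x y x0; have [] := DP k h s t x y k1 h0 x0.
Qed.

End Pointwise.

(** * Mixed Lebesgue norms *)

Section MixedNorms.
Context {R : realType}.
Implicit Types (v : R -> R -> R[i]) (f : R -> R -> R -> R[i]).

(* Stated without measurability: the norm of a mode need not be shown to be a
   measurable function of time. *)
Lemma ge0_le_integralT d (X : measurableType d) (mu : {measure set X -> \bar R})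
    (f g : X -> \bar R) : (forall x, (0 <= f x)%E) -> (forall x, (f x <= g x)%E) ->
  (\int[mu]_x f x <= \int[mu]_x g x)%E.
Proof.
move=> f0 fg; rewrite !ge0_integralTE//; last by move=> x; exact: le_trans (fg x).
by apply: ereal_sup_le => _ [u uf <-]; exists u => // x; exact: le_trans (uf x) (fg x).
Qed.

Lemma le_poweR (x y : \bar R) (p : R) : 0 <= p -> (0 <= x)%E -> (x <= y)%E ->
  (x `^ p <= y `^ p)%E.
Proof.
move=> p0 x0 xy; apply: gt0_ler_poweR => //.
  by rewrite in_itv/= x0 leey.
by rewrite in_itv/= (le_trans x0 xy) leey.
Qed.

Lemma Lr_Omega2_ge0 r v : (0 <= Lr_Omega2 r v)%E.
Proof. exact: Lnorm_ge0. Qed.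

(** In the application [c] is the conserved power of the L2 norm and [b] the time-dependent majorant
    of the fourth power of the sup norm. *)
Lemma Lq_Lr_fin_le (q : R) r f (b : R -> R) (c B T : R) : 0 < q -> 0 <= c -> 0 <= B ->
  continuous b -> (forall t, 0 <= b t) ->
  (\int[leb]_(t in `[(- T)%R, T]) (b t)%:E <= B%:E)%E ->
  (forall t, (Lr_Omega2 r (f t) `^ q <= (c * b t)%:E)%E) ->
  (Lq_Lr T q%:E r f <= ((c * B) `^ q^-1)%:E)%E.
Proof.
move=> q0 c0 B0 cb b0 bB fb; rewrite /Lq_Lr unlock -poweR_EFin.
apply: le_poweR; first by rewrite invr_ge0 ltW.
  by apply: integral_ge0 => t _; exact: poweR_ge0.
apply: (@le_trans _ _ (\int[leb]_t ((fun t => (c * b t)%:E) \_ `[(- T)%R, T]) t)%E).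
  apply: ge0_le_integralT => t; first exact: poweR_ge0.
  rewrite !patchE; case: ifPn => _; last by rewrite abse0 poweR0r// gt_eqF.
  by rewrite gee0_abs ?Lr_Omega2_ge0.
have mb := continuous_measurable_fun cb.
rewrite -integral_mkcond.
rewrite (_ : \int[leb]_(t in `[(- T)%R, T]) _ = c%:E * \int[leb]_(t in `[(- T)%R, T]) (b t)%:E)%E.
  by rewrite EFinM lee_wpmul2l// lee_fin.
rewrite -ge0_integralZl//.
- by apply/measurable_EFinP; exact: measurable_funTS.
- by move=> t _; rewrite lee_fin.
Qed.

Lemma Lq_Lr_inf_le r f (A T : R) : 0 <= A -> (forall t, (Lr_Omega2 r (f t) <= A%:E)%E) ->
  (Lq_Lr T +oo%E r f <= A%:E)%E.
Proof.
move=> A0 fA; rewrite /Lq_Lr unlock; case: ifPn => _; last by rewrite lee_fin.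
apply/ess_supP/aeW => t /=; rewrite patchE; case: ifPn => _.
  by rewrite gee0_abs ?Lr_Omega2_ge0.
by rewrite abse0 lee_fin.
Qed.

Lemma Lr_Omega2_inf_le v (M : R) : 0 <= M ->
  (forall x y, 0 < x -> Normc.normc (v x y) <= M) -> (Lr_Omega2 +oo%E v <= M%:E)%E.
Proof.
move=> M0 vM; rewrite /Lr_Omega2 unlock; case: ifPn => _; last by rewrite lee_fin.
apply/ess_supP/aeW => -[x y] /=; rewrite patchE; case: ifPn => [|_].
  by rewrite inE/= => x0; rewrite lee_fin ger0_norm ?vM// normc_ge0.
by rewrite abse0 lee_fin.
Qed.

(** Pointwise |v|^r <= M^(r - 2) |v|^2, and the integral of |v|^2 over [Omega2] is A^2. *)
Lemma Lr_Omega2_interpolation v (r M A : R) : 2 <= r -> 0 <= M -> 0 <= A ->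
  measurable_fun setT (fun z : R * R => Normc.normc (v z.1 z.2) ^+ 2) ->
  Lr_Omega2 2%:E v = A%:E ->
  (forall x y, 0 < x -> Normc.normc (v x y) <= M) ->
  (Lr_Omega2 r%:E v <= ((M `^ (r - 2) * A ^+ 2) `^ r^-1)%:E)%E.
Proof.
move=> r2 M0 A0 mv vA vM; have r0 : 0 < r by lra.
rewrite /Lr_Omega2 unlock -poweR_EFin.
apply: le_poweR; first by rewrite invr_ge0 ltW.
  by apply: integral_ge0 => t _; exact: poweR_ge0.
pose S (z : R * R) : R := (0 < z.1)%R%:R * Normc.normc (v z.1 z.2) ^+ 2.
have S0 z : 0 <= S z by rewrite mulr_ge0 ?sqr_ge0.
have mS : measurable_fun setT S.
  apply: measurable_funM => //.
  pose one : R -> R := \1_`]0%R, +oo[.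
  have -> : (fun z : R * R => (0 < z.1)%R%:R) = (fun z => one z.1) :> (R * R -> R).
    by apply/funext => z; rewrite /one indicE mem_setE in_itv/= andbT.
  exact: (measurableT_comp (measurable_indic (measurable_itv _)) measurable_fst).
have AE : (\int[leb \x leb]_z (S z)%:E = (A ^+ 2)%:E)%E.
  have := congr1 (fun e => e `^ 2)%E vA.
  rewrite /Lr_Omega2 unlock -poweRrM mulVf// poweRe1; last first.
    by apply: integral_ge0 => t _; exact: poweR_ge0.
  rewrite poweR_EFin powR_mulrn// => <-; apply: eq_integral => z _.
  rewrite patchE /S; case: ifPn; rewrite ?inE/= => z0.
    by rewrite z0 mul1r ger0_norm ?normc_ge0// powR_mulrn ?normc_ge0.
  rewrite (_ : (0 < z.1)%R = false); last first.
    by apply/negP => h; move: z0; rewrite notin_setE.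
  by rewrite mul0r normr0 powR0.
apply: (@le_trans _ _ (\int[leb \x leb]_z ((M `^ (r - 2))%:E * (S z)%:E))%E).
  apply: ge0_le_integralT => z; first exact: poweR_ge0.
  rewrite patchE; case: ifPn; rewrite ?inE/= => z0; last first.
    by rewrite normr0 powR0 ?gt_eqF// lee_fin mulr_ge0// powR_ge0.
  rewrite /S z0 mul1r ger0_norm ?normc_ge0// -EFinM lee_fin.
  set u := Normc.normc _; have u0 : 0 <= u := normc_ge0 _.
  have -> : u `^ r = u `^ (r - 2) * u ^+ 2.
    rewrite -powR_mulrn// -powRD ?subrK//.
    by rewrite (gt_eqF r0).
  rewrite ler_wpM2r ?sqr_ge0//; apply: ge0_ler_powR; rewrite ?nnegrE//; first lra.
  exact: vM.
rewrite ge0_integralZl//.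
- by rewrite AE -EFinM.
- exact/measurable_EFinP.
- by move=> z _; rewrite lee_fin.
- by rewrite lee_fin powR_ge0.
Qed.

End MixedNorms.

(** * From conservation and dispersion to the Strichartz estimates *)

Lemma Rintegral_continuous_gt0 {R : realType} (f : R -> R) (x0 : R) : continuous f ->
  (forall x, 0 <= f x) -> leb.-integrable setT (EFin \o f) -> 0 < f x0 ->
  0 < \int[leb]_x f x.
Proof.
move=> cf f0 fi fx0.
have f20 : 0 < f x0 / 2 by rewrite divr_gt0.
have /cvgrPdist_lt/(_ _ f20)/nbhs_ballP[e /= e0 fe] := cf x0.
have half z : z \in `[x0 - e / 2, x0 + e / 2] -> f x0 / 2 <= f z.
  rewrite in_itv/= => /andP[z1 z2].
  have /fe : ball x0 e z by rewrite /ball/= ltr_norml; apply/andP; split; lra.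
  by rewrite /= ltr_norml => /andP[]; lra.
rewrite -lte_fin fineK; last exact: integrable_fin_num fi.
apply: (@lt_le_trans _ _ (\int[leb]_(x in `[(x0 - e / 2)%R, (x0 + e / 2)%R]) (f x0 / 2)%:E)%E).
  rewrite integral_cst//= lebesgue_measure_itv/= lte_fin ifT; last lra.
  by rewrite -EFinB -EFinM lte_fin mulr_gt0//; lra.
rewrite [leLHS]integral_mkcond; apply: ge0_le_integralT => z; rewrite patchE; case: ifPn => //.
- by move=> _; rewrite lee_fin ltW.
- by rewrite inE => /half zf; rewrite lee_fin.
- by move=> _; rewrite lee_fin.
Qed.

Lemma gallery_mode_psi0 {R : realType} (psi : R -> R[i]) omega k (h : R) s t x y :
  (forall eta, psi eta = 0) -> gallery_mode psi omega k h s t x y = 0.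
Proof.
move=> psi0; rewrite gallery_modeE; apply/eqP; rewrite eq_complex/=; apply/andP.
have z (f : R -> R) : (forall eta, f eta = 0) -> h^-1 * \int[leb]_eta f eta = 0.
  move=> f0; rewrite (_ : f = cst 0); first by rewrite Rintegral_cst// mul0r mulr0.
  by apply/funext.
by split; apply/eqP/z => eta; rewrite /mode_re /mode_im psi0/=; ring.
Qed.

(** With A the L2 norm, A^4 = I^2 / h^2, so D / h^5 = (D / I^2) h^-3 A^4. Its power 1/q supplies the
    missing A^(4/q) and the factor h^(-3/q). Since 1 + D / I^2 >= 1, its power 1/q is at most
    itself, a bound independent of q. *)
Lemma interpolation_constant {R : realType} (I D h q : R) : 0 < I -> 0 < D -> 0 < h -> 1 <= q ->
  ((I / h) `^ 2^-1) `^ (1 - 4 / q) * (D / h ^+ 5) `^ q^-1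
  <= (1 + D / I ^+ 2) * h `^ (- (3 / q)) * (I / h) `^ 2^-1.
Proof.
move=> I0 D0 h0 q1; have q0 : 0 < q by lra.
have Ih : 0 < I / h by rewrite divr_gt0.
set A := (I / h) `^ 2^-1; have A0 : 0 < A by exact: powR_gt0.
have AE : A ^+ 4 = I ^+ 2 / h ^+ 2.
  rewrite -powR_mulrn ?ltW// -powRrM (_ : 2^-1 * 4 = 2%:R); last by field.
  by rewrite powR_mulrn ?expr_div_n// ltW.
have E0 : 0 < D / I ^+ 2 by rewrite divr_gt0 ?exprn_gt0.
have -> : D / h ^+ 5 = D / I ^+ 2 * (h ^- 3 * A ^+ 4).
  by rewrite AE; field; rewrite !gt_eqF.
have h30 : 0 <= h ^- 3 by rewrite invr_ge0 exprn_ge0// ltW.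
have A40 : 0 <= A ^+ 4 by rewrite exprn_ge0// ltW.
rewrite (powRM _ (ltW E0) (mulr_ge0 h30 A40)) (powRM _ h30 A40).
have -> : (h ^- 3) `^ q^-1 = h `^ (- (3 / q)).
  by rewrite -powR_invn ?ltW// -powRrM mulNr.
have -> : (A ^+ 4) `^ q^-1 = A `^ (4 / q).
  by rewrite -(powR_mulrn 4 (ltW A0)) -powRrM.
have -> : A `^ (1 - 4 / q) * ((D / I ^+ 2) `^ q^-1 * (h `^ (- (3 / q)) * A `^ (4 / q)))
    = (D / I ^+ 2) `^ q^-1 * h `^ (- (3 / q)) * (A `^ (1 - 4 / q) * A `^ (4 / q)) by ring.
rewrite -powRD ?subrK ?oner_eq0// (powRr1 (ltW A0)).
rewrite (ler_wpM2r (ltW A0))//. rewrite (ler_wpM2r (powR_ge0 _ _))//.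
have h1 : 1 <= 1 + D / I ^+ 2 by lra.
apply: (@le_trans _ _ ((1 + D / I ^+ 2) `^ q^-1)).
  by apply: ge0_ler_powR; rewrite ?nnegrE ?invr_ge0; lra.
by apply: ler1_powR => //; rewrite invf_le1.
Qed.

Lemma recip_fin {R : realType} (p : R) : 0 < p -> recip p%:E = p^-1.
Proof. by move=> p0; rewrite /recip /inve gt_eqF. Qed.

Lemma recip_pinfty {R : realType} : recip (+oo%E : \bar R) = 0.
Proof. by []. Qed.

Theorem theorem2 (R : realType) (omega : nat -> R) (psi : R -> complex R)
    (T : R) :
  airy_zeros omega -> smooth_supported (1 / 2) (3 / 2) psi -> 0 < T ->
  exists C : R, forall (q r : \bar R) (k : nat) (h : R) (s : bool),
    (4%:E <= q)%E -> (1%:E <= r)%E ->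
    recip q = 1 / 2 * (1 / 2 - recip r) ->
    (1 <= k)%N -> 0 < h <= 1 ->
    let beta := 2 * (1 / 2 - recip r) - recip q in
    (Lq_Lr T q r (gallery_mode psi omega k h s)
     <= (C * h `^ (- beta))%:E * Lr_Omega2 2%:E (gallery_mode psi omega k h s 0))%E.
Proof.
move=> Ho Hpsi T0.
(* The zero profile is set apart because the constant in the other case is divided by the square of
   the integral of |psi|^2. *)
have [psi0|/existsNP[x0 px0]] := pselect (forall x, psi x = 0).
  exists 0 => q r k h s q4 r1 _ _ _ /=; rewrite mul0r mul0e.
  have Lr0 t : Lr_Omega2 r (gallery_mode psi omega k h s t) = 0%E.
    rewrite /Lr_Omega2 -[RHS](Lnorm0 (leb \x leb)%E (p := r)).
      congr (Lnorm _ _ _); apply/funext => z; rewrite patchE.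
      by rewrite gallery_mode_psi0//= expr0n/= addr0 sqrtr0 if_same.
    by apply/negP => /eqP r0; move: r1; rewrite r0 lee_fin ler10.
  rewrite /Lq_Lr (_ : (_ \_ _) = cst 0%E); last first.
    by apply/funext => t; rewrite patchE Lr0 if_same.
  by rewrite Lnorm0//; apply/negP => /eqP q0; move: q4; rewrite q0 lee_fin lern0.
have [Ai' [dAi dAi' Ai_decay]] := @airy_equation R.
have [D D0 DP] := gallery_mode_majorant Ho Hpsi dAi dAi' Ai_decay.
have [s1 s2 out] := Hpsi.
set N := fun eta => complex.Re (psi eta) ^+ 2 + complex.Im (psi eta) ^+ 2.
have cN : continuous N by exact: continuous_sqrD (smooth_continuous s1) (smooth_continuous s2).
have N0 eta : 0 <= N eta by rewrite addr_ge0// sqr_ge0.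
have iN : leb.-integrable setT (EFin \o N).
  apply: (@compact_support_integrable R _ (1 / 2) (3 / 2)) => // eta /out e.
  by rewrite /N e/= expr0n addr0.
have Nx0 : 0 < N x0.
  rewrite lt_neqAle N0 andbT eq_sym paddr_eq0 ?sqr_ge0// !sqrf_eq0; apply/negP => /andP[/eqP a /eqP b].
  by apply: px0; apply/eqP; rewrite eq_complex/= a b eqxx.
pose I := 2 * pi * \int[leb]_eta N eta.
have I0 : 0 < I.
  by rewrite /I !mulr_gt0 ?pi_gt0//; exact: Rintegral_continuous_gt0 cN N0 iN Nx0.
have DT0 : 0 < D * (1 + T) by rewrite mulr_gt0//; lra.
exists (1 + D * (1 + T) / I ^+ 2) => q r k h s q4 r1 qr k1 h01; cbv zeta.
move betaE : (2 * (1 / 2 - recip r) - recip q) => beta.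
have /andP[h0 _] := h01.
set u := gallery_mode psi omega k h s.
set A := (I / h) `^ 2^-1.
have A0 : 0 <= A by exact: powR_ge0.
have C1 : 1 <= 1 + D * (1 + T) / I ^+ 2.
  by rewrite lerDl ltW// divr_gt0// exprn_gt0.
have L2 t : Lr_Omega2 2%:E (u t) = A%:E.
  rewrite (Lr2_gallery_mode Ho Hpsi dAi dAi' Ai_decay s k1 h0) poweR_EFin; congr (_ `^ _)%:E.
  by rewrite /I /N; ring.
have [b [cb b0 bB ub]] := DP k h s k1 h01 T T0.
have B0 : 0 < D * (1 + T) / h ^+ 5 by rewrite divr_gt0// exprn_gt0.
pose M t := b t `^ 4^-1.
have M0 t : 0 <= M t by exact: powR_ge0.
have uM t x y : 0 < x -> Normc.normc (u t x y) <= M t.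
  move=> x0'; have u0 : 0 <= Normc.normc (u t x y) := normc_ge0 _.
  rewrite (_ : Normc.normc (u t x y) = (Normc.normc (u t x y) ^+ 4) `^ 4^-1); last first.
    by rewrite -powR_mulrn// -powRrM divff// powRr1.
  by apply: ge0_ler_powR; rewrite ?nnegrE ?invr_ge0 ?exprn_ge0//; exact: ub.
rewrite L2 -EFinM.
(* For q = +oo admissibility forces r = 2 and beta = 0, and the estimate is the conservation of the
   L2 norm. *)
case: q q4 qr betaE => [q| |]// q4 qr betaE; last first.
  have r2 : r = 2%:E.
    case: r r1 qr {betaE} => [r| |]// r1; rewrite recip_pinfty; last by move=> ?; exfalso; lra.
    have r0 : 0 < r by move: r1; rewrite lee_fin; lra.
    rewrite (recip_fin r0) => e; congr EFin.
    by rewrite -[r]invrK (_ : r^-1 = 2^-1) ?invrK//; lra.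
  apply: (@le_trans _ _ A%:E); first by apply: Lq_Lr_inf_le => // t; rewrite r2 L2.
  rewrite lee_fin (_ : beta = 0) ?oppr0 ?powRr0 ?mulr1 ?ler_peMl//.
  by move: qr; rewrite -betaE recip_pinfty => qr; lra.
have q40 : 4 <= q by rewrite -lee_fin.
have q0 : 0 < q by lra.
have rq := recip_fin q0.
rewrite rq in qr.
have {}betaE : beta = 3 / q by rewrite -betaE rq; lra.
apply: (@le_trans _ _ (A `^ (1 - 4 / q) * (D * (1 + T) / h ^+ 5) `^ q^-1)%:E); last first.
  rewrite lee_fin betaE; apply: interpolation_constant => //; lra.
(* r = +oo forces q = 4: the time integral of the majorant applies directly, without
   interpolation. *)
case: r r1 qr {betaE} => [r| |]// r1; last first.
  rewrite recip_pinfty => e; have q4e : q = 4.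
    by rewrite -[q]invrK (_ : q^-1 = 4^-1) ?invrK//; lra.
  subst q; rewrite divff// subrr powRr0 mul1r.
  have := @Lq_Lr_fin_le R 4 +oo%E u b 1 (D * (1 + T) / h ^+ 5) T.
  rewrite mul1r; apply => //; first exact: ltW.
  move=> t; rewrite mul1r; apply: le_trans.
    by apply: le_poweR (Lr_Omega2_inf_le (M0 t) (uM t)); [|exact: Lr_Omega2_ge0].
  by rewrite poweR_EFin lee_fin /M -powRrM mulVf// powRr1.
have r10 : 1 <= r by rewrite -lee_fin.
have r0 : 0 < r by lra.
rewrite (recip_fin r0) => e.
have qv : 0 < q^-1 by rewrite invr_gt0.
have r2 : 2 <= r.
  by rewrite -[r]invrK -[leLHS]invrK lef_pV2 ?posrE ?invr_gt0//; lra.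
(* Interpolation bounds the power q of the norm at time t by M^((r - 2) q / r) A^(2 q / r). By
   admissibility (r - 2) q / r = 4, so the first factor is exactly [b t], and 2/r = 1 - 4/q gives
   the power of A required above. *)
have := @Lq_Lr_fin_le R q r%:E u b (A `^ (2 * q / r)) (D * (1 + T) / h ^+ 5) T.
have rr : r * r^-1 = 1 by rewrite divff// gt_eqF.
have qq : q * q^-1 = 1 by rewrite divff// gt_eqF.
rewrite powRM ?powR_ge0 ?(ltW B0)// -powRrM.
rewrite (_ : 2 * q / r * q^-1 = 1 - 4 / q); last first.
  transitivity (2 * r^-1 * (q * q^-1)); first by ring.
  by rewrite qq; lra.
apply => // t.
have mv := measurable_gallery_mode_sqr omega Hpsi dAi k h s t.
apply: le_trans.
  apply: le_poweR (Lr_Omega2_interpolation r2 (M0 t) A0 mv (L2 t) (uM t)).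
    exact: ltW.
  exact: Lr_Omega2_ge0.
have Mq : (M t `^ (r - 2)) `^ (r^-1 * q) = b t.
  rewrite /M -powRrM -powRrM (_ : 4^-1 * _ = 1) ?powRr1//.
  transitivity (4^-1 * (r * r^-1 - 2 * r^-1) * q); first by ring.
  rewrite rr (_ : 1 - 2 * r^-1 = 4 * q^-1); last lra.
  by rewrite mulrA mulVf// mul1r mulrC.
have Aq : (A ^+ 2) `^ (r^-1 * q) = A `^ (2 * q / r).
  by rewrite -(powR_mulrn 2 A0) -powRrM; congr (_ `^ _); ring.
by rewrite poweR_EFin lee_fin -powRrM (powRM _ (powR_ge0 _ _) (sqr_ge0 A)) Mq Aq mulrC.
Qed.
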